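(* Let $A$ be a non-negative commutative DG ring such that $\mathrm{H}_0(A)$ is Noetherian, $\mathrm{H}(A)$ is finitely generated over $\mathrm{H}_0(A)$, and the underlying graded ring $A^\natural$ is Noetherian. For each $X\in\mathsf{D}^f_b(A)$ and each full subcategory $\mathcal{G}\subseteq\mathsf{D}^f_b(A)$, the following are equivalent. (1) $\mathsf{level}^{\mathcal{G}}_{\mathsf{D}^f_b(A)}(X)<\infty$. (2) $\mathsf{level}^{\mathcal{G}_{\bar{\mathfrak{p}}}}_{\mathsf{D}^f_b(A_{\bar{\mathfrak{p}}})}(X_{\bar{\mathfrak{p}}})<\infty$ for each $\bar{\mathfrak{p}}\in\operatorname{Spec}(\mathrm{H}_0(A))$. (3) $\mathsf{level}^{\mathcal{G}_{\bar{\mathfrak{m}}}}_{\mathsf{D}^f_b(A_{\bar{\mathfrak{m}}})}(X_{\bar{\mathfrak{m}}})<\infty$ for each $\bar{\mathfrak{m}}\in\operatorname{maxSpec}(\mathrm{H}_0(A))$.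
   Context: DG rings are graded homologically (differential of degree $-1$). A DG ring is commutative if it is graded-commutative and $a^2=0$ for $a$ of odd degree; non-negative means $A_i=0$ for $i<0$. $\mathsf{D}(A)$ is the derived category of DG $A$-modules; $\mathsf{D}^f_b(A)$ is the full subcategory of those $X$ with $\mathrm{H}_i(X)=0$ for $|i|\gg0$ and every $\mathrm{H}_i(X)$ finitely generated over $\mathrm{H}_0(A)$. For $\bar{\mathfrak{p}}\in\operatorname{Spec}(\mathrm{H}_0(A))$ let $\mathfrak{p}=\pi^{-1}(\bar{\mathfrak{p}})$ with $\pi\colon A_0\to\mathrm{H}_0(A)$ canonical; $A_{\bar{\mathfrak{p}}}=A\otimes_{A_0}(A_0)_{\mathfrak{p}}$, $X_{\bar{\mathfrak{p}}}=X\otimes_{A_0}(A_0)_{\mathfrak{p}}$, and $\mathcal{G}_{\bar{\mathfrak{p}}}=\{G_{\bar{\mathfrak{p}}}\mid G\in\mathcal{G}\}$ as a full subcategory of $\mathsf{D}^f_b(A_{\bar{\mathfrak{p}}})$. $\operatorname{maxSpec}$ is the set of maximal ideals. Levels. For a full subcategory $\mathcal{G}$ of a triangulated category $\mathcal{S}$: $\mathsf{thick}^0_{\mathcal{S}}(\mathcal{G})=\{0\}$; $\mathsf{thick}^1_{\mathcal{S}}(\mathcal{G})$ is the smallest full subcategory containing $\mathcal{G}$ and closed under finite direct sums, direct summands and suspensions ($\Sigma^i$, $i\in\mathbb{Z}$); for $n\ge2$, $\mathsf{thick}^n_{\mathcal{S}}(\mathcal{G})$ consists of those $X$ that appear in an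 exact triangle $X_1\to X\oplus X'\to X_2\to\Sigma X_1$ with $X_1\in\mathsf{thick}^1_{\mathcal{S}}(\mathcal{G})$, $X_2\in\mathsf{thick}^{n-1}_{\mathcal{S}}(\mathcal{G})$. Then $\mathsf{level}^{\mathcal{G}}_{\mathcal{S}}(X)=\inf\{n\geq0\mid X\in\mathsf{thick}^n_{\mathcal{S}}(\mathcal{G})\}$ (infinite if there is no such $n$). *)

(* Defs.v *)
From HB Require Import structures.
From mathcomp Require Import all_boot all_order all_algebra.
From mathcomp Require Import boolp zify ring.

Set Implicit Arguments.
Unset Strict Implicit.
Unset Printing Implicit Defensive.

Import GRing.Theory.

Local Open Scope ring_scope.
Local Open Scope quotient_scope.

(* Rings are not assumed to be nontrivial. *)
Definition ideal (R : comPzRingType) (I : R -> Prop) : Prop :=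
  [/\ I 0, forall x y, I x -> I y -> I (x + y) & forall r x, I x -> I (r * x)].

Record primeIdeal (R : comPzRingType) := PrimeIdeal {
  prime_pred :> R -> Prop;
  prime_ideal : ideal prime_pred;
  prime_proper : ~ prime_pred 1;
  prime_mul : forall x y,
    prime_pred (x * y) -> prime_pred x \/ prime_pred y
}.

Definition maximalIdeal (R : comPzRingType) (I : R -> Prop) : Prop :=
  [/\ ideal I, ~ I 1 & forall J : R -> Prop, ideal J -> ~ J 1 ->
    (forall x, I x -> J x) -> forall x, J x -> I x].

Lemma maximal_prime (R : comPzRingType) (I : R -> Prop) :
  maximalIdeal I -> forall x y, I (x * y) -> I x \/ I y.
Proof.
move=> [[I0 ID IM] I1 Imax] x y Ixy; apply: contrapT => /not_orP [nx ny].
pose J z := exists r i, I i /\ z = r * x + i.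
have Jx : J x by exists 1, 0; split=> //; rewrite mul1r addr0.
apply: nx; apply: (Imax J) => //.
- split.
  + by exists 0, 0; split=> //; rewrite mul0r addr0.
  + move=> _ _ [r [i [Ii ->]]] [s [j [Ij ->]]]; exists (r + s), (i + j).
    by split; [apply: ID|rewrite mulrDl addrACA].
  + move=> t _ [r [i [Ii ->]]]; exists (t * r), (t * i).
    by split; [apply: IM|rewrite mulrDr mulrA].
- move=> [r [i [Ii e]]]; apply: ny.
  have -> : y = r * (x * y) + y * i.
    by rewrite -[LHS]mulr1 e; ring.
  by apply: ID; apply: IM.
- by move=> z Iz; exists 0, z; rewrite mul0r add0r.
Qed.

Definition noetherian (R : comPzRingType) : Prop :=
  forall I : R -> Prop, ideal I -> exists (n : nat) (g : 'I_n -> R),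
    (forall k, I (g k)) /\
    forall x, I x -> exists c : 'I_n -> R, x = \sum_k c k * g k.

Definition fin_gen (R : pzRingType) (M : lmodType R) : Prop :=
  exists (n : nat) (g : 'I_n -> M),
    forall x, exists c : 'I_n -> R, x = \sum_k c k *: g k.

Section Localization.
Variables (R : comPzRingType) (P : primeIdeal R).

Record primeC := PrimeC { den : R; _ : `[< ~ P den >] }.
HB.instance Definition _ := [isSub for den].
HB.instance Definition _ := [Choice of primeC by <:].

Lemma primeC_notin (s : primeC) : ~ P (den s).
Proof. exact: (asboolW (valP s)). Qed.

Fact primeC1_subproof : `[< ~ P 1 >].
Proof. by apply/asboolP; exact: (@prime_proper R P). Qed.
Definition primeC1 : primeC := PrimeC primeC1_subproof.

Fact primeCM_subproof (s t : primeC) : `[< ~ P (den s * den t) >].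
Proof. by apply/asboolP => /prime_mul [] /primeC_notin. Qed.
Definition primeCM (s t : primeC) : primeC := PrimeC (primeCM_subproof s t).

Lemma primeCMC s t : primeCM s t = primeCM t s.
Proof. by apply: val_inj; rewrite /= mulrC. Qed.
Lemma primeCMA s t u : primeCM s (primeCM t u) = primeCM (primeCM s t) u.
Proof. by apply: val_inj; rewrite /= mulrA. Qed.
Lemma primeC1M s : primeCM primeC1 s = s.
Proof. by apply: val_inj; rewrite /= mul1r. Qed.
Lemma primeCM1 s : primeCM s primeC1 = s.
Proof. by rewrite primeCMC primeC1M. Qed.

Section Module.
Variable M : lmodType R.

Lemma scale_eq (m a b k l : R) (x y : M) :
  a *: x = b *: y -> k = m * a -> l = m * b -> k *: x = l *: y.
Proof. by move=> e -> ->; rewrite -!scalerA e. Qed.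

Definition frac_eqv (a b : M * primeC) : bool :=
  `[< exists u : primeC, (den u * den b.2) *: a.1 = (den u * den a.2) *: b.1 >].

Lemma frac_eqv_equiv : equiv_class_of frac_eqv.
Proof.
split=> [a|a b|b a c]; first by apply/asboolP; exists primeC1.
  by apply: asbool_equiv_eq; split=> -[u e]; exists u.
move=> /asboolP [u e] /asboolP [v f]; apply/asboolP.
exists (primeCM (primeCM u v) b.2) => /=.
transitivity ((den u * den a.2 * den v * den c.2) *: b.1).
  by apply: (scale_eq (m := den v * den c.2) e); ring.
by apply: (scale_eq (m := den u * den a.2) f); ring.
Qed.
Canonical frac_eqv_rel := EquivRelPack frac_eqv_equiv.
Canonical frac_eqv_encModRel := defaultEncModRel frac_eqv.

Definition loc := {eq_quot frac_eqv}.
HB.instance Definition _ := Choice.on loc.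

Definition frac (x : M) (s : primeC) : loc := \pi_({eq_quot frac_eqv}) (x, s).

Lemma frac_eqP x s y t : frac x s = frac y t <->
  exists u : primeC, (den u * den t) *: x = (den u * den s) *: y.
Proof.
by split=> [/eqmodP /asboolP|e]; last by apply/eqmodP/asboolP.
Qed.

Lemma fracP (q : loc) : exists x s, q = frac x s.
Proof.
by exists (repr q).1, (repr q).2; rewrite /frac -surjective_pairing reprK.
Qed.

Lemma frac_cancel x s t : frac (den t *: x) (primeCM s t) = frac x s.
Proof. by apply/frac_eqP; exists primeC1; rewrite /= scalerA; congr (_ *: _); ring. Qed.

Lemma frac_common (p q : loc) : exists x y s, p = frac x s /\ q = frac y s.
Proof.
have [x [s ->]] := fracP p; have [y [t ->]] := fracP q.
exists (den t *: x), (den s *: y), (primeCM s t); rewrite frac_cancel.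
by rewrite primeCMC frac_cancel.
Qed.

Definition loc_lift (T : Type) (f : M -> primeC -> T) (q : loc) : T :=
  f (repr q).1 (repr q).2.

Lemma loc_liftE (T : Type) (f : M -> primeC -> T) :
  (forall x s y t, frac x s = frac y t -> f x s = f y t) ->
  forall x s, loc_lift f (frac x s) = f x s.
Proof.
by move=> fc x s; apply: fc; rewrite /frac -surjective_pairing reprK.
Qed.

Definition loc_add (p q : loc) : loc :=
  loc_lift (fun x s =>
    loc_lift (fun y t => frac (den t *: x + den s *: y) (primeCM s t)) q) p.
Definition loc_opp : loc -> loc := loc_lift (fun x s => frac (- x) s).
Definition loc_scale (r : R) : loc -> loc := loc_lift (fun x s => frac (r *: x) s).

Lemma loc_addE' x s y t :
  loc_add (frac x s) (frac y t) = frac (den t *: x + den s *: y) (primeCM s t).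
Proof.
have E x1 s1 y1 t1 : loc_lift (fun y t =>
      frac (den t *: x1 + den s1 *: y) (primeCM s1 t)) (frac y1 t1) =
    frac (den t1 *: x1 + den s1 *: y1) (primeCM s1 t1).
  rewrite loc_liftE // => y2 t2 y3 t3 /frac_eqP [u e]; apply/frac_eqP.
  exists u; rewrite /= !scalerDr !scalerA; congr (_ + _).
    by congr (_ *: _); ring.
  by apply: (scale_eq (m := den s1 * den s1) e); ring.
rewrite /loc_add loc_liftE ?E // => x2 s2 x3 s3 /frac_eqP [u e].
rewrite !E; apply/frac_eqP; exists u; rewrite /= !scalerDr !scalerA.
congr (_ + _); last by congr (_ *: _); ring.
by apply: (scale_eq (m := den t * den t) e); ring.
Qed.

Lemma loc_addE x y s : loc_add (frac x s) (frac y s) = frac (x + y) s.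
Proof. by rewrite loc_addE' -scalerDr frac_cancel. Qed.

Lemma loc_oppE x s : loc_opp (frac x s) = frac (- x) s.
Proof.
rewrite /loc_opp loc_liftE // => {x s} x s y t /frac_eqP [u e].
by apply/frac_eqP; exists u; rewrite !scalerN e.
Qed.

Lemma loc_scaleE r x s : loc_scale r (frac x s) = frac (r *: x) s.
Proof.
rewrite /loc_scale loc_liftE // => {x s} x s y t /frac_eqP [u e].
apply/frac_eqP; exists u; rewrite !scalerA.
by apply: (scale_eq (m := r) e); ring.
Qed.

Lemma frac0 s t : frac 0 s = frac 0 t.
Proof. by apply/frac_eqP; exists primeC1; rewrite !scaler0. Qed.

Lemma loc_addA : associative loc_add.
Proof.
move=> p q r; have [x [s ->]] := fracP p; have [y [z [t [-> ->]]]] := frac_common q r.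
rewrite loc_addE !loc_addE' -(frac_cancel _ _ t); congr frac.
by rewrite /= !scalerDr !scalerA; rewrite addrA; congr (_ + _ + _); congr (_ *: _); ring.
Qed.
Lemma loc_addC : commutative loc_add.
Proof.
by move=> p q; have [x [y [s [-> ->]]]] := frac_common p q; rewrite !loc_addE addrC.
Qed.
Lemma loc_add0 : left_id (frac 0 primeC1) loc_add.
Proof.
by move=> p; have [x [s ->]] := fracP p; rewrite (frac0 _ s) loc_addE add0r.
Qed.
Lemma loc_addN : left_inverse (frac 0 primeC1) loc_opp loc_add.
Proof.
move=> p; have [x [s ->]] := fracP p.
by rewrite loc_oppE loc_addE addNr; exact: frac0.
Qed.
HB.instance Definition _ :=
  GRing.isZmodule.Build loc loc_addA loc_addC loc_add0 loc_addN.

Lemma fracD x y s : frac (x + y) s = frac x s + frac y s.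
Proof. by rewrite -loc_addE. Qed.
Lemma fracN x s : frac (- x) s = - frac x s.
Proof. by rewrite -loc_oppE. Qed.
Lemma frac_0 s : frac 0 s = 0.
Proof. exact: frac0. Qed.
Lemma fracB x y s : frac (x - y) s = frac x s - frac y s.
Proof. by rewrite fracD fracN. Qed.
Lemma frac_sum (I : Type) (r : seq I) (Q : pred I) (F : I -> M) s :
  frac (\sum_(i <- r | Q i) F i) s = \sum_(i <- r | Q i) frac (F i) s.
Proof. by apply: (big_morph (frac^~ s)) => [x y|]; [exact: fracD|exact: frac_0]. Qed.

Lemma loc_scaleA a b q : loc_scale a (loc_scale b q) = loc_scale (a * b) q.
Proof. by have [x [s ->]] := fracP q; rewrite !loc_scaleE scalerA. Qed.
Lemma loc_scale1 : left_id 1 loc_scale.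
Proof. by move=> q; have [x [s ->]] := fracP q; rewrite loc_scaleE scale1r. Qed.
Lemma loc_scaleDr : right_distributive loc_scale +%R.
Proof.
move=> r p q; have [x [y [s [-> ->]]]] := frac_common p q.
by rewrite -fracD !loc_scaleE scalerDr fracD.
Qed.
Lemma loc_scaleDl q : {morph loc_scale^~ q : a b / a + b}.
Proof.
by move=> a b; have [x [s ->]] := fracP q; rewrite !loc_scaleE scalerDl fracD.
Qed.
HB.instance Definition _ := GRing.Zmodule_isLmodule.Build R loc
  loc_scaleA loc_scale1 loc_scaleDr loc_scaleDl.

Lemma fracZ r x s : frac (r *: x) s = r *: frac x s.
Proof. by rewrite -loc_scaleE. Qed.
End Module.

Section Map.
Variables (M N : lmodType R) (f : {linear M -> N}).

Definition loc_map : loc M -> loc N := loc_lift (fun x s => frac (f x) s).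

Lemma loc_mapE x s : loc_map (frac x s) = frac (f x) s.
Proof.
rewrite /loc_map loc_liftE // => {x s} x s y t /frac_eqP [u e].
by apply/frac_eqP; exists u; rewrite -!linearZ /= e.
Qed.

Lemma loc_map_linear : linear loc_map.
Proof.
move=> r p q; have [x [y [s [-> ->]]]] := frac_common p q.
by rewrite -fracZ -fracD !loc_mapE linearP fracD fracZ.
Qed.
HB.instance Definition _ :=
  GRing.isLinear.Build R (loc M) (loc N) *:%R loc_map loc_map_linear.
End Map.

(* [loc M] is the tensor product over R of M with the local ring [loc R^o]: the
   universal balanced map sends x ⊗ a / s to a x / s. *)
Section Tensor.
Variable M : lmodType R.

Lemma orbit_linear (x : M) : linear (fun a : R^o => a *: x).
Proof. by move=> r a b; rewrite scalerDl -scalerA. Qed.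
Definition orbit_map (x : M) (a : R^o) : M := a *: x.
HB.instance Definition _ (x : M) :=
  GRing.isLinear.Build R R^o M *:%R (orbit_map x) (orbit_linear x).

Definition loc_tens (x : M) : loc R^o -> loc M := loc_map (orbit_map x).

Lemma loc_tensE x (a : R^o) s : loc_tens x (frac a s) = frac (a *: x) s.
Proof. exact: loc_mapE. Qed.

Lemma loc_tens_additivel q : zmod_morphism (loc_tens^~ q).
Proof.
by move=> x y; have [a [s ->]] := fracP q; rewrite !loc_tensE scalerBr fracB.
Qed.

Lemma loc_tens_additiver x : zmod_morphism (loc_tens x).
Proof. exact: raddfB. Qed.

Lemma loc_tens_balanced r x q : loc_tens (r *: x) q = loc_tens x (r *: q).
Proof.
have [a [s ->]] := fracP q; rewrite -fracZ !loc_tensE scalerA mulrC //.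
Qed.

Lemma loc_tens_universal (T : zmodType) (b : M -> loc R^o -> T) :
  (forall q, zmod_morphism (b^~ q)) -> (forall x, zmod_morphism (b x)) ->
  (forall r x q, b (r *: x) q = b x (r *: q)) ->
  exists! h : loc M -> T, zmod_morphism h /\ forall x q, h (loc_tens x q) = b x q.
Proof.
move=> bl br bb; pose one : R^o := 1.
have hE x s : loc_lift (fun x s => b x (frac one s)) (frac x s) = b x (frac one s).
  rewrite loc_liftE // => {x s} x s y t /frac_eqP [u e].
  have E (v : primeC) w : frac one v = (den u * den w) *: frac one (primeCM v (primeCM u w)).
    by rewrite -fracZ (frac_cancel (M := R^o) one v (primeCM u w)).
  rewrite (E s t) -bb e bb (E t s).
  by congr (b y (_ *: frac one _)); apply: val_inj; rewrite /=; ring.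
exists (loc_lift (fun x s => b x (frac one s))); split; last first.
  move=> h [hB hb]; apply/funext => q; have [x [s ->]] := fracP q.
  by rewrite hE -hb loc_tensE scale1r.
split=> [p q|x q].
  by have [x [y [s [-> ->]]]] := frac_common p q; rewrite -fracB !hE bl.
have [a [s ->]] := fracP q; rewrite loc_tensE hE bb -fracZ; congr (b _ (frac _ _)).
exact: mulr1.
Qed.
End Tensor.
End Localization.

(* A direct sum decomposition M = \bigoplus_i M_i, given by the projections
   onto the summands. *)
Record grading (M : zmodType) := Grading {
  pr :> int -> M -> M;
  pr_is_additive : forall i, zmod_morphism (pr i);
  pr_pr : forall i j x, pr i (pr j x) = if i == j then pr j x else 0;
  pr_decomp : forall x, exists s : seq int, uniq s /\ x = \sum_(i <- s) pr i x
}.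

HB.instance Definition _ (M : zmodType) (g : grading M) i :=
  GRing.isZmodMorphism.Build M M (g i) (pr_is_additive g i).

Definition homog (M : zmodType) (g : grading M) (i : int) (x : M) : Prop :=
  g i x = x.

(* The Koszul sign: [ksign i x] is (-1)^i x. *)
Definition ksign (M : zmodType) (i : int) (x : M) : M :=
  if odd `|i|%N then - x else x.

(* Right multiplication: a left module over the converse ring A^c is a right
   module over A. *)
Definition ract (A : pzRingType) (M : lmodType A^c) (x : M) (a : A) : M :=
  (a : A^c) *: x.
Notation "x ∙ a" := (ract x a) (at level 40, left associativity) : ring_scope.

(* Graded homologically; non-negativity and graded-commutativity are part of
   the definition. *)
Record dgRing := DGRing {
  dg_ring :> pzRingType;
  dg_gr : grading dg_ring;
  dg_d : dg_ring -> dg_ring;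
  dg_one : homog dg_gr 0 1;
  dg_mul : forall i j a b,
    homog dg_gr i a -> homog dg_gr j b -> homog dg_gr (i + j) (a * b);
  dg_d_additive : zmod_morphism dg_d;
  dg_d_deg : forall i a, dg_gr i (dg_d a) = dg_d (dg_gr (i + 1) a);
  dg_dd : forall a, dg_d (dg_d a) = 0;
  dg_leibniz : forall i a b, homog dg_gr i a ->
    dg_d (a * b) = dg_d a * b + ksign i (a * dg_d b);
  dg_comm : forall i j a b, homog dg_gr i a -> homog dg_gr j b ->
    a * b = ksign (i * j) (b * a);
  dg_sq_odd : forall i a, odd `|i|%N -> homog dg_gr i a -> a * a = 0;
  dg_nonneg : forall i a, i < 0 -> dg_gr i a = 0
}.

(* Over a graded-commutative DG ring, left and right DG modules are the same
   via x a = (-1)^(|a||x|) a x. Right modules are used because the action on a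
   suspension then carries no sign. *)
Record dgMod (A : dgRing) := DGMod {
  dm_mod :> lmodType (A : pzRingType)^c;
  dm_gr : grading dm_mod;
  dm_d : dm_mod -> dm_mod;
  dm_act : forall i j x (a : A),
    homog dm_gr i x -> homog (dg_gr A) j a -> homog dm_gr (i + j) (x ∙ a);
  dm_d_additive : zmod_morphism dm_d;
  dm_d_deg : forall i x, dm_gr i (dm_d x) = dm_d (dm_gr (i + 1) x);
  dm_dd : forall x, dm_d (dm_d x) = 0;
  dm_leibniz : forall i x (a : A), homog dm_gr i x ->
    dm_d (x ∙ a) = dm_d x ∙ a + ksign i (x ∙ dg_d a)
}.

HB.instance Definition _ (A : dgRing) :=
  GRing.isZmodMorphism.Build A A (@dg_d A) (@dg_d_additive A).
HB.instance Definition _ (A : dgRing) (X : dgMod A) :=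
  GRing.isZmodMorphism.Build X X (@dm_d A X) (@dm_d_additive A X).

Section Signs.
Variables (M N : zmodType).
Implicit Types (i j : int) (x y : M).

Lemma ksignD i x y : ksign i (x + y) = ksign i x + ksign i y.
Proof. by rewrite /ksign; case: ifP; rewrite // opprD. Qed.
Lemma ksignN i x : ksign i (- x) = - ksign i x.
Proof. by rewrite /ksign; case: ifP. Qed.
Lemma ksignB i x y : ksign i (x - y) = ksign i x - ksign i y.
Proof. by rewrite ksignD ksignN. Qed.
Lemma ksign0 i : ksign i (0 : M) = 0.
Proof. by rewrite /ksign; case: ifP; rewrite // oppr0. Qed.
Lemma ksign_even i x : ~~ odd `|i|%N -> ksign i x = x.
Proof. by rewrite /ksign => /negPf ->. Qed.
Lemma ksign_ksign i j x : ksign i (ksign j x) = ksign (i + j) x.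
Proof.
rewrite /ksign; have -> : odd `|(i + j)%R|%N = odd `|i|%N (+) odd `|j|%N by lia.
by case: (odd `|i|%N); case: (odd `|j|%N); rewrite //= opprK.
Qed.
Lemma ksignK i x : ksign i (ksign i x) = x.
Proof. by rewrite ksign_ksign ksign_even //; lia. Qed.
Lemma ksign_add (f : M -> N) : zmod_morphism f ->
  forall i x, f (ksign i x) = ksign i (f x).
Proof.
move=> fB i x; rewrite /ksign; case: ifP => // _.
by have := fB 0 x; have := fB 0 0; rewrite !subrr => ->; rewrite !sub0r.
Qed.
End Signs.

Section RightAction.
Variables (A : pzRingType) (M : lmodType A^c).
Implicit Types (x y : M) (a b : A).

Lemma ractA x a b : x ∙ a ∙ b = x ∙ (a * b).
Proof. by rewrite /ract scalerA. Qed.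
Lemma ract1 x : x ∙ (1 : A) = x.
Proof. exact: scale1r. Qed.
Lemma ractDl a x y : (x + y) ∙ a = x ∙ a + y ∙ a.
Proof. exact: scalerDr. Qed.
Lemma ractBl a x y : (x - y) ∙ a = x ∙ a - y ∙ a.
Proof. exact: scalerBr. Qed.
Lemma ractNl a x : (- x) ∙ a = - (x ∙ a).
Proof. exact: scalerN. Qed.
Lemma ractDr a b x : x ∙ (a + b) = x ∙ a + x ∙ b.
Proof. exact: scalerDl. Qed.
Lemma ractBr a b x : x ∙ (a - b) = x ∙ a - x ∙ b.
Proof. exact: scalerBl. Qed.
Lemma ract0l a : (0 : M) ∙ a = 0.
Proof. exact: scaler0. Qed.
Lemma ract0r x : x ∙ (0 : A) = 0.
Proof. exact: scale0r. Qed.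
Lemma ract_ksign i x a : ksign i x ∙ a = ksign i (x ∙ a).
Proof. by rewrite /ksign; case: ifP; rewrite // ractNl. Qed.
Lemma ract_sum (I : Type) (r : seq I) (F : I -> M) a :
  (\sum_(i <- r) F i) ∙ a = \sum_(i <- r) (F i ∙ a).
Proof. exact: scaler_sumr. Qed.
End RightAction.

Section Homog.
Variables (M : zmodType) (g : grading M).
Lemma homog_pr i x : homog g i (g i x).
Proof. by rewrite /homog pr_pr eqxx. Qed.
Lemma homog0 i : homog g i 0.
Proof. exact: raddf0. Qed.
Lemma homogD i x y : homog g i x -> homog g i y -> homog g i (x + y).
Proof. by rewrite /homog => hx hy; rewrite raddfD /= hx hy. Qed.
Lemma homogN i x : homog g i x -> homog g i (- x).
Proof. by rewrite /homog => hx; rewrite raddfN /= hx. Qed.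
Lemma homogB i x y : homog g i x -> homog g i y -> homog g i (x - y).
Proof. by move=> hx hy; apply/homogD/homogN. Qed.
Lemma homog_sign i j x : homog g i x -> homog g i (ksign j x).
Proof. by move=> h; rewrite /ksign; case: ifP => // _; exact: homogN. Qed.
Lemma homog_inj x y : (forall i, g i x = g i y) -> x = y.
Proof.
move=> e; apply/eqP; rewrite -subr_eq0; apply/eqP.
have [s [_ ->]] := pr_decomp g (x - y).
by rewrite big1 // => i _; rewrite raddfB /= e subrr.
Qed.
End Homog.

Section DegreeZero.
Variable A : dgRing.

Lemma dm_d_homog (X : dgMod A) i x :
  homog (dm_gr X) i x -> homog (dm_gr X) (i - 1) (dm_d x).
Proof. by rewrite /homog dm_d_deg subrK => ->. Qed.

Lemma d_deg0 (a : A) : homog (dg_gr A) 0 a -> dg_d a = 0.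
Proof.
move=> ha; have h := @dg_nonneg A (-1) (dg_d a) isT.
by rewrite -h dg_d_deg subrr ha.
Qed.

Section Act0.
Variables (X : dgMod A) (a : A).
Hypothesis a0 : homog (dg_gr A) 0 a.

Lemma pr_act0 i (x : X) : dm_gr X i (x ∙ a) = dm_gr X i x ∙ a.
Proof.
have [s [_ e]] := pr_decomp (dm_gr X) x.
rewrite {1}e {2}e ract_sum !raddf_sum /= ract_sum; apply: eq_bigr => j _.
have h := dm_act (homog_pr (dm_gr X) j x) a0; rewrite addr0 in h.
by rewrite -[in LHS]h !pr_pr; case: eqP => [_|_]; rewrite ?ract0l.
Qed.

Lemma d_act0 (x : X) : dm_d (x ∙ a) = dm_d x ∙ a.
Proof.
have [s [_ e]] := pr_decomp (dm_gr X) x.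
rewrite e ract_sum !raddf_sum /= ract_sum; apply: eq_bigr => j _.
by rewrite (dm_leibniz _ (homog_pr _ _ _)) d_deg0 // ract0r ksign0 addr0.
Qed.
End Act0.

Lemma comm_deg0 (a b : A) : homog (dg_gr A) 0 a -> a * b = b * a.
Proof.
move=> a0; have [s [_ ->]] := pr_decomp (dg_gr A) b.
rewrite mulr_sumr mulr_suml; apply: eq_bigr => j _.
by rewrite (dg_comm a0 (homog_pr _ _ _)) mul0r.
Qed.

Definition in_deg0 : {pred A} := fun a => dg_gr A 0 a == a.

Lemma deg0_subring : subring_closed in_deg0.
Proof.
split; first by apply/eqP; exact: dg_one.
  by move=> a b /eqP ha /eqP hb; apply/eqP; exact: homogB.
by move=> a b /eqP ha /eqP hb; apply/eqP; exact: (dg_mul ha hb).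
Qed.
HB.instance Definition _ := GRing.isSubringClosed.Build A in_deg0 deg0_subring.

Record deg0 := Deg0 { deg0_val : A; _ : deg0_val \in in_deg0 }.
HB.instance Definition _ := [isSub for deg0_val].
HB.instance Definition _ := [Choice of deg0 by <:].
HB.instance Definition _ :=
  GRing.SubChoice_isSubPzRing.Build A in_deg0 deg0 deg0_subring.

Lemma deg0P (a : deg0) : homog (dg_gr A) 0 (deg0_val a).
Proof. exact/eqP/(valP a). Qed.

Lemma deg0_mulC : commutative (@GRing.mul deg0).
Proof. by move=> a b; apply: val_inj; rewrite /= comm_deg0 //; exact: deg0P. Qed.
HB.instance Definition _ := GRing.PzRing_hasCommutativeMul.Build deg0 deg0_mulC.

Definition over0 (X : dgMod A) : Type := X.
HB.instance Definition _ X := GRing.Zmodule.on (over0 X).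

Section Over0.
Variable X : dgMod A.
Definition over0_scale (a : deg0) (x : over0 X) : over0 X :=
  (x : X) ∙ deg0_val a.
Lemma over0_scaleA a b x : over0_scale a (over0_scale b x) = over0_scale (a * b) x.
Proof. by rewrite /over0_scale ractA mulrC. Qed.
Lemma over0_scale1 : left_id 1 over0_scale.
Proof. by move=> x; exact: ract1. Qed.
Lemma over0_scaleDr : right_distributive over0_scale +%R.
Proof. by move=> a x y; exact: ractDl. Qed.
Lemma over0_scaleDl x : {morph over0_scale^~ x : a b / a + b}.
Proof. by move=> a b; exact: ractDr. Qed.
HB.instance Definition _ := GRing.Zmodule_isLmodule.Build deg0 (over0 X)
  over0_scaleA over0_scale1 over0_scaleDr over0_scaleDl.
End Over0.
End DegreeZero.

Section Regular.
Variable A : dgRing.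
Lemma reg_act i j (x : (A : pzRingType)^c^o) (a : A) :
  homog (dg_gr A) i x -> homog (dg_gr A) j a -> homog (dg_gr A) (i + j) (x ∙ a).
Proof. exact: dg_mul. Qed.
Definition regMod : dgMod A :=
  @DGMod A ((A : pzRingType)^c^o) (dg_gr A) (@dg_d A) reg_act
    (@dg_d_additive A) (@dg_d_deg A) (@dg_dd A) (@dg_leibniz A).
End Regular.

Section Homology.
Variable A : dgRing.

Section Groups.
Variables (X : dgMod A) (i : int).

Definition in_cycle : {pred X} := fun x => (dm_gr X i x == x) && (dm_d x == 0).

Lemma cycle_zmod_closed : zmod_closed in_cycle.
Proof.
split; first by apply/andP; split; apply/eqP; exact: raddf0.
move=> x y /andP [/eqP hx /eqP dx] /andP [/eqP hy /eqP dy].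
by apply/andP; rewrite !raddfB /= dx dy hx hy subrr.
Qed.
HB.instance Definition _ := GRing.isZmodClosed.Build X in_cycle cycle_zmod_closed.

Record cycle := Cycle { cycle_val : X; _ : cycle_val \in in_cycle }.
HB.instance Definition _ := [isSub for cycle_val].
HB.instance Definition _ := [Choice of cycle by <:].
HB.instance Definition _ := [SubChoice_isSubZmodule of cycle by <:].

Definition in_boundary : {pred cycle} := fun z =>
  `[< exists y : X, homog (dm_gr X) (i + 1) y /\ dm_d y = cycle_val z >].

Lemma boundary_zmod_closed : zmod_closed in_boundary.
Proof.
split; first by apply/asboolP; exists 0; split; [exact: homog0|exact: raddf0].
move=> z w /asboolP [x [hx dx]] /asboolP [y [hy dy]]; apply/asboolP.
by exists (x - y); split; [exact: homogB|rewrite raddfB /= dx dy].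
Qed.
HB.instance Definition _ :=
  GRing.isZmodClosed.Build cycle in_boundary boundary_zmod_closed.

Definition homology := Quotient.quot in_boundary.
HB.instance Definition _ := GRing.Zmodule.on homology.

Definition hclass (z : cycle) : homology := \pi_(Quotient.quot in_boundary) z.

Lemma hclassB : zmod_morphism hclass.
Proof. by move=> z w; rewrite /hclass raddfB. Qed.
HB.instance Definition _ := GRing.isZmodMorphism.Build cycle homology hclass hclassB.

Lemma hclassP (h : homology) : exists z, h = hclass z.
Proof. by exists (repr h); rewrite /hclass reprK. Qed.

Lemma hclass_eqP z w : hclass z = hclass w <-> z - w \in in_boundary.
Proof. by split=> [/eqP|h]; [|apply/eqP]; rewrite -Quotient.idealrBE. Qed.

Lemma cycle_homog (z : cycle) : homog (dm_gr X) i (cycle_val z).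
Proof. by have /andP [/eqP] := valP z. Qed.
Lemma cycle_d (z : cycle) : dm_d (cycle_val z) = 0.
Proof. by have /andP [_ /eqP] := valP z. Qed.

Lemma mk_cycle (x : X) : homog (dm_gr X) i x -> dm_d x = 0 -> x \in in_cycle.
Proof. by move=> h d; apply/andP; rewrite d h. Qed.
End Groups.

Definition H0 := homology (regMod A) 0.
HB.instance Definition _ := GRing.Zmodule.on H0.

Section H0Action.
Variables (X : dgMod A) (i : int).

Fact cycle_act_subproof (z : cycle X i) (a : cycle (regMod A) 0) :
  cycle_val z ∙ (cycle_val a : A) \in in_cycle (X := X) i.
Proof.
apply: mk_cycle.
  by have := dm_act (cycle_homog z) (cycle_homog a : homog (dg_gr A) 0 _); rewrite addr0.
rewrite (dm_leibniz _ (cycle_homog z)) cycle_d ract0l.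
by have -> : dg_d (cycle_val a : A) = 0 := cycle_d a; rewrite ract0r ksign0 add0r.
Qed.
Definition cycle_act z a : cycle X i := Cycle (cycle_act_subproof z a).

Definition hact (h : homology X i) (a : H0) : homology X i :=
  hclass (cycle_act (repr h) (repr a)).

Lemma hactE z a : hact (hclass z) (hclass a) = hclass (cycle_act z a).
Proof.
rewrite /hact; set z' := repr _; set a' := repr _.
have /hclass_eqP /asboolP [y [hy dy]] : hclass z' = hclass z by rewrite /hclass reprK.
have /hclass_eqP /asboolP [b [hb db]] : hclass a' = hclass a by rewrite /hclass reprK.
apply/hclass_eqP/asboolP.
exists (y ∙ (cycle_val a' : A) + ksign i (cycle_val z ∙ (b : A))); split.
  apply: homogD.
    by have := dm_act hy (cycle_homog a' : homog (dg_gr A) 0 _); rewrite addr0.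
  apply: homog_sign.
  by have := dm_act (cycle_homog z) (hb : homog (dg_gr A) _ _); rewrite add0r.
rewrite raddfD /= (ksign_add (@dm_d_additive _ X)).
rewrite (dm_leibniz _ hy) (dm_leibniz _ (cycle_homog z)) cycle_d ract0l add0r ksignK.
have -> : dg_d (cycle_val a' : A) = 0 := cycle_d a'.
have -> : dg_d (b : A) = (cycle_val a' : A) - (cycle_val a : A) := db.
by rewrite dy ract0r ksign0 addr0 /= ractBl ractBr addrA subrK.
Qed.
End H0Action.

Fact one_cycle_subproof : (1 : A) \in in_cycle (X := regMod A) 0.
Proof. by apply: mk_cycle; [exact: dg_one|exact/d_deg0/dg_one]. Qed.
Definition H0_one : H0 := hclass (Cycle one_cycle_subproof).
Definition H0_mul : H0 -> H0 -> H0 := @hact (regMod A) 0.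

Lemma hactA X i (h : homology X i) a b : hact (hact h a) b = hact h (H0_mul a b).
Proof.
have [z ->] := hclassP h; have [u ->] := hclassP a; have [v ->] := hclassP b.
rewrite /H0_mul !hactE; congr hclass; apply: val_inj; exact: ractA.
Qed.
Lemma hact1 X i (h : homology X i) : hact h H0_one = h.
Proof.
have [z ->] := hclassP h; rewrite hactE; congr hclass; apply: val_inj.
exact: ract1.
Qed.
Lemma hactDl X i (h k : homology X i) a : hact (h + k) a = hact h a + hact k a.
Proof.
have [z ->] := hclassP h; have [w ->] := hclassP k; have [u ->] := hclassP a.
rewrite -raddfD !hactE -raddfD; congr hclass; apply: val_inj; exact: ractDl.
Qed.
Lemma hactDr X i (h : homology X i) (a b : H0) : hact h (a + b) = hact h a + hact h b.
Proof.
have [z ->] := hclassP h; have [u ->] := hclassP a; have [v ->] := hclassP b.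
rewrite -(raddfD (@hclass (regMod A) 0)) !hactE -raddfD; congr hclass.
apply: val_inj; exact: ractDr.
Qed.

Lemma H0_mulC : commutative H0_mul.
Proof.
move=> a b; have [u ->] := hclassP a; have [v ->] := hclassP b.
rewrite /H0_mul !hactE; congr hclass; apply: val_inj.
exact/comm_deg0/(cycle_homog u).
Qed.
Lemma H0_mulA : associative H0_mul.
Proof. by move=> a b c; rewrite /H0_mul -hactA. Qed.
Lemma H0_mul1 : left_id H0_one H0_mul.
Proof. by move=> a; rewrite H0_mulC; exact: hact1. Qed.
Lemma H0_mulDl : left_distributive H0_mul +%R.
Proof. by move=> a b c; exact: hactDl. Qed.
HB.instance Definition _ := GRing.Zmodule_isComPzRing.Build H0
  H0_mulA H0_mulC H0_mul1 H0_mulDl.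

Section HModule.
Variables (X : dgMod A) (i : int).
Definition hscale (a : H0) (h : homology X i) := hact h a.
Lemma hscaleA a b h : hscale a (hscale b h) = hscale (a * b) h.
Proof. by rewrite /hscale hactA mulrC. Qed.
Lemma hscale1 : left_id 1 hscale.
Proof. by move=> h; exact: hact1. Qed.
Lemma hscaleDr : right_distributive hscale +%R.
Proof. by move=> a h k; exact: hactDl. Qed.
Lemma hscaleDl h : {morph hscale^~ h : a b / a + b}.
Proof. by move=> a b; exact: hactDr. Qed.
HB.instance Definition _ := GRing.Zmodule_isLmodule.Build H0 (homology X i)
  hscaleA hscale1 hscaleDr hscaleDl.
End HModule.

Fact deg0_cycle_subproof (a : deg0 A) : deg0_val a \in in_cycle (X := regMod A) 0.
Proof. by apply: mk_cycle; [exact: deg0P|exact/d_deg0/deg0P]. Qed.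
Definition toH0 (a : deg0 A) : H0 := hclass (Cycle (deg0_cycle_subproof a)).

Lemma toH0D a b : toH0 (a + b) = toH0 a + toH0 b.
Proof.
by rewrite /toH0 -(raddfD (@hclass (regMod A) 0)); congr hclass; exact: val_inj.
Qed.
Lemma toH0M a b : toH0 (a * b) = toH0 a * toH0 b.
Proof.
rewrite /toH0 [RHS](hactE (X := regMod A)); congr hclass; exact: val_inj.
Qed.
Lemma toH01 : toH0 1 = 1.
Proof. by congr hclass; exact: val_inj. Qed.
Lemma toH00 : toH0 0 = 0.
Proof.
rewrite /toH0 -(raddf0 (@hclass (regMod A) 0)); congr hclass; exact: val_inj.
Qed.

Section Preimage.
Variable p : primeIdeal H0.
Lemma preim_ideal : ideal (fun a => p (toH0 a)).
Proof.
have [p0 pD pM] := prime_ideal p; split; first by rewrite toH00.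
  by move=> a b ha hb; rewrite toH0D; exact: pD.
by move=> a b hb; rewrite toH0M; exact: pM.
Qed.
Lemma preim_proper : ~ p (toH0 1).
Proof. by rewrite toH01; exact: prime_proper. Qed.
Lemma preim_mul a b : p (toH0 (a * b)) -> p (toH0 a) \/ p (toH0 b).
Proof. by rewrite toH0M; exact: prime_mul. Qed.
Definition preim_prime : primeIdeal (deg0 A) :=
  PrimeIdeal preim_ideal preim_proper preim_mul.
End Preimage.
End Homology.

(* The localisation A_p = A \otimes_{A_0} (A_0)_p at a prime p of H_0(A), and
   similarly for DG modules. *)
Section LocalDG.
Variables (A : dgRing) (p : primeIdeal (H0 A)).
Notation P := (preim_prime p).

Definition locMod (X : dgMod A) : Type := loc P (over0 X).
HB.instance Definition _ X := GRing.Zmodule.on (locMod X).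

Section LocAct.
Variable X : dgMod A.

Definition ract0 (x : over0 X) (a : over0 (regMod A)) : over0 X :=
  (x : X) ∙ (a : A).

Lemma ract0Zl r x a : ract0 (r *: x) a = r *: ract0 x a.
Proof.
transitivity ((x : X) ∙ (deg0_val r * (a : A))); first exact: ractA.
by rewrite comm_deg0; [rewrite -ractA|exact: deg0P].
Qed.
Lemma ract0Zr r x a : ract0 x (r *: a) = r *: ract0 x a.
Proof. by symmetry; exact: ractA. Qed.

Definition loc_act (q : locMod X) (a : locMod (regMod A)) : locMod X :=
  loc_lift (fun x s => loc_lift (fun b t =>
    frac (ract0 x b) (primeCM s t)) a) q.

Lemma loc_actE x s b t :
  loc_act (frac x s) (frac b t) = frac (ract0 x b) (primeCM s t).
Proof.
have E x1 s1 b1 t1 : loc_lift (fun b t => frac (ract0 x1 b) (primeCM s1 t))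
    (frac b1 t1) = frac (ract0 x1 b1) (primeCM s1 t1) :> loc P (over0 X).
  rewrite loc_liftE // => b2 t2 b3 t3 /frac_eqP [u e]; apply/frac_eqP.
  exists u; rewrite /= -!ract0Zr.
  have {}e := congr1 (fun z => den s1 *: z) e; rewrite !scalerA in e.
  by congr (ract0 x1 _); apply: (scale_eq (m := 1) e); ring.
rewrite /loc_act loc_liftE ?E // => x2 s2 x3 s3 /frac_eqP [u e].
rewrite !E; apply/frac_eqP; exists u; rewrite /= -!ract0Zl.
by congr (ract0 _ b); apply: (scale_eq (m := den t) e); ring.
Qed.

Lemma loc_actDl a : {morph loc_act^~ a : q r / q + r}.
Proof.
move=> q r; have [x [y [s [-> ->]]]] := frac_common q r; have [b [t ->]] := fracP a.
by rewrite -fracD !loc_actE -fracD; congr frac; exact: ractDl.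
Qed.
Lemma loc_actDr q : {morph loc_act q : a b / a + b}.
Proof.
move=> a b; have [x [y [s [-> ->]]]] := frac_common a b; have [z [t ->]] := fracP q.
by rewrite -fracD !loc_actE -fracD; congr frac; exact: ractDr.
Qed.
End LocAct.

Definition locRing : Type := locMod (regMod A).
HB.instance Definition _ := GRing.Zmodule.on locRing.

Definition loc_one : locRing := frac ((1 : A) : over0 (regMod A)) (primeC1 P).
Definition loc_mul : locRing -> locRing -> locRing := @loc_act (regMod A).

Lemma loc_actA X (q : locMod X) a b : loc_act (loc_act q a) b = loc_act q (loc_mul a b).
Proof.
have [x [s ->]] := fracP q; have [c [t ->]] := fracP a; have [d [u ->]] := fracP b.
by rewrite /loc_mul !loc_actE primeCMA; congr frac; exact: ractA.
Qed.
Lemma loc_act1 X (q : locMod X) : loc_act q loc_one = q.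
Proof.
have [x [s ->]] := fracP q; rewrite loc_actE primeCM1; congr frac; exact: ract1.
Qed.
Lemma loc_mulA : associative loc_mul.
Proof. by move=> a b c; rewrite /loc_mul -loc_actA. Qed.
Lemma loc_1mul : left_id loc_one loc_mul.
Proof.
move=> a; have [x [s ->]] := fracP a; rewrite /loc_mul loc_actE primeC1M.
congr frac; exact: (mul1r (x : A)).
Qed.
Lemma loc_mul1 : right_id loc_one loc_mul.
Proof. exact: loc_act1. Qed.
Lemma loc_mulDl : left_distributive loc_mul +%R.
Proof. by move=> a b c; exact: loc_actDl. Qed.
Lemma loc_mulDr : right_distributive loc_mul +%R.
Proof. by move=> a b c; exact: loc_actDr. Qed.
HB.instance Definition _ := GRing.Zmodule_isPzRing.Build locRing
  loc_mulA loc_1mul loc_mul1 loc_mulDl loc_mulDr.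

Section LocModule.
Variable X : dgMod A.

Definition loc_rscale (a : locRing^c) (q : locMod X) : locMod X := loc_act q a.
Lemma loc_rscaleA a b q : loc_rscale a (loc_rscale b q) = loc_rscale (a * b) q.
Proof. exact: loc_actA. Qed.
Lemma loc_rscale1 : left_id 1 loc_rscale.
Proof. by move=> q; exact: loc_act1. Qed.
Lemma loc_rscaleDr : right_distributive loc_rscale +%R.
Proof. by move=> a q r; exact: loc_actDl. Qed.
Lemma loc_rscaleDl q : {morph loc_rscale^~ q : a b / a + b}.
Proof. by move=> a b; exact: loc_actDr. Qed.
HB.instance Definition _ := GRing.Zmodule_isLmodule.Build locRing^c (locMod X)
  loc_rscaleA loc_rscale1 loc_rscaleDr loc_rscaleDl.

Definition pr0 i : over0 X -> over0 X := dm_gr X i.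
Lemma pr0_linear i : linear (pr0 i).
Proof.
move=> r x y; rewrite /pr0 raddfD /=; congr (_ + _); exact/pr_act0/deg0P.
Qed.
HB.instance Definition _ i :=
  GRing.isLinear.Build (deg0 A) (over0 X) (over0 X) *:%R (pr0 i) (pr0_linear i).

Definition d0 : over0 X -> over0 X := @dm_d A X.
Lemma d0_linear : linear d0.
Proof.
move=> r x y; rewrite /d0 raddfD /=; congr (_ + _); exact/d_act0/deg0P.
Qed.
HB.instance Definition _ :=
  GRing.isLinear.Build (deg0 A) (over0 X) (over0 X) *:%R d0 d0_linear.

Definition loc_pr (i : int) : locMod X -> locMod X := loc_map (P := P) (pr0 i).
Definition loc_d : locMod X -> locMod X := loc_map (P := P) d0.

Lemma loc_prE i x s : loc_pr i (frac x s) = frac (pr0 i x) s.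
Proof. exact: loc_mapE. Qed.
Lemma loc_dE x s : loc_d (frac x s) = frac (d0 x) s.
Proof. exact: loc_mapE. Qed.

Lemma loc_pr_additive i : zmod_morphism (loc_pr i).
Proof. exact: (raddfB (loc_map (P := P) (pr0 i))). Qed.
Lemma loc_d_additive : zmod_morphism loc_d.
Proof. exact: (raddfB (loc_map (P := P) d0)). Qed.
Lemma loc_pr_pr i j q :
  loc_pr i (loc_pr j q) = if i == j then loc_pr j q else 0.
Proof.
have [x [s ->]] := fracP q; rewrite !loc_prE /pr0 pr_pr.
by case: ifP => // _; exact: frac_0.
Qed.
Lemma loc_pr_decomp q :
  exists s : seq int, uniq s /\ q = \sum_(i <- s) loc_pr i q.
Proof.
have [x [t ->]] := fracP q; have [s [us e]] := pr_decomp (dm_gr X) x.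
exists s; split=> //; rewrite {1}e [LHS]frac_sum; apply: eq_bigr => i _.
by rewrite loc_prE.
Qed.
Definition loc_gr : grading (locMod X) :=
  Grading loc_pr_additive loc_pr_pr loc_pr_decomp.

Lemma loc_homogP i q : homog loc_gr i q ->
  exists (x : X) s, homog (dm_gr X) i x /\ q = frac (x : over0 X) s.
Proof.
have [x [s ->]] := fracP q => e; exists (dm_gr X i x), s.
by split; [exact: homog_pr|rewrite -[LHS]e; exact: loc_prE].
Qed.
Lemma loc_homog i (x : X) s :
  homog (dm_gr X) i x -> homog loc_gr i (frac (x : over0 X) s : locMod X).
Proof. by rewrite /homog => e; rewrite [LHS]loc_prE /pr0 e. Qed.
Lemma loc_ksign i (x : X) s :
  ksign i (frac (x : over0 X) s : locMod X) = frac (ksign i x : over0 X) s.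
Proof. by rewrite /ksign; case: ifP => // _; rewrite [RHS]fracN. Qed.
Lemma loc_d_deg i q : loc_gr i (loc_d q) = loc_d (loc_gr (i + 1) q).
Proof.
have [x [s ->]] := fracP q.
have -> : loc_gr (i + 1) (frac x s) = frac (pr0 (i + 1) x) s by exact: loc_prE.
rewrite !loc_dE [LHS]loc_prE; congr frac; exact: (dm_d_deg i (x : X)).
Qed.
Lemma loc_dd q : loc_d (loc_d q) = 0.
Proof. by have [x [s ->]] := fracP q; rewrite !loc_dE [d0 _]dm_dd; exact: frac_0. Qed.
End LocModule.

Section LocRules.
Variable X : dgMod A.
Notation grA := (loc_gr (regMod A)).

Lemma loc_act_homog i j (q : locMod X) (a : locMod (regMod A)) :
  homog (loc_gr X) i q -> homog grA j a -> homog (loc_gr X) (i + j) (loc_act q a).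
Proof.
move=> /loc_homogP [x [s [hx ->]]] /loc_homogP [b [t [hb ->]]].
by rewrite loc_actE; apply: loc_homog; exact: (dm_act hx hb).
Qed.
Lemma loc_leibniz i (q : locMod X) (a : locMod (regMod A)) :
  homog (loc_gr X) i q ->
  loc_d (loc_act q a) = loc_act (loc_d q) a + ksign i (loc_act q (loc_d a)).
Proof.
move=> /loc_homogP [x [s [hx ->]]]; have [b [t ->]] := fracP a.
rewrite loc_actE loc_dE [loc_d (frac (x : over0 X) s)]loc_dE.
rewrite [LHS]loc_dE !loc_actE loc_ksign -[RHS]fracD; congr frac; exact: (dm_leibniz _ hx).
Qed.
End LocRules.

Lemma loc_comm i j (a b : locRing) : homog (loc_gr (regMod A)) i a ->
  homog (loc_gr (regMod A)) j b -> a * b = ksign (i * j) (b * a).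
Proof.
move=> /loc_homogP [x [s [hx ->]]] /loc_homogP [y [t [hy ->]]].
rewrite [LHS]loc_actE [X in ksign _ X]loc_actE [RHS]loc_ksign primeCMC; congr frac.
exact: (dg_comm (hx : homog (dg_gr A) _ _) hy).
Qed.
Lemma loc_sq_odd i (a : locRing) :
  odd `|i|%N -> homog (loc_gr (regMod A)) i a -> a * a = 0.
Proof.
move=> oi /loc_homogP [x [s [hx ->]]]; rewrite [LHS]loc_actE.
rewrite [ract0 x x](dg_sq_odd oi (hx : homog (dg_gr A) _ _)); exact: frac_0.
Qed.
Lemma loc_nonneg i (a : locRing) : i < 0 -> loc_gr (regMod A) i a = 0.
Proof.
move=> i0; have [x [s ->]] := fracP a; rewrite [LHS]loc_prE.
rewrite [pr0 i x](dg_nonneg (x : A) i0); exact: frac_0.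
Qed.
Lemma loc_one_homog : homog (loc_gr (regMod A)) 0 loc_one.
Proof. exact/loc_homog/dg_one. Qed.

Definition dgLoc : dgRing :=
  @DGRing locRing (loc_gr (regMod A)) (@loc_d (regMod A)) loc_one_homog
    (@loc_act_homog (regMod A)) (@loc_d_additive _) (@loc_d_deg _) (@loc_dd _)
    (@loc_leibniz (regMod A)) loc_comm loc_sq_odd loc_nonneg.

Definition dgLocMod (X : dgMod A) : dgMod dgLoc :=
  @DGMod dgLoc (locMod X) (loc_gr X) (@loc_d X) (@loc_act_homog X)
    (@loc_d_additive X) (@loc_d_deg X) (@loc_dd X) (@loc_leibniz X).
End LocalDG.

Section Constructions.
Variable A : dgRing.
Notation Ac := (A : pzRingType)^c.

Record dgHom (X Y : dgMod A) := DGHom {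
  dgh_fun :> X -> Y;
  dgh_linear : linear dgh_fun;
  dgh_deg : forall i x, dm_gr Y i (dgh_fun x) = dgh_fun (dm_gr X i x);
  dgh_d : forall x, dm_d (dgh_fun x) = dgh_fun (dm_d x)
}.
HB.instance Definition _ X Y (f : dgHom X Y) :=
  GRing.isLinear.Build Ac X Y *:%R f (dgh_linear f).

Definition dgId (X : dgMod A) : dgHom X X :=
  @DGHom X X id (fun _ _ _ => erefl) (fun _ _ => erefl) (fun _ => erefl).

Section Comp.
Variables (X Y Z : dgMod A) (g : dgHom Y Z) (f : dgHom X Y).
Lemma comp_linear : linear (g \o f).
Proof. by move=> a x y; rewrite /= !linearP. Qed.
Lemma comp_deg i x : dm_gr Z i ((g \o f) x) = (g \o f) (dm_gr X i x).
Proof. by rewrite /= !dgh_deg. Qed.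
Lemma comp_d x : dm_d ((g \o f) x) = (g \o f) (dm_d x).
Proof. by rewrite /= !dgh_d. Qed.
Definition dgComp : dgHom X Z := DGHom comp_linear comp_deg comp_d.
End Comp.

Section Zero.
Definition zero_gr : grading 'rV[Ac]_0.
Proof.
exists (fun _ x => x) => [i x y|i j x|x] //.
  by case: ifP => // _; exact: thinmx0.
by exists [::]; rewrite big_nil; split=> //; exact: thinmx0.
Defined.
Lemma zero_dd (x : 'rV[Ac]_0) : x = 0. Proof. exact: thinmx0. Qed.
Lemma zero_leibniz i (x : 'rV[Ac]_0) (a : A) : homog zero_gr i x ->
  x ∙ a = x ∙ a + ksign i (x ∙ dg_d a).
Proof. by move=> _; rewrite [LHS]thinmx0 [RHS]thinmx0. Qed.
Definition dgZero : dgMod A :=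
  @DGMod A 'rV[Ac]_0 zero_gr id (fun _ _ _ _ _ _ => erefl)
    (fun _ _ => erefl) (fun _ _ => erefl) zero_dd zero_leibniz.
End Zero.

(* The n-fold suspension: (Σ^n X)_i = X_(i-n), with differential (-1)^n d. *)
Section Shift.
Variables (n : int) (X : dgMod A).
Definition shift_pr (i : int) : X -> X := dm_gr X (i - n).
Lemma shift_pr_pr i j x :
  shift_pr i (shift_pr j x) = if i == j then shift_pr j x else 0.
Proof. by rewrite /shift_pr pr_pr (inj_eq (addIr _)). Qed.
Lemma shift_pr_decomp x :
  exists s : seq int, uniq s /\ x = \sum_(i <- s) shift_pr i x.
Proof.
have [s [us e]] := pr_decomp (dm_gr X) x; exists [seq i + n | i <- s]; split.
  by rewrite map_inj_uniq //; exact: addIr.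
by rewrite big_map {1}e; apply: eq_bigr => i _; rewrite /shift_pr addrK.
Qed.
Definition shift_gr : grading X :=
  Grading (fun i => pr_is_additive (dm_gr X) (i - n)) shift_pr_pr shift_pr_decomp.
Definition shift_d (x : X) : X := ksign n (dm_d x).
Lemma shift_act i j x (a : A) :
  homog shift_gr i x -> homog (dg_gr A) j a -> homog shift_gr (i + j) (x ∙ a).
Proof. by move=> hx ha; rewrite /homog /= /shift_pr addrAC; exact: (dm_act hx ha). Qed.
Lemma shift_d_additive : zmod_morphism shift_d.
Proof. by move=> x y; rewrite /shift_d raddfB ksignB. Qed.
Lemma shift_d_deg i x : shift_gr i (shift_d x) = shift_d (shift_gr (i + 1) x).
Proof.
rewrite /= /shift_pr /shift_d (ksign_add (@pr_is_additive _ (dm_gr X) _)) dm_d_deg.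
by rewrite addrAC.
Qed.
Lemma shift_dd x : shift_d (shift_d x) = 0.
Proof.
by rewrite /shift_d (ksign_add (@dm_d_additive _ X)) dm_dd !ksign0.
Qed.
Lemma shift_leibniz i x (a : A) : homog shift_gr i x ->
  shift_d (x ∙ a) = shift_d x ∙ a + ksign i (x ∙ dg_d a).
Proof.
move=> hx; rewrite /shift_d (dm_leibniz _ (hx : homog (dm_gr X) (i - n) x)).
by rewrite ksignD ksign_ksign ract_ksign [n + _]addrC subrK.
Qed.
Definition dgShift : dgMod A := @DGMod A (dm_mod X) shift_gr shift_d shift_act
  shift_d_additive shift_d_deg shift_dd shift_leibniz.
End Shift.

Section ShiftHom.
Variables (n : int) (X Y : dgMod A) (f : dgHom X Y).
Lemma shift_hom_deg i x : dm_gr (dgShift n Y) i (f x) = f (dm_gr (dgShift n X) i x).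
Proof. exact: (dgh_deg f (i - n) x). Qed.
Lemma shift_hom_d x : dm_d (f x : dgShift n Y) = f (dm_d (x : dgShift n X)).
Proof.
rewrite [LHS]/(ksign n (dm_d (f x))) dgh_d; symmetry; exact: (ksign_add (raddfB f)).
Qed.
Definition dgShiftHom : dgHom (dgShift n X) (dgShift n Y) :=
  @DGHom (dgShift n X) (dgShift n Y) f (dgh_linear f) shift_hom_deg shift_hom_d.
End ShiftHom.

Section PairGrading.
Variables (V W : zmodType) (g : grading V) (h : grading W).
Definition pair_pr (i : int) (z : (V * W)%type) : (V * W)%type := (g i z.1, h i z.2).
Lemma pair_pr_additive i : zmod_morphism (pair_pr i).
Proof. by move=> [x y] [x' y']; rewrite /pair_pr /= !raddfB. Qed.
Lemma pair_pr_pr i j z :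
  pair_pr i (pair_pr j z) = if i == j then pair_pr j z else 0.
Proof. by rewrite /pair_pr /= !pr_pr; case: ifP. Qed.
Lemma decomp_sub (U : zmodType) (k : grading U) (x : U) (s t : seq int) :
  uniq s -> x = \sum_(i <- s) k i x -> uniq t -> {subset s <= t} ->
  x = \sum_(i <- t) k i x.
Proof.
move=> us e ut st; apply: (homog_inj (g := k)) => j; rewrite raddf_sum /=.
have E (r : seq int) : uniq r -> \sum_(i <- r) k j (k i x) =
    if j \in r then k j x else 0.
  move=> ur; case: ifP => jr.
    rewrite (bigD1_seq j) //= pr_pr eqxx big1 ?addr0 // => i ij.
    by rewrite pr_pr eq_sym (negPf ij).
  rewrite big_seq big1 // => i ir; rewrite pr_pr; case: eqP => // ji.
  by rewrite ji ir in jr.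
rewrite E //; have : k j x = if j \in s then k j x else 0.
  by rewrite -E // -raddf_sum -e.
by case: ifP => [/st -> //|_ ->]; case: ifP.
Qed.
Lemma pair_pr_decomp z :
  exists s : seq int, uniq s /\ z = \sum_(i <- s) pair_pr i z.
Proof.
case: z => x y; have [s [us ex]] := pr_decomp g x; have [t [ut ey]] := pr_decomp h y.
exists (undup (s ++ t)); split; first exact: undup_uniq.
have -> : \sum_(i <- undup (s ++ t)) pair_pr i (x, y) =
    (\sum_(i <- undup (s ++ t)) g i x, \sum_(i <- undup (s ++ t)) h i y).
  by elim: (undup _) => [|i r IH]; rewrite ?big_nil // !big_cons IH.
congr (_, _).
  apply: (decomp_sub us ex (undup_uniq _)) => i.
  by rewrite mem_undup mem_cat => ->.
apply: (decomp_sub ut ey (undup_uniq _)) => i.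
by rewrite mem_undup mem_cat orbC => ->.
Qed.
Definition pair_gr : grading (V * W)%type :=
  Grading pair_pr_additive pair_pr_pr pair_pr_decomp.
Lemma pair_homog i z : homog pair_gr i z <-> homog g i z.1 /\ homog h i z.2.
Proof.
by split=> [e|[e1 e2]]; [split; [exact: (congr1 fst e)|exact: (congr1 snd e)]|];
  case: z e1 e2 => x y /= e1 e2; congr (_, _).
Qed.
End PairGrading.

(* The sign in d (y, x) = (dy + f x, - dx) is hidden in the suspension. *)
Section Cone.
Variables (X Y : dgMod A) (f : dgHom X Y).
Notation C := (Y * dgShift 1 X)%type.
Definition cone_gr := pair_gr (dm_gr Y) (dm_gr (dgShift 1 X)).
Definition cone_d (z : C) : C := (dm_d z.1 + f z.2, dm_d z.2).
Lemma pair_ksign (V W : zmodType) i (x : V) (y : W) :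
  ksign i (x, y) = (ksign i x, ksign i y).
Proof. by rewrite /ksign; case: ifP. Qed.
Lemma cone_act i j (z : C) (a : A) :
  homog cone_gr i z -> homog (dg_gr A) j a -> homog cone_gr (i + j) (z ∙ a).
Proof.
move=> /pair_homog [h1 h2] ha; apply/pair_homog.
by split; [exact: (dm_act h1 ha)|exact: (dm_act h2 ha)].
Qed.
Lemma cone_d_additive : zmod_morphism cone_d.
Proof.
move=> [y x] [y' x']; congr (_, _); last exact: (@shift_d_additive 1 X x x').
by rewrite /= (raddfB f) raddfB /= opprD addrACA.
Qed.
Lemma cone_d_deg i z : cone_gr i (cone_d z) = cone_d (cone_gr (i + 1) z).
Proof.
case: z => y x; congr (_, _); last exact: (@shift_d_deg 1 X i x).
rewrite /= raddfD /= dm_d_deg; congr (_ + _).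
by rewrite dgh_deg /shift_pr addrK.
Qed.
Lemma cone_dd z : cone_d (cone_d z) = 0.
Proof.
case: z => y x; congr (_, _); last exact: (@shift_dd 1 X x).
rewrite /= raddfD /= dm_dd add0r dgh_d -raddfD /=.
by rewrite [shift_d _ _]/(- dm_d (x : X)) subrr; exact: (raddf0 f).
Qed.
Lemma cone_leibniz i (z : C) (a : A) : homog cone_gr i z ->
  cone_d (z ∙ a) = cone_d z ∙ a + ksign i (z ∙ dg_d a).
Proof.
case: z => y x /pair_homog [/= h1 h2]; rewrite pair_ksign; congr (_, _) => /=.
  transitivity (dm_d (y ∙ a) + f x ∙ a); first by congr (_ + _); exact: linearZ.
  by rewrite (dm_leibniz _ h1) addrAC -ractDl.
exact: (@shift_leibniz 1 X i x a h2).
Qed.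
Definition dgCone : dgMod A := @DGMod A C cone_gr cone_d cone_act
  cone_d_additive cone_d_deg cone_dd cone_leibniz.

Lemma cone_in_linear : linear (fun y : Y => (y, 0) : dgCone).
Proof. by move=> a y y'; congr (_, _); rewrite /= scaler0 addr0. Qed.
Lemma cone_in_deg i y : dm_gr dgCone i (y, 0) = (dm_gr Y i y, 0).
Proof. by congr (_, _); exact: raddf0. Qed.
Lemma cone_in_d y : dm_d ((y, 0) : dgCone) = (dm_d y, 0).
Proof.
congr (_, _); first by rewrite /= raddf0 addr0.
exact: (raddf0 (@dm_d A (dgShift 1 X))).
Qed.
Definition dgConeIn : dgHom Y dgCone := DGHom cone_in_linear cone_in_deg cone_in_d.

Lemma cone_out_linear : linear (snd : dgCone -> dgShift 1 X).
Proof. by []. Qed.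
Definition dgConeOut : dgHom dgCone (dgShift 1 X) :=
  DGHom cone_out_linear (fun _ _ => erefl) (fun _ => erefl).
End Cone.

Section DirectSum.
Variables X Y : dgMod A.
Notation S := (X * Y)%type.
Definition sum_gr := pair_gr (dm_gr X) (dm_gr Y).
Definition sum_d (z : S) : S := (dm_d z.1, dm_d z.2).
Lemma sum_act i j (z : S) (a : A) :
  homog sum_gr i z -> homog (dg_gr A) j a -> homog sum_gr (i + j) (z ∙ a).
Proof.
move=> /pair_homog [h1 h2] ha; apply/pair_homog.
by split; [exact: (dm_act h1 ha)|exact: (dm_act h2 ha)].
Qed.
Lemma sum_d_additive : zmod_morphism sum_d.
Proof. by move=> [y x] [y' x']; congr (_, _); rewrite /= !raddfB. Qed.
Lemma sum_d_deg i z : sum_gr i (sum_d z) = sum_d (sum_gr (i + 1) z).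
Proof. by case: z => y x; congr (_, _); rewrite /= dm_d_deg. Qed.
Lemma sum_dd z : sum_d (sum_d z) = 0.
Proof. by case: z => y x; congr (_, _); rewrite /= dm_dd. Qed.
Lemma sum_leibniz i (z : S) (a : A) : homog sum_gr i z ->
  sum_d (z ∙ a) = sum_d z ∙ a + ksign i (z ∙ dg_d a).
Proof.
case: z => y x /pair_homog [/= h1 h2]; rewrite pair_ksign; congr (_, _) => /=.
  exact: (dm_leibniz _ h1).
exact: (dm_leibniz _ h2).
Qed.
Definition dgSum : dgMod A := @DGMod A S sum_gr sum_d sum_act
  sum_d_additive sum_d_deg sum_dd sum_leibniz.
End DirectSum.
End Constructions.

Section Derived.
Variable A : dgRing.

Section QuasiIso.
Variables (X Y : dgMod A) (f : dgHom X Y).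

Fact cycle_map_subproof i (z : cycle X i) : f (cycle_val z) \in in_cycle (X := Y) i.
Proof.
apply: mk_cycle; first by rewrite /homog dgh_deg cycle_homog.
by rewrite dgh_d cycle_d; exact: raddf0.
Qed.
Definition hmap i (h : homology X i) : homology Y i :=
  hclass (Cycle (cycle_map_subproof (repr h))).

Lemma hmapE i z : hmap (hclass z) = hclass (Cycle (@cycle_map_subproof i z)).
Proof.
rewrite /hmap; set z' := repr _.
have /hclass_eqP /asboolP [y [hy dy]] : hclass z' = hclass z by rewrite /hclass reprK.
apply/hclass_eqP/asboolP; exists (f y); split; first by rewrite /homog dgh_deg hy.
by rewrite dgh_d dy /= raddfB.
Qed.

Definition quasi_iso : Prop :=
  forall i, injective (@hmap i) /\ forall h, exists k, @hmap i k = h.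

Lemma quasi_isoP : quasi_iso <-> forall i,
  (forall x, homog (dm_gr X) i x -> dm_d x = 0 ->
     (exists y, homog (dm_gr Y) (i + 1) y /\ dm_d y = f x) ->
     exists y, homog (dm_gr X) (i + 1) y /\ dm_d y = x) /\
  (forall w, homog (dm_gr Y) i w -> dm_d w = 0 ->
     exists x, [/\ homog (dm_gr X) i x, dm_d x = 0 &
       exists y, homog (dm_gr Y) (i + 1) y /\ dm_d y = f x - w]).
Proof.
split=> qf i; have [qi qs] := qf i; split.
- move=> x hx dx [y [hy dy]]; pose z := Cycle (mk_cycle hx dx).
  have /qi /hclass_eqP /asboolP [u [hu du]] : hmap (hclass z) = hmap (hclass 0).
    rewrite !hmapE; apply/hclass_eqP/asboolP; exists y; split=> //.
    by rewrite dy /= raddf0 subr0.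
  by exists u; rewrite du /= subr0.
- move=> w hw dw; have [k] := qs (hclass (Cycle (mk_cycle hw dw))).
  have [z ->] := hclassP k; rewrite hmapE => /hclass_eqP /asboolP [y [hy dy]].
  exists (cycle_val z); split; [exact: cycle_homog|exact: cycle_d|].
  by exists y; rewrite dy.
- move=> h k; have [z ->] := hclassP h; have [w ->] := hclassP k.
  rewrite !hmapE => /hclass_eqP /asboolP [y [hy dy]].
  have [] := qi (cycle_val (z - w)) (cycle_homog _) (cycle_d _).
    by exists y; rewrite dy /= raddfB.
  by move=> u [hu du]; apply/hclass_eqP/asboolP; exists u.
- move=> h; have [w ->] := hclassP h.
  have [x [hx dx [y [hy dy]]]] := qs _ (cycle_homog w) (cycle_d w).
  exists (hclass (Cycle (mk_cycle hx dx))); rewrite hmapE.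
  by apply/hclass_eqP/asboolP; exists y; rewrite dy.
Qed.
End QuasiIso.

Lemma shift_quasi_iso n (X Y : dgMod A) (f : dgHom X Y) :
  quasi_iso f -> quasi_iso (dgShiftHom n f).
Proof.
move=> /quasi_isoP qf; apply/quasi_isoP => i; have [qi qs] := qf (i - n).
have k0 (Z : dgMod A) (z : Z) : ksign n (dm_d z) = 0 -> dm_d z = 0.
  by move=> e; rewrite -[LHS](ksignK n) e ksign0.
have dk (Z : dgMod A) (z : Z) : dm_d (ksign n z) = ksign n (dm_d z).
  exact: (ksign_add (@dm_d_additive _ Z)).
have hk (Z : dgMod A) (z : Z) : homog (dm_gr (dgShift n Z)) (i + 1) z <->
    homog (dm_gr Z) (i - n + 1) z.
  by rewrite /homog /= /shift_pr addrAC.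
split.
- move=> x hx /(k0 X x) dx [y [/(hk Y y) hy dy]].
  have [|u [hu du]] := qi x hx dx.
    by exists (ksign n y); split; [exact: homog_sign|rewrite dk].
  exists (ksign n u); split; first by apply/(hk _ _); exact: homog_sign.
  by have : ksign n (dm_d (ksign n u)) = x; [rewrite dk ksignK|].
- move=> w hw /(k0 Y w) dw; have [x [hx dx [y [hy dy]]]] := qs w hw dw.
  exists x; split=> //; first by have : ksign n (dm_d x) = 0; [rewrite dx ksign0|].
  exists (ksign n y); split; first by apply/(hk _ _); exact: homog_sign.
  by have : ksign n (dm_d (ksign n y)) = f x - w; [rewrite dk ksignK|].
Qed.

(* The derived category D(A), as the localisation of the category of DG modules
   at the quasi-isomorphisms: morphisms are formal composites of maps of DG
   modules and inverses of quasi-isomorphisms, modulo the congruence [dEq]. *)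
Inductive dMor : dgMod A -> dgMod A -> Type :=
| dMap X Y : dgHom X Y -> dMor X Y
| dInv X Y (s : dgHom X Y) : quasi_iso s -> dMor Y X
| dComp X Y Z : dMor Y Z -> dMor X Y -> dMor X Z.

Inductive dEq : forall X Y : dgMod A, dMor X Y -> dMor X Y -> Prop :=
| dEq_refl X Y (u : dMor X Y) : dEq u u
| dEq_sym X Y (u v : dMor X Y) : dEq u v -> dEq v u
| dEq_trans X Y (u v w : dMor X Y) : dEq u v -> dEq v w -> dEq u w
| dEq_comp X Y Z (u u' : dMor Y Z) (v v' : dMor X Y) :
    dEq u u' -> dEq v v' -> dEq (dComp u v) (dComp u' v')
| dEq_assoc X Y Z W (u : dMor Z W) (v : dMor Y Z) (w : dMor X Y) :
    dEq (dComp u (dComp v w)) (dComp (dComp u v) w)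
| dEq_idl X Y (u : dMor X Y) : dEq (dComp (dMap (dgId Y)) u) u
| dEq_idr X Y (u : dMor X Y) : dEq (dComp u (dMap (dgId X))) u
| dEq_ext X Y (f g : dgHom X Y) : f =1 g -> dEq (dMap f) (dMap g)
| dEq_map X Y Z (g : dgHom Y Z) (f : dgHom X Y) :
    dEq (dMap (dgComp g f)) (dComp (dMap g) (dMap f))
| dEq_invl X Y (s : dgHom X Y) (qs : quasi_iso s) :
    dEq (dComp (dInv qs) (dMap s)) (dMap (dgId X))
| dEq_invr X Y (s : dgHom X Y) (qs : quasi_iso s) :
    dEq (dComp (dMap s) (dInv qs)) (dMap (dgId Y)).

Fixpoint dShift n X Y (u : dMor X Y) : dMor (dgShift n X) (dgShift n Y) :=
  match u with
  | dMap _ _ f => dMap (dgShiftHom n f)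
  | dInv _ _ _ qs => dInv (shift_quasi_iso n qs)
  | dComp _ _ _ u v => dComp (dShift n u) (dShift n v)
  end.

Definition d_is_iso X Y (u : dMor X Y) : Prop :=
  exists v : dMor Y X,
    dEq (dComp v u) (dMap (dgId X)) /\ dEq (dComp u v) (dMap (dgId Y)).

Definition d_iso (X Y : dgMod A) : Prop := exists u : dMor X Y, d_is_iso u.

Definition exact_triangle X Y Z
    (u : dMor X Y) (v : dMor Y Z) (w : dMor Z (dgShift 1 X)) : Prop :=
  exists (X' Y' : dgMod A) (f : dgHom X' Y')
    (a : dMor X X') (b : dMor Y Y') (c : dMor Z (dgCone f)),
  [/\ d_is_iso a, d_is_iso b & d_is_iso c] /\
  [/\ dEq (dComp b u) (dComp (dMap f) a),
      dEq (dComp c v) (dComp (dMap (dgConeIn f)) b) &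
      dEq (dComp (dShift 1 a) w) (dComp (dMap (dgConeOut f)) c)].

(* Full subcategories of D(A) are predicates on DG modules. *)
Definition Dfb (X : dgMod A) : Prop :=
  (exists n : nat, forall i : int, (n < `|i|)%N ->
     forall h : homology X i, h = 0) /\
  forall i, fin_gen (homology X i).

Section Thick.
Variables S G : dgMod A -> Prop.

(* Closure under isomorphism in S is the case of a summand with zero
   complement. *)
Inductive thick1 : dgMod A -> Prop :=
| thick1_gen X : G X -> thick1 X
| thick1_zero : thick1 (dgZero A)
| thick1_sum X Y : thick1 X -> thick1 Y -> thick1 (dgSum X Y)
| thick1_summand X Y Z : S X -> S Y ->
    thick1 Z -> d_iso Z (dgSum X Y) -> thick1 X
| thick1_shift n X : thick1 X -> thick1 (dgShift n X).

Fixpoint thick (n : nat) (X : dgMod A) : Prop :=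
  match n with
  | 0 => S X /\ d_iso X (dgZero A)
  | 1 => thick1 X
  | n'.+1 => S X /\ exists (X' X1 X2 : dgMod A)
      (u : dMor X1 (dgSum X X')) (v : dMor (dgSum X X') X2)
      (w : dMor X2 (dgShift 1 X1)),
      [/\ S X', thick1 X1, thick n' X2 & exact_triangle u v w]
  end.

(* [None] stands for an infinite level. *)
Definition level (X : dgMod A) : option nat :=
  match pselect (exists n, `[< thick n X >]) with
  | left ex => Some (ex_minn ex)
  | right _ => None
  end.

Definition level_finite (X : dgMod A) : Prop := level X <> None.

Lemma level_finiteP X : level_finite X <-> exists n, thick n X.
Proof.
rewrite /level_finite /level; case: pselect => [ex|nex]; split=> //.
  by move=> _; have [n /asboolP h] := ex; exists n.
by move=> [n h]; case: nex; exists n; apply/asboolP.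
Qed.
End Thick.
End Derived.

Definition locFull (A : dgRing) (p : primeIdeal (H0 A)) (G : dgMod A -> Prop)
  (Y : dgMod (dgLoc p)) : Prop := exists2 X, G X & Y = dgLocMod p X.
Arguments locFull {A} p G Y.

(* H(A) = \bigoplus_i H_i(A) is generated over H_0(A) by a finite set of
   homogeneous elements. *)
Definition homology_fin_gen (A : dgRing) (X : dgMod A) : Prop :=
  exists (s : seq int) (g : forall i, seq (homology X i)),
    (forall i, i \notin s -> g i = [::]) /\
    forall i (h : homology X i), exists c : nat -> H0 A,
      h = \sum_(k < size (g i)) c k *: (g i)`_k.

(* Homogeneous one-sided ideals are two-sided, by graded-commutativity. *)
Definition graded_noetherian (A : dgRing) : Prop :=
  forall I : A -> Prop,
    I 0 -> (forall a b, I a -> I b -> I (a + b)) ->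
    (forall a b, I a -> I (a * b) /\ I (b * a)) ->
    (forall i a, I a -> I (dg_gr A i a)) ->
  exists (n : nat) (g : 'I_n -> A),
    (forall k, I (g k) /\ exists i, homog (dg_gr A) i (g k)) /\
    forall a, I a -> exists c : 'I_n -> A, a = \sum_k g k * c k.

(* Main.v *)
(* Write r.X for multiplication by r on X. The elements r of H_0(A) such that
   r.X factors in D(A) through an object of some thick^n(G) form an ideal I. If
   1 lies in I, then X is a retract of an object of thick^n(G), so its level is
   finite. Otherwise I lies in a maximal ideal m, and it suffices to turn
   X_m in thick^n(G_m) into some s outside m with s.X factoring through an object
   of thick^n(G).

   To this end regard X_m as a DG A-module. By induction on n, every map in D(A)
   from an object of D^f_b(A) to an object of thick^n(G_m) factors through an
   object of thick^n(G): for n = 1 because Hom(X, Y_m) is the localisation of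
   Hom(X, Y), and for an extension by forming a homotopy pushout. Applying this
   to X -> X_m, and lifting the second factor T -> X_m to a map s.(T -> X_m) that
   comes from T -> X, gives the factorisation of some multiple s.X.

   That Hom(X, -) commutes with localisation on D^f_b(A) is seen on a finite
   cellular approximation F -> X that is an isomorphism on homology up to the
   degree in which the target is truncated. *)
Require Import Defs.
From HB Require Import structures.
From mathcomp Require Import all_boot all_order all_algebra.
From mathcomp Require Import boolp zify.
From mathcomp Require classical_sets.
From Corelib Require Import Setoid Morphisms.
Import Defs.

Set Implicit Arguments.
Unset Strict Implicit.
Unset Printing Implicit Defensive.

Import Order.TTheory GRing.Theory.

Local Open Scope ring_scope.
Local Open Scope quotient_scope.

(** * Maps of DG modules *)

Section ZmodExpr.
Inductive zexp := ZVar of nat | ZNil | ZAdd of zexp & zexp | ZOpp of zexp.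
Fixpoint zcoef (e : zexp) (i : nat) : int :=
  match e with
  | ZVar j => (i == j)%:Z
  | ZNil => 0
  | ZAdd a b => zcoef a i + zcoef b i
  | ZOpp a => - zcoef a i
  end.
Variable V : zmodType.
Fixpoint zeval (env : seq V) (e : zexp) : V :=
  match e with
  | ZVar j => nth 0 env j
  | ZNil => 0
  | ZAdd a b => zeval env a + zeval env b
  | ZOpp a => - zeval env a
  end.
Lemma zeval_sum env e :
  zeval env e = \sum_(i < size env) env`_i *~ zcoef e i.
Proof.
elim: e => [j||a IHa b IHb|a IHa] /=.
- have [js|sj] := ltnP j (size env).
    rewrite (bigD1 (Ordinal js)) //= eqxx mulr1z big1 ?addr0 // => i.
    by rewrite -val_eqE /= => /negPf ->.
  rewrite nth_default // big1 // => i _.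
  by rewrite (negPf (_ : i != j :> nat)) // neq_ltn (leq_trans (ltn_ord i) sj).
- by rewrite big1.
- by rewrite IHa IHb -big_split; apply: eq_bigr => i _; rewrite mulrzDr.
- by rewrite IHa -sumrN; apply: eq_bigr => i _; rewrite mulrNz.
Qed.
Lemma zeval_eq env a b :
  all (fun i => zcoef a i == zcoef b i) (iota 0 (size env)) ->
  zeval env a = zeval env b.
Proof.
move=> /allP h; rewrite !zeval_sum; apply: eq_bigr => i _; congr (_ *~ _).
by apply/eqP/h; rewrite mem_iota ltn_ord.
Qed.
End ZmodExpr.

Ltac zindex x l :=
  lazymatch l with
  | ?y :: ?l' => match l with
    | _ => let _ := match l with _ => constr:(erefl x : x = y) end in constr:(0%N)
    | _ => let n := zindex x l' in constr:(n.+1)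
    end
  end.
Ltac zinsert x l :=
  match l with
  | _ => let _ := zindex x l in l
  | _ => constr:(x :: l)
  end.
Ltac zatoms e l :=
  lazymatch e with
  | @GRing.add _ ?a ?b => let l' := zatoms b l in zatoms a l'
  | @GRing.opp _ ?a => zatoms a l
  | @GRing.zero _ => l
  | _ => zinsert e l
  end.
Ltac zreify e l :=
  lazymatch e with
  | @GRing.add _ ?a ?b =>
      let a' := zreify a l in let b' := zreify b l in constr:(ZAdd a' b')
  | @GRing.opp _ ?a => let a' := zreify a l in constr:(ZOpp a')
  | @GRing.zero _ => constr:(ZNil)
  | _ => let n := zindex e l in constr:(ZVar n)
  end.
(* Decides equalities that hold in every abelian group. *)
Ltac abel :=
  lazymatch goal with
  | |- @eq ?T ?a ?b =>
    let l0 := zatoms b (@nil T) in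
    let l := zatoms a l0 in
    let a' := zreify a l in let b' := zreify b l in
    exact: (@zeval_eq _ l a' b' isT)
  end.

Section Homs.
Variable A : dgRing.
Implicit Types X Y Z W : dgMod A.

Lemma ract_linear X Y (f : X -> Y) : zmod_morphism f ->
  (forall x (a : A), f (x ∙ a) = f x ∙ a) -> linear f.
Proof.
move=> fB fZ a x y; have f0 : f 0 = 0 by have := fB 0 0; rewrite !subrr.
have fN z : f (- z) = - f z by have := fB 0 z; rewrite f0 !sub0r.
have -> : a *: x + y = a *: x - - y by rewrite opprK.
by rewrite fB fN opprK; congr (_ + _); exact: (fZ x a).
Qed.

Lemma dgh_ract X Y (f : dgHom X Y) x (a : A) : f (x ∙ a) = f x ∙ a.
Proof. exact: linearZ. Qed.

Record gHom n X Y := GHom {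
  gh_fun :> X -> Y;
  gh_linear : linear gh_fun;
  gh_deg : forall i x, dm_gr Y (i + n) (gh_fun x) = gh_fun (dm_gr X i x)
}.
HB.instance Definition _ n X Y (f : gHom n X Y) :=
  GRing.isLinear.Build (A : pzRingType)^c X Y *:%R f (gh_linear f).

Lemma gh_ract n X Y (f : gHom n X Y) x (a : A) : f (x ∙ a) = f x ∙ a.
Proof. exact: linearZ. Qed.
Lemma gh_degE n X Y (f : gHom n X Y) i x :
  dm_gr Y i (f x) = f (dm_gr X (i - n) x).
Proof. by rewrite -gh_deg subrK. Qed.
Lemma gh_homog n X Y (f : gHom n X Y) i x :
  homog (dm_gr X) i x -> homog (dm_gr Y) (i + n) (f x).
Proof. by move=> hx; rewrite /homog gh_deg hx. Qed.
Lemma dgh_homog X Y (f : dgHom X Y) i x :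
  homog (dm_gr X) i x -> homog (dm_gr Y) i (f x).
Proof. by move=> hx; rewrite /homog dgh_deg hx. Qed.

Definition htp X Y (f g : dgHom X Y) : Prop :=
  exists h : gHom 1 X Y, forall x, dm_d (h x) + h (dm_d x) = f x - g x.

Section Arith.
Variables X Y : dgMod A.
Section G.
Variables (n : int) (f g : gHom n X Y).
Lemma gadd_linear : linear (fun x => f x + g x).
Proof. by move=> a x y; rewrite !linearP scalerDr; abel. Qed.
Lemma gadd_deg i x : dm_gr Y (i + n) (f x + g x) = f (dm_gr X i x) + g (dm_gr X i x).
Proof. by rewrite raddfD /= !gh_deg. Qed.
Definition gAdd : gHom n X Y := GHom gadd_linear gadd_deg.
Lemma gopp_linear : linear (fun x => - f x).
Proof. by move=> a x y; rewrite linearP scalerN opprD. Qed.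
Lemma gopp_deg i x : dm_gr Y (i + n) (- f x) = - f (dm_gr X i x).
Proof. by rewrite raddfN /= !gh_deg. Qed.
Definition gOpp : gHom n X Y := GHom gopp_linear gopp_deg.
End G.
Lemma gzero_linear : linear (fun _ : X => 0 : Y).
Proof. by move=> a x y; rewrite scaler0 addr0. Qed.
Lemma gzero_deg n i x : dm_gr Y (i + n) 0 = (fun _ : X => 0 : Y) (dm_gr X i x).
Proof. exact: raddf0. Qed.
Definition gZero n : gHom n X Y := GHom gzero_linear (@gzero_deg n).

Variables f g : dgHom X Y.
Lemma dgadd_linear : linear (fun x => f x + g x).
Proof. by move=> a x y; rewrite !linearP scalerDr; abel. Qed.
Lemma dgadd_deg i x : dm_gr Y i (f x + g x) = f (dm_gr X i x) + g (dm_gr X i x).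
Proof. by rewrite raddfD /= !dgh_deg. Qed.
Lemma dgadd_d x : dm_d (f x + g x) = f (dm_d x) + g (dm_d x).
Proof. by rewrite raddfD /= !dgh_d. Qed.
Definition dgAdd : dgHom X Y := DGHom dgadd_linear dgadd_deg dgadd_d.
Lemma dgopp_linear : linear (fun x => - f x).
Proof. by move=> a x y; rewrite linearP scalerN opprD. Qed.
Lemma dgopp_deg i x : dm_gr Y i (- f x) = - f (dm_gr X i x).
Proof. by rewrite raddfN /= !dgh_deg. Qed.
Lemma dgopp_d x : dm_d (- f x) = - f (dm_d x).
Proof. by rewrite raddfN /= !dgh_d. Qed.
Definition dgOpp : dgHom X Y := DGHom dgopp_linear dgopp_deg dgopp_d.
Lemma dgzero_deg i x : dm_gr Y i 0 = (fun _ : X => 0 : Y) (dm_gr X i x).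
Proof. exact: raddf0. Qed.
Lemma dgzero_d x : dm_d (0 : Y) = (fun _ : X => 0 : Y) (dm_d x).
Proof. exact: raddf0. Qed.
Definition dgZ : dgHom X Y := DGHom gzero_linear dgzero_deg dgzero_d.
Lemma dgh_deg0 i x : dm_gr Y (i + 0) (f x) = f (dm_gr X i x).
Proof. by rewrite addr0 dgh_deg. Qed.
Definition gOf : gHom 0 X Y := GHom (dgh_linear f) dgh_deg0.
End Arith.

Section GComp.
Variables (n m : int) (X Y Z : dgMod A).
Lemma gpre_linear (g : gHom m Y Z) (f : dgHom X Y) : linear (g \o f).
Proof. by move=> a x y; rewrite /= !linearP. Qed.
Lemma gpre_deg (g : gHom m Y Z) (f : dgHom X Y) i x :
  dm_gr Z (i + m) ((g \o f) x) = (g \o f) (dm_gr X i x).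
Proof. by rewrite /= gh_deg dgh_deg. Qed.
Definition gPre g f : gHom m X Z := GHom (gpre_linear g f) (gpre_deg g f).
Lemma gpost_linear (g : dgHom Y Z) (f : gHom m X Y) : linear (g \o f).
Proof. by move=> a x y; rewrite /= !linearP. Qed.
Lemma gpost_deg (g : dgHom Y Z) (f : gHom m X Y) i x :
  dm_gr Z (i + m) ((g \o f) x) = (g \o f) (dm_gr X i x).
Proof. by rewrite /= dgh_deg gh_deg. Qed.
Definition gPost g f : gHom m X Z := GHom (gpost_linear g f) (gpost_deg g f).
End GComp.

Section SumHoms.
Variables X Y : dgMod A.
Lemma inl_linear : linear (fun x : X => (x, 0) : dgSum X Y).
Proof. by move=> a x y; congr (_, _); rewrite /= scaler0 addr0. Qed.
Lemma inl_deg i x : dm_gr (dgSum X Y) i (x, 0) = (dm_gr X i x, 0).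
Proof. by congr (_, _); exact: raddf0. Qed.
Lemma inl_d x : dm_d ((x, 0) : dgSum X Y) = (dm_d x, 0).
Proof. by congr (_, _); exact: raddf0. Qed.
Definition dgInl : dgHom X (dgSum X Y) := DGHom inl_linear inl_deg inl_d.
Lemma inr_linear : linear (fun y : Y => (0, y) : dgSum X Y).
Proof. by move=> a x y; congr (_, _); rewrite /= scaler0 addr0. Qed.
Lemma inr_deg i y : dm_gr (dgSum X Y) i (0, y) = (0, dm_gr Y i y).
Proof. by congr (_, _); exact: raddf0. Qed.
Lemma inr_d y : dm_d ((0, y) : dgSum X Y) = (0, dm_d y).
Proof. by congr (_, _); exact: raddf0. Qed.
Definition dgInr : dgHom Y (dgSum X Y) := DGHom inr_linear inr_deg inr_d.
Lemma fst_linear : linear (fst : dgSum X Y -> X). Proof. by []. Qed.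
Definition dgFst : dgHom (dgSum X Y) X :=
  DGHom fst_linear (fun _ _ => erefl) (fun _ => erefl).
Lemma snd_linear : linear (snd : dgSum X Y -> Y). Proof. by []. Qed.
Definition dgSnd : dgHom (dgSum X Y) Y :=
  DGHom snd_linear (fun _ _ => erefl) (fun _ => erefl).
Variable W : dgMod A.
Section Pair.
Variables (f : dgHom W X) (g : dgHom W Y).
Lemma pair_linear : linear (fun w => (f w, g w) : dgSum X Y).
Proof. by move=> a x y; congr (_, _); rewrite /= linearP. Qed.
Lemma pair_deg i w : dm_gr (dgSum X Y) i (f w, g w) = (f (dm_gr W i w), g (dm_gr W i w)).
Proof. by congr (_, _); exact: dgh_deg. Qed.
Lemma pair_d w : dm_d ((f w, g w) : dgSum X Y) = (f (dm_d w), g (dm_d w)).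
Proof. by congr (_, _); exact: dgh_d. Qed.
Definition dgPair : dgHom W (dgSum X Y) := DGHom pair_linear pair_deg pair_d.
End Pair.
Section Copair.
Variables (f : dgHom X W) (g : dgHom Y W).
Notation k := (fun z : dgSum X Y => f z.1 + g z.2).
Lemma copair_linear : linear k.
Proof. by move=> a [x y] [x' y'] /=; rewrite !linearP scalerDr; abel. Qed.
Lemma copair_deg i z : dm_gr W i (k z) = k (dm_gr (dgSum X Y) i z).
Proof. by rewrite /= raddfD /= !dgh_deg. Qed.
Lemma copair_d z : dm_d (k z) = k (dm_d z).
Proof. by rewrite /= raddfD /= !dgh_d. Qed.
Definition dgCopair : dgHom (dgSum X Y) W := DGHom copair_linear copair_deg copair_d.
End Copair.
End SumHoms.

Section ConeRec.
Variables (X Y Z : dgMod A) (f : dgHom X Y) (g : dgHom Y Z) (h : gHom 1 X Z).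
Hypothesis gh : forall x, dm_d (h x) + h (dm_d x) = g (f x).
Notation k := (fun z : dgCone f => g z.1 + h z.2).
Lemma cone_rec_linear : linear k.
Proof.
move=> a [x y] [x' y'] /=; rewrite linearP (linearP h) scalerDr; abel.
Qed.
Lemma cone_rec_deg i z : dm_gr Z i (k z) = k (dm_gr (dgCone f) i z).
Proof. by rewrite /= raddfD /= dgh_deg (gh_degE h). Qed.
Lemma cone_rec_d z : dm_d (k z) = k (dm_d z).
Proof.
case: z => y x; rewrite /= !raddfD /= dgh_d -gh.
rewrite [shift_d _ _]/(- dm_d (x : X)) raddfN /=; abel.
Qed.
Definition coneRec : dgHom (dgCone f) Z := DGHom cone_rec_linear cone_rec_deg cone_rec_d.
End ConeRec.

Section Smul.
Variables (X : dgMod A) (a : deg0 A).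
Lemma smul_linear : linear (fun x : X => x ∙ deg0_val a).
Proof.
apply: ract_linear => [x y|x b]; first exact: ractBl.
by rewrite !ractA (comm_deg0 b (deg0P a)).
Qed.
Lemma smul_deg i x : dm_gr X i (x ∙ deg0_val a) = dm_gr X i x ∙ deg0_val a.
Proof. exact/pr_act0/deg0P. Qed.
Lemma smul_d (x : X) : dm_d (x ∙ deg0_val a) = dm_d x ∙ deg0_val a.
Proof. exact/d_act0/deg0P. Qed.
Definition dgSmul : dgHom X X := DGHom smul_linear smul_deg smul_d.
End Smul.
End Homs.

Arguments dm_mod : simpl never.
Arguments dm_gr : simpl never.
Arguments dm_d : simpl never.

Section DiffRules.
Variable A : dgRing.
Implicit Types X Y : dgMod A.
Lemma cone_dE X Y (f : dgHom X Y) (z : dgCone f) :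
  dm_d z = (dm_d (z.1 : Y) + f z.2, - dm_d (z.2 : X)) :> dgCone f.
Proof. by []. Qed.
Lemma sum_dE X Y (z : dgSum X Y) :
  dm_d z = (dm_d (z.1 : X), dm_d (z.2 : Y)) :> dgSum X Y.
Proof. by []. Qed.
Lemma cone_degE X Y (f : dgHom X Y) i (z : dgCone f) :
  dm_gr (dgCone f) i z = (dm_gr Y i z.1, dm_gr X (i - 1) z.2) :> dgCone f.
Proof. by []. Qed.
Lemma sum_degE X Y i (z : dgSum X Y) :
  dm_gr (dgSum X Y) i z = (dm_gr X i z.1, dm_gr Y i z.2) :> dgSum X Y.
Proof. by []. Qed.
End DiffRules.

(** * The derived category *)

#[export] Instance dEq_equivalence A X Y : Equivalence (@dEq A X Y).
Proof.
split=> [u|u v|u v w]; [exact: dEq_refl|exact: dEq_sym|exact: dEq_trans].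
Qed.
#[export] Instance dComp_proper A X Y Z :
  Proper (@dEq A Y Z ==> @dEq A X Y ==> @dEq A X Z) (@dComp A X Y Z).
Proof. by move=> u u' uu' v v'; exact: dEq_comp. Qed.

#[export] Hint Resolve dEq_refl : core.

Section QuasiIsos.
Variable A : dgRing.
Implicit Types X Y Z W : dgMod A.

Lemma pr_d X i (x : X) : dm_d (dm_gr X i x) = dm_gr X (i - 1) (dm_d x).
Proof. by rewrite dm_d_deg subrK. Qed.

(* The grading plays no role in being a quasi-isomorphism. *)
Lemma quasi_isoE X Y (f : dgHom X Y) : quasi_iso f <->
  (forall x y, dm_d x = 0 -> dm_d y = f x -> exists x', dm_d x' = x) /\
  (forall w, dm_d w = 0 -> exists x y, dm_d x = 0 /\ dm_d y = f x - w).
Proof.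
split=> [/quasi_isoP qf|[qi qs]].
  split=> [x y dx dy|w dw].
    have /choice [u hu] : forall i, exists u, dm_d u = dm_gr X i x.
      move=> i; have [qi _] := qf i.
      have [||u [_ hu]] := qi (dm_gr X i x) (homog_pr _ _ _).
      - by rewrite pr_d dx raddf0.
      - exists (dm_gr Y (i + 1) y); split; first exact: homog_pr.
        by rewrite pr_d addrK dy dgh_deg.
      by exists u.
    have [s [_ ->]] := pr_decomp (dm_gr X) x.
    by exists (\sum_(i <- s) u i); rewrite raddf_sum; apply: eq_bigr => i _; exact: hu.
  have /choice [u hu] : forall i, exists u, dm_d u.1 = 0 /\
      dm_d u.2 = f u.1 - dm_gr Y i w.
    move=> i; have [_ qs] := qf i.
    have [|x [_ dx [y [_ dy]]]] := qs (dm_gr Y i w) (homog_pr _ _ _).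
      by rewrite pr_d dw raddf0.
    by exists (x, y).
  have [s [_ ->]] := pr_decomp (dm_gr Y) w.
  exists (\sum_(i <- s) (u i).1), (\sum_(i <- s) (u i).2); split.
    by rewrite raddf_sum big1 // => i _; case: (hu i).
  rewrite !raddf_sum -big_split; apply: eq_bigr => i _; by case: (hu i).
apply/quasi_isoP => i; split=> [x hx dx [y [hy dy]]|w hw dw].
  have [x' dx'] := qi x y dx dy; exists (dm_gr X (i + 1) x').
  by split; [exact: homog_pr|rewrite pr_d addrK dx' hx].
have [x [y [dx dy]]] := qs w dw; exists (dm_gr X i x); split.
- exact: homog_pr.
- by rewrite pr_d dx raddf0.
- exists (dm_gr Y (i + 1) y); split; first exact: homog_pr.
  by rewrite pr_d addrK dy raddfB /= dgh_deg hw.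
Qed.

Definition acyclic X := forall x : X, dm_d x = 0 -> exists y, dm_d y = x.

Lemma quasi_iso_id X : quasi_iso (dgId X).
Proof.
apply/quasi_isoE; split=> [x y _ e|w dw]; first by exists y.
by exists w, 0; rewrite raddf0 /= subrr.
Qed.

Lemma quasi_iso_bij X Y (f : dgHom X Y) (g : dgHom Y X) :
  cancel f g -> cancel g f -> quasi_iso f.
Proof.
move=> fK gK; apply/quasi_isoE; split=> [x y _ e|w dw].
  by exists (g y); rewrite dgh_d e fK.
by exists (g w), 0; rewrite gK subrr raddf0 dgh_d dw raddf0.
Qed.

Lemma quasi_iso_comp X Y Z (g : dgHom Y Z) (f : dgHom X Y) :
  quasi_iso g -> quasi_iso f -> quasi_iso (dgComp g f).
Proof.
move=> /quasi_isoE [gi gs] /quasi_isoE [fi fs]; apply/quasi_isoE; split.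
  move=> x y dx dy; have [|z dz] := gi (f x) y _ dy; last exact: fi dx dz.
  by rewrite dgh_d dx raddf0.
move=> w dw; have [y [z [dy dz]]] := gs w dw; have [x [y' [dx dy']]] := fs y dy.
exists x, (g y' + z); split=> //.
by rewrite raddfD /= dgh_d dy' raddfB /= dz; abel.
Qed.

Lemma quasi_iso_acyclic X Y (f : dgHom X Y) : acyclic X -> acyclic Y -> quasi_iso f.
Proof.
move=> aX aY; apply/quasi_isoE; split=> [x y dx _|w dw]; first exact: aX.
by have [y dy] := aY w dw; exists 0, (- y); rewrite !raddf0 raddfN /= dy sub0r.
Qed.

Lemma acyclic_zero : acyclic (dgZero A).
Proof. by move=> x _; exists 0; rewrite raddf0 [x]thinmx0. Qed.
End QuasiIsos.

Section Homotopy.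
Variable A : dgRing.
Implicit Types X Y Z W : dgMod A.

Lemma htp_ext X Y (f g : dgHom X Y) : f =1 g -> htp f g.
Proof. by move=> e; exists (gZero X Y 1) => x; rewrite e subrr /= raddf0 addr0. Qed.
Lemma htp_refl X Y (f : dgHom X Y) : htp f f.
Proof. exact: htp_ext. Qed.
Lemma htp_sym X Y (f g : dgHom X Y) : htp f g -> htp g f.
Proof. by move=> [h hE]; exists (gOpp h) => x; rewrite /= raddfN /= -opprD hE opprB. Qed.
Lemma htp_trans X Y (f g k : dgHom X Y) : htp f g -> htp g k -> htp f k.
Proof.
move=> [h hE] [l lE]; exists (gAdd h l) => x /=; rewrite raddfD /=.
have -> : f x - k x = f x - g x + (g x - k x) by abel.
by rewrite -hE -lE; abel.
Qed.
Lemma htp_compl X Y Z (f g : dgHom X Y) (k : dgHom Y Z) :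
  htp f g -> htp (dgComp k f) (dgComp k g).
Proof.
move=> [h hE]; exists (gPost k h) => x /=.
by rewrite dgh_d -raddfD /= hE raddfB.
Qed.
Lemma htp_compr X Y Z (f g : dgHom X Y) (k : dgHom Z X) :
  htp f g -> htp (dgComp f k) (dgComp g k).
Proof. by move=> [h hE]; exists (gPre h k) => x /=; rewrite -dgh_d hE. Qed.

Lemma acyclic_cone_id X : acyclic (dgCone (dgId X)).
Proof.
move=> [y x]; rewrite cone_dE => -[] /= e _; exists (0, y).
rewrite cone_dE /= raddf0 add0r; congr (_, _).
by apply/eqP; rewrite eqr_oppLR -addr_eq0 e.
Qed.

Lemma fst_quasi_iso X Y : acyclic Y -> quasi_iso (dgFst X Y).
Proof.
move=> aY; apply/quasi_isoE; split=> [[x n] y [dx /aY [m dm]] /= dy|w dw].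
  by exists (y, m); congr (_, _).
by exists (w, 0), 0; rewrite /= subrr raddf0; split=> //; congr (_, _); rewrite ?raddf0.
Qed.

(* The two sections x |-> (x, 0) and x |-> (x, x) of the projection
   X (+) cone(id) -> X agree in the derived category. *)
Lemma htp_dEq X Y (f g : dgHom X Y) : htp f g -> dEq (dMap f) (dMap g).
Proof.
move=> [h hE]; pose C := dgCone (dgId X); pose p := dgFst X C.
have qp : quasi_iso p := fst_quasi_iso X (acyclic_cone_id (X := X)).
have kE x : dm_d (h x) + h (dm_d x) = dgAdd f (dgOpp g) (dgId X x) by exact: hE.
pose H := dgCopair g (coneRec kE).
pose i := dgInl X C; pose j := dgPair (dgId X) (dgConeIn (dgId X)).
have pE (k : dgHom X (dgSum X C)) : p \o k =1 id -> dEq (dMap k) (dInv qp).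
  move=> e; rewrite -[dMap k]dEq_idl -(dEq_invl qp) -dEq_assoc -dEq_map.
  have -> : dEq (dMap (dgComp p k)) (dMap (dgId X))
    by exact: (@dEq_ext _ _ _ (dgComp p k) (dgId X) e).
  by rewrite dEq_idr.
have ij : dEq (dMap i) (dMap j) by rewrite (pE i) // (pE j).
have -> : dEq (dMap f) (dComp (dMap H) (dMap j)).
  by rewrite -dEq_map; apply: dEq_ext => x /=; rewrite raddf0; abel.
have -> : dEq (dMap g) (dComp (dMap H) (dMap i)).
  by rewrite -dEq_map; apply: dEq_ext => x /=; rewrite !raddf0; abel.
by rewrite ij.
Qed.
End Homotopy.

Definition dgFib (A : dgRing) (X Y : dgMod A) (k : dgHom X Y) : dgMod A :=
  dgShift (- 1) (dgCone k).

Section Fibre.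
Variable A : dgRing.
Implicit Types X Y Z W : dgMod A.

Section Def.
Variables (X Y : dgMod A) (k : dgHom X Y).
Notation dgFib := (dgFib k).

Lemma fib_dE (z : dgFib) :
  dm_d z = (- (dm_d (z.1 : Y) + k z.2), dm_d (z.2 : X)) :> dgFib.
Proof. by case: z => y x; congr (_, _); exact: opprK. Qed.
Lemma fib_degE i (z : dgFib) :
  dm_gr dgFib i z = (dm_gr Y (i + 1) z.1, dm_gr X i z.2) :> dgFib.
Proof.
case: z => y x; have e : i - - 1 = i + 1 by rewrite opprK.
congr (_, _).
by rewrite [LHS]/(dm_gr X (i - - 1 - 1) x) e addrK.
Qed.

Lemma fib_out_linear : linear (snd : dgFib -> X). Proof. by []. Qed.
Lemma fib_out_deg i z : dm_gr X i z.2 = (snd : dgFib -> X) (dm_gr dgFib i z).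
Proof. by rewrite fib_degE. Qed.
Lemma fib_out_d (z : dgFib) : dm_d (z.2 : X) = (dm_d z).2.
Proof. by rewrite fib_dE. Qed.
Definition dgFibOut : dgHom dgFib X := DGHom fib_out_linear fib_out_deg fib_out_d.

Lemma fib_top_linear : linear (fst : dgFib -> Y). Proof. by []. Qed.
Lemma fib_top_deg i z : dm_gr Y (i + 1) z.1 = (fst : dgFib -> Y) (dm_gr dgFib i z).
Proof. by rewrite fib_degE. Qed.
Definition gFibTop : gHom 1 dgFib Y := GHom fib_top_linear fib_top_deg.

Lemma fib_topE (z : dgFib) : dm_d (gFibTop z) + gFibTop (dm_d z) = - k z.2.
Proof. by rewrite fib_dE /=; abel. Qed.

Lemma fib_acyclic : quasi_iso k -> acyclic dgFib.
Proof.
move=> /quasi_isoE [ki ks] [y x]; rewrite fib_dE => -[] /= /eqP.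
rewrite oppr_eq0 => /eqP ey dx.
have [|x0 dx0] := ki x (- y) dx.
  by apply/eqP; rewrite raddfN /= eqr_oppLR -addr_eq0 ey.
have [|x1 [y1 [dx1 dy1]]] := ks (y + k x0).
  by rewrite raddfD /= dgh_d dx0.
exists (y1, x0 - x1); rewrite fib_dE /= dy1 !raddfB /= dx0 dx1; congr (_, _).
  abel.
exact: subr0.
Qed.
End Def.

Section Corec.
Variables (X Y W : dgMod A) (k : dgHom X Y) (u : gHom 1 W Y) (v : dgHom W X).
Hypothesis uv : forall w, dm_d (u w) + u (dm_d w) = - k (v w).
Lemma fib_corec_linear : linear (fun w => (u w, v w) : dgFib k).
Proof. by move=> a x y; congr (_, _); rewrite /= linearP. Qed.
Lemma fib_corec_deg i w :
  dm_gr (dgFib k) i (u w, v w) = (u (dm_gr W i w), v (dm_gr W i w)).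
Proof. by rewrite fib_degE /= gh_deg dgh_deg. Qed.
Lemma fib_corec_d w : dm_d ((u w, v w) : dgFib k) = (u (dm_d w), v (dm_d w)).
Proof.
rewrite fib_dE /= dgh_d; congr (_, _).
have -> : k (v w) = - (dm_d (u w) + u (dm_d w)) by rewrite uv opprK.
abel.
Qed.
Definition fibCorec : dgHom W (dgFib k) :=
  DGHom fib_corec_linear fib_corec_deg fib_corec_d.
End Corec.

Lemma ore X W Y (g : dgHom X Y) (t : dgHom W Y) : quasi_iso t ->
  exists P (p : dgHom P X) (q : dgHom P W),
    quasi_iso p /\ htp (dgComp g p) (dgComp t q).
Proof.
move=> /quasi_isoE [ti ts]; pose k := dgCopair g (dgOpp t).
exists (dgFib k), (dgComp (dgFst X W) (dgFibOut k)).
exists (dgComp (dgSnd X W) (dgFibOut k)); split; last first.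
  by exists (gOpp (gFibTop k)) => z; have /= e := fib_topE z; rewrite /= raddfN /= -opprD e opprK.
apply/quasi_isoE; split=> [[y [x w]] x'|x dx].
  rewrite fib_dE => -[] /= /eqP; rewrite oppr_eq0 => /eqP ey dx dw dx'.
  have [|w0 dw0] := ti w (y + g x') dw.
    rewrite raddfD /= dgh_d dx' -[t w]add0r -ey; abel.
  have [|c [y2 [dc dy2]]] := ts (t w0 - y - g x').
    rewrite !raddfB /= !dgh_d dw0 dx' -oppr0 -ey; abel.
  exists (- y2, (x', w0 - c)); rewrite fib_dE sum_dE /= raddfN /= dy2 (raddfB t).
  congr (_, _); first abel.
  by congr (_, _); rewrite // raddfB /= dw0 dc subr0.
have [|w [y [dw dy]]] := ts (g x); first by rewrite dgh_d dx raddf0.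
exists (y, (x, w)), 0; rewrite fib_dE sum_dE raddf0 /= subrr; split=> //.
congr (_, _); last by congr (_, _).
rewrite dy; abel.
Qed.

Lemma htp_cancel Z X Y (f g : dgHom Z X) (t : dgHom X Y) : quasi_iso t ->
  htp (dgComp t f) (dgComp t g) ->
  exists Z' (r : dgHom Z' Z), quasi_iso r /\ htp (dgComp f r) (dgComp g r).
Proof.
move=> qt [h hE].
have fg w : dm_d (gOpp h w) + gOpp h (dm_d w) = - t (dgAdd f (dgOpp g) w).
  by rewrite /= raddfN /= -opprD hE (raddfB t).
have q0 : quasi_iso (dgZ (dgZero A) (dgFib t)).
  by apply: quasi_iso_acyclic; [exact: acyclic_zero|exact: fib_acyclic].
have [P [p [q [qp pq]]]] := ore (fibCorec fg) q0; exists P, p; split=> //.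
have [l lE] := htp_compl (dgFibOut t) pq; exists l => x.
by rewrite lE /= subr0.
Qed.
End Fibre.

Section Fractions.
Variable A : dgRing.
Implicit Types X Y Z W V : dgMod A.

Lemma dEq_ore X W Y P (g : dgHom X Y) (t : dgHom W Y) (p : dgHom P X) (q : dgHom P W)
    (qt : quasi_iso t) (qp : quasi_iso p) :
  htp (dgComp g p) (dgComp t q) ->
  dEq (dComp (dInv qt) (dMap g)) (dComp (dMap q) (dInv qp)).
Proof.
move=> /htp_dEq; rewrite !dEq_map => e.
rewrite -[dMap g]dEq_idr -(dEq_invr qp) (dEq_assoc (dMap g)) e.
by rewrite -!dEq_assoc (dEq_assoc (dInv qt)) dEq_invl dEq_idl.
Qed.

Lemma fraction X Y (u : dMor X Y) :
  exists Z (s : dgHom Z X) (qs : quasi_iso s) (f : dgHom Z Y),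
    dEq u (dComp (dMap f) (dInv qs)).
Proof.
elim: u => {X Y} [X Y f|X Y s qs|X Y Z u [U [s [qs [f ue]]]] v [V [t [qt [g ve]]]]].
- exists X, (dgId X), (quasi_iso_id X), f.
  by rewrite -[X in dEq X _]dEq_idr -(dEq_invr (quasi_iso_id X)) dEq_idl.
- by exists X, s, qs, (dgId X); rewrite dEq_idl.
have [P [p [q [qp pq]]]] := ore g qs.
exists P, (dgComp t p), (quasi_iso_comp qt qp), (dgComp f q).
rewrite ue ve -!dEq_assoc (dEq_assoc (dInv qs)) (dEq_ore qs qp pq) dEq_map -!dEq_assoc.
apply: dEq_comp => //; apply: dEq_comp => //.
rewrite -[dComp (dInv qp) _]dEq_idr -(dEq_invr (quasi_iso_comp qt qp)).
rewrite dEq_map -!dEq_assoc (dEq_assoc (dInv qt)) dEq_invl dEq_idl.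
by rewrite (dEq_assoc (dInv qp)) dEq_invl dEq_idl.
Qed.

Record roof X Y := Roof {
  fr_obj : dgMod A; fr_s : dgHom fr_obj X; fr_q : quasi_iso fr_s;
  fr_f : dgHom fr_obj Y
}.

Definition roof_eq X Y (a b : roof X Y) : Prop :=
  exists W (t : dgHom W (fr_obj a)) (t' : dgHom W (fr_obj b)),
  [/\ quasi_iso t, quasi_iso t', htp (dgComp (fr_s a) t) (dgComp (fr_s b) t')
    & htp (dgComp (fr_f a) t) (dgComp (fr_f b) t')].

Definition roof_push X Y Z (g : dgHom Y Z) (a : roof X Y) : roof X Z :=
  Roof (fr_q a) (dgComp g (fr_f a)).

Lemma htp_quasi_iso X Y (f g : dgHom X Y) : htp f g -> quasi_iso f -> quasi_iso g.
Proof.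
move=> [h hE] /quasi_isoE [fi fs]; apply/quasi_isoE; split=> [x y dx dy|w dw].
  apply: (fi x (y + h x)) => //; rewrite raddfD /= dy.
  by rewrite -[dm_d (h x)]addr0 -(raddf0 h) -dx hE; abel.
have [x [y [dx dy]]] := fs w dw; exists x, (y - h x); split=> //.
by rewrite raddfB /= dy -[dm_d (h x)]addr0 -(raddf0 h) -dx hE; abel.
Qed.

Lemma quasi_iso_cancel X Y Z (g : dgHom Y Z) (f : dgHom X Y) :
  quasi_iso g -> quasi_iso (dgComp g f) -> quasi_iso f.
Proof.
move=> /quasi_isoE [gi gs] /quasi_isoE [ci cs]; apply/quasi_isoE; split.
  by move=> x y dx dy; apply: (ci x (g y)) => //; rewrite dgh_d dy.
move=> w dw; have [|x [z [dx dz]]] := cs (g w); first by rewrite dgh_d dw raddf0.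
have [||y dy] := gi (f x - w) z.
- by rewrite raddfB /= dgh_d dx dw raddf0 subr0.
- by rewrite dz raddfB.
by exists x, y.
Qed.

Lemma roof_eq_refl X Y (a : roof X Y) : roof_eq a a.
Proof.
exists (fr_obj a), (dgId _), (dgId _).
by split; [exact: quasi_iso_id|exact: quasi_iso_id|exact: htp_refl|exact: htp_refl].
Qed.
Lemma roof_eq_sym X Y (a b : roof X Y) : roof_eq a b -> roof_eq b a.
Proof.
by move=> [W [t [t' [q q' h h']]]]; exists W, t', t; split=> //; exact: htp_sym.
Qed.
Lemma roof_eq_trans X Y (a b c : roof X Y) : roof_eq a b -> roof_eq b c -> roof_eq a c.
Proof.
move=> [W [t [t' [qt qt' h1 h2]]]] [V [r [r' [qr qr' k1 k2]]]].
have [P [p [q [qp pq]]]] := ore t' qr.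
have qq : quasi_iso q.
  by apply: (quasi_iso_cancel qr); apply: htp_quasi_iso pq (quasi_iso_comp qt' qp).
exists P, (dgComp t p), (dgComp r' q); split; try exact: quasi_iso_comp.
  apply: (htp_trans (htp_compr p h1)).
  apply: (htp_trans (htp_compl (fr_s b) pq)); exact: (htp_compr q k1).
apply: (htp_trans (htp_compr p h2)).
apply: (htp_trans (htp_compl (fr_f b) pq)); exact: (htp_compr q k2).
Qed.
Lemma roof_eq_push X Y Z (g : dgHom Y Z) (a b : roof X Y) :
  roof_eq a b -> roof_eq (roof_push g a) (roof_push g b).
Proof.
move=> [W [t [t' [q q' h h']]]]; exists W, t, t'; split=> //.
exact: (htp_compl g h').
Qed.
Lemma roof_push_inj X Y Z (g : dgHom Y Z) (a b : roof X Y) : quasi_iso g ->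
  roof_eq (roof_push g a) (roof_push g b) -> roof_eq a b.
Proof.
move=> qg [W [t [t' [q q' h h']]]].
have [V [r [qr hr]]] := htp_cancel qg (h' : htp (dgComp g (dgComp _ t)) (dgComp g (dgComp _ t'))).
exists V, (dgComp t r), (dgComp t' r); split; try exact: quasi_iso_comp.
  exact: (htp_compr r h).
exact: hr.
Qed.
Lemma roof_push_surj X Y Z (g : dgHom Y Z) (a : roof X Z) : quasi_iso g ->
  exists b : roof X Y, roof_eq a (roof_push g b).
Proof.
move=> qg; have [P [p [q [qp pq]]]] := ore (fr_f a) qg.
exists (Roof (quasi_iso_comp (fr_q a) qp) q), P, p, (dgId P); split=> //.
- exact: quasi_iso_id.
- exact: htp_refl.
Qed.

Fixpoint dRel V X Y (u : dMor X Y) : roof V X -> roof V Y -> Prop :=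
  match u with
  | dMap _ _ g => fun a b => roof_eq b (roof_push g a)
  | dInv _ _ t _ => fun a b => roof_eq a (roof_push t b)
  | dComp _ _ _ u v => fun a c => exists b, dRel v a b /\ dRel u b c
  end.

Lemma dRel_closed V X Y (u : dMor X Y) (a a' : roof V X) (b b' : roof V Y) :
  roof_eq a a' -> roof_eq b b' -> dRel u a b -> dRel u a' b'.
Proof.
elim: u a a' b b' => {X Y} [X Y f|X Y s qs|X Y Z u IHu v IHv] a a' b b' aa bb /=.
- move=> h; apply: (roof_eq_trans (roof_eq_sym bb)); apply: (roof_eq_trans h).
  exact: roof_eq_push.
- move=> h; apply: (roof_eq_trans (roof_eq_sym aa)); apply: (roof_eq_trans h).
  exact: roof_eq_push.
- move=> [c [h1 h2]]; exists c; split.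
    exact: (IHv _ _ _ _ aa (roof_eq_refl c) h1).
  exact: (IHu _ _ _ _ (roof_eq_refl c) bb h2).
Qed.

Lemma dRel_dEq V X Y (u v : dMor X Y) : dEq u v ->
  forall (a : roof V X) (b : roof V Y), dRel u a b <-> dRel v a b.
Proof.
have rr (X' Y' : dgMod A) (a : roof X' Y') : roof_eq a a := roof_eq_refl a.
have id_push (X' Y' : dgMod A) (a : roof X' Y') : roof_eq a (roof_push (dgId _) a).
  exists (fr_obj a), (dgId _), (dgId _).
  by split; [exact: quasi_iso_id|exact: quasi_iso_id|exact: htp_refl|exact: htp_refl].
elim=> {X Y u v} [X Y u|X Y u v _ IH|X Y u v w _ IH1 _ IH2
  |X Y Z u u' v v' _ IHu _ IHv|X Y Z W u v w|X Y u|X Y u|X Y f g fg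
  |X Y Z g f|X Y s qs|X Y s qs] a b //=.
- by split=> /IH.
- by split=> [/IH1 /IH2|/IH2 /IH1].
- by split=> -[c [/IHv h1 /IHu h2]]; exists c.
- split=> [[c [[d [h1 h2]] h3]]|[d [h1 [c [h2 h3]]]]].
    by exists d; split=> //; exists c.
  by exists c; split=> //; exists d.
- split=> [[c [h1 h2]]|h]; last by exists b; split.
  apply: (dRel_closed (rr _ _ a) _ h1); apply: (roof_eq_trans (id_push _ _ c)).
  exact: roof_eq_sym.
- split=> [[c [h1 h2]]|h].
    apply: (dRel_closed _ (rr _ _ b) h2); apply: (roof_eq_trans h1).
    exact/roof_eq_sym/id_push.
  by exists a; split.
- have e : roof_eq (roof_push f a) (roof_push g a).
    exists (fr_obj a), (dgId _), (dgId _).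
    split; [exact: quasi_iso_id|exact: quasi_iso_id|exact: htp_refl|].
    by apply: htp_ext => x /=; rewrite fg.
  by split=> h; apply: (roof_eq_trans h) => //; exact: roof_eq_sym.
- split=> [h|[c [h1 h2]]]; first by exists (roof_push f a).
  exact: (roof_eq_trans h2 (roof_eq_push g h1)).
- split=> [[c [h1 h2]]|h].
    apply: roof_eq_trans (id_push _ _ a); apply: (roof_push_inj qs).
    exact: (roof_eq_trans (roof_eq_sym h2) h1).
  exists (roof_push s a); split=> //; apply: roof_eq_push.
  by apply: (roof_eq_trans (id_push _ _ a)); exact: roof_eq_sym.
- split=> [[c [h1 h2]]|h].
    apply: roof_eq_trans (id_push _ _ a); exact: (roof_eq_trans h2 (roof_eq_sym h1)).
  have [c hc] := roof_push_surj a qs; exists c; split=> //.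
  apply: (roof_eq_trans h); apply: roof_eq_trans hc.
  exact/roof_eq_sym/id_push.
Qed.

Lemma dEq_htp X Y (f g : dgHom X Y) : dEq (dMap f) (dMap g) ->
  exists Z (t : dgHom Z X), quasi_iso t /\ htp (dgComp f t) (dgComp g t).
Proof.
move=> /(dRel_dEq (V := X)) e; have qi := quasi_iso_id X.
have [/(_ (roof_eq_refl _)) h _] := e (Roof qi (dgId X)) (Roof qi f).
case: h => W [t [t' [qt qt' h1 h2]]]; exists W, t; split=> //=.
apply: (htp_trans h2); apply: (htp_compl g); exact: htp_sym.
Qed.
End Fractions.

(** * Functors and natural transformations *)

Record dgFunctor (A B : dgRing) := DGFunctor {
  fo :> dgMod A -> dgMod B;
  fh : forall X Y, dgHom X Y -> dgHom (fo X) (fo Y);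
  fh_ext : forall X Y (f g : dgHom X Y), f =1 g -> fh f =1 fh g;
  fh_id : forall X, fh (dgId X) =1 id;
  fh_comp : forall X Y Z (g : dgHom Y Z) (f : dgHom X Y),
    fh (dgComp g f) =1 fh g \o fh f;
  fh_quasi_iso : forall X Y (f : dgHom X Y), quasi_iso f -> quasi_iso (fh f)
}.

Section Functors.
Variables A B : dgRing.
Implicit Types (F G : dgFunctor A B) (X Y Z : dgMod A).

Fixpoint fMor F X Y (u : dMor X Y) : dMor (F X) (F Y) :=
  match u with
  | dMap _ _ f => dMap (fh F f)
  | dInv _ _ _ qs => dInv (fh_quasi_iso F qs)
  | dComp _ _ _ u v => dComp (fMor F u) (fMor F v)
  end.

Lemma fMor_dEq F X Y (u v : dMor X Y) : dEq u v -> dEq (fMor F u) (fMor F v).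
Proof.
have fid X' : dEq (dMap (fh F (dgId X'))) (dMap (dgId (F X'))).
  by apply: dEq_ext; exact: fh_id.
elim=> {X Y u v} /=.
- by [].
- by move=> X Y u v _ ->.
- by move=> X Y u v w _ -> _ ->.
- by move=> X Y Z u u' v v' _ -> _ ->.
- by move=> X Y Z W u v w; exact: dEq_assoc.
- by move=> X Y u; rewrite fid dEq_idl.
- by move=> X Y u; rewrite fid dEq_idr.
- by move=> X Y f g fg; apply: dEq_ext; exact: fh_ext.
- by move=> X Y Z g f; rewrite -dEq_map; apply: dEq_ext; exact: fh_comp.
- by move=> X Y s qs; rewrite fid dEq_invl.
- by move=> X Y s qs; rewrite fid dEq_invr.
Qed.

Lemma nat_dEq F G (eta : forall X, dgHom (F X) (G X)) :
  (forall X Y (f : dgHom X Y), dgComp (eta Y) (fh F f) =1 dgComp (fh G f) (eta X)) ->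
  forall X Y (u : dMor X Y),
    dEq (dComp (dMap (eta Y)) (fMor F u)) (dComp (fMor G u) (dMap (eta X))).
Proof.
move=> nat X Y; elim=> {X Y} /= [X Y f|X Y s qs|X Y Z u IHu v IHv].
- by rewrite -!dEq_map; apply: dEq_ext; exact: nat.
- set qF := fh_quasi_iso F qs; set qG := fh_quasi_iso G qs.
  rewrite -[dMap (eta X)]dEq_idl -(dEq_invl qG) -!dEq_assoc.
  rewrite (dEq_assoc (dMap (fh G s))).
  have <- : dEq (dComp (dMap (eta Y)) (dMap (fh F s))) (dComp (dMap (fh G s)) (dMap (eta X))).
    by rewrite -!dEq_map; apply: dEq_ext; exact: nat.
  by rewrite -dEq_assoc dEq_invr dEq_idr.
- by rewrite dEq_assoc IHu -!dEq_assoc IHv.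
Qed.
End Functors.

Definition dgIdFunctor A : dgFunctor A A.
Proof. by exists (fun X => X) (fun X Y f => f). Defined.
Definition dgCompFunctor A B C (G : dgFunctor B C) (F : dgFunctor A B) : dgFunctor A C.
Proof.
exists (fun X => G (F X)) (fun X Y f => fh G (fh F f)).
- by move=> X Y f g fg; apply: fh_ext; exact: fh_ext.
- by move=> X x; rewrite (fh_ext (g := dgId _)) ?fh_id //; exact: fh_id.
- move=> X Y Z g f x; rewrite /= (fh_ext (g := dgComp (fh F g) (fh F f))) ?fh_comp //.
  exact: fh_comp.
- by move=> X Y f qf; apply: fh_quasi_iso; exact: fh_quasi_iso.
Defined.
Lemma fMor_id A X Y (u : dMor X Y) : dEq (fMor (dgIdFunctor A) u) u.
Proof.
elim: u => {X Y} [//|X Y s qs|X Y Z u IHu v IHv] /=; last by rewrite IHu IHv.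
rewrite -[X in dEq X _]dEq_idr -(dEq_invr qs).
by rewrite dEq_assoc dEq_invl dEq_idl.
Qed.
Lemma fMor_comp A B C (G : dgFunctor B C) (F : dgFunctor A B) X Y (u : dMor X Y) :
  dEq (fMor (dgCompFunctor G F) u) (fMor G (fMor F u)).
Proof.
elim: u => {X Y} [//|X Y s qs|X Y Z u IHu v IHv] /=; last by rewrite IHu IHv.
set q2 := fh_quasi_iso G _.
by rewrite -[X in dEq X _]dEq_idr -(dEq_invr q2) dEq_assoc dEq_invl dEq_idl.
Qed.

Definition d_retract A (X Y : dgMod A) : Prop :=
  exists (i : dMor X Y) (r : dMor Y X), dEq (dComp r i) (dMap (dgId X)).

Section Isos.
Variable A : dgRing.
Implicit Types X Y Z W : dgMod A.

Lemma quasi_iso_d_iso X Y (s : dgHom X Y) : quasi_iso s -> d_iso X Y.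
Proof.
by move=> qs; exists (dMap s), (dInv qs); rewrite dEq_invl dEq_invr.
Qed.
Lemma d_iso_refl X : d_iso X X.
Proof. exact: quasi_iso_d_iso (quasi_iso_id X). Qed.
Lemma d_iso_sym X Y : d_iso X Y -> d_iso Y X.
Proof. by move=> [u [v [vu uv]]]; exists v, u. Qed.
Lemma d_iso_trans X Y Z : d_iso X Y -> d_iso Y Z -> d_iso X Z.
Proof.
move=> [u [v [vu uv]]] [u' [v' [vu' uv']]]; exists (dComp u' u), (dComp v v'); split.
  by rewrite -dEq_assoc (dEq_assoc v') vu' dEq_idl.
by rewrite -dEq_assoc (dEq_assoc u) uv dEq_idl.
Qed.
Lemma bij_d_iso X Y (f : dgHom X Y) (g : dgHom Y X) :
  cancel f g -> cancel g f -> d_iso X Y.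
Proof. by move=> fK gK; apply: quasi_iso_d_iso; exact: quasi_iso_bij fK gK. Qed.
Lemma d_iso_retract X Y : d_iso X Y -> d_retract X Y.
Proof. by move=> [u [v [vu uv]]]; exists u, v. Qed.
Lemma d_retract_trans X Y Z : d_retract X Y -> d_retract Y Z -> d_retract X Z.
Proof.
move=> [u [v vu]] [u' [v' vu']]; exists (dComp u' u), (dComp v v').
by rewrite -dEq_assoc (dEq_assoc v') vu' dEq_idl.
Qed.
Lemma sum_retract X Y : d_retract X (dgSum X Y).
Proof.
exists (dMap (dgInl X Y)), (dMap (dgFst X Y)); rewrite -dEq_map.
exact: dEq_ext.
Qed.

Lemma fMor_iso B (F : dgFunctor A B) X Y : d_iso X Y -> d_iso (F X) (F Y).
Proof.
have fid Z : dEq (fMor F (dMap (dgId Z))) (dMap (dgId (F Z))).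
  by apply: dEq_ext; exact: fh_id.
move=> [u [v [vu uv]]]; exists (fMor F u), (fMor F v).
by rewrite -!fid; split; [exact: (fMor_dEq F vu)|exact: (fMor_dEq F uv)].
Qed.
Lemma fMor_retract B (F : dgFunctor A B) X Y : d_retract X Y -> d_retract (F X) (F Y).
Proof.
move=> [u [v vu]]; exists (fMor F u), (fMor F v).
rewrite (fMor_dEq F vu : dEq (dComp _ _) _); apply: dEq_ext; exact: fh_id.
Qed.

Definition dgSumHom X Y X' Y' (f : dgHom X X') (g : dgHom Y Y') :
  dgHom (dgSum X Y) (dgSum X' Y') :=
  dgPair (dgComp f (dgFst X Y)) (dgComp g (dgSnd X Y)).
Lemma quasi_iso_sum X Y X' Y' (f : dgHom X X') (g : dgHom Y Y') :
  quasi_iso f -> quasi_iso g -> quasi_iso (dgSumHom f g).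
Proof.
move=> /quasi_isoE [fi fs] /quasi_isoE [gi gs]; apply/quasi_isoE; split.
  move=> [x y] [x' y']; rewrite !sum_dE => -[dx dy] -[ex ey].
  have [x1 dx1] := fi x x' dx ex; have [y1 dy1] := gi y y' dy ey.
  by exists (x1, y1); rewrite sum_dE /= dx1 dy1.
move=> [x y]; rewrite sum_dE => -[dx dy].
have [x1 [x2 [dx1 dx2]]] := fs x dx; have [y1 [y2 [dy1 dy2]]] := gs y dy.
by exists (x1, y1), (x2, y2); rewrite !sum_dE /= dx1 dy1 dx2 dy2.
Qed.
Definition dgSumL W : dgFunctor A A.
Proof.
exists (fun X => dgSum X W) (fun X Y f => dgSumHom f (dgId W)).
- by move=> X Y f g fg [x w] /=; rewrite fg.
- by move=> X [].
- by [].
- by move=> X Y f qf; apply: quasi_iso_sum => //; exact: quasi_iso_id.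
Defined.
Definition dgSumR W : dgFunctor A A.
Proof.
exists (fun X => dgSum W X) (fun X Y f => dgSumHom (dgId W) f).
- by move=> X Y f g fg [x w] /=; rewrite fg.
- by move=> X [].
- by [].
- by move=> X Y f qf; apply: quasi_iso_sum => //; exact: quasi_iso_id.
Defined.
Lemma sum_d_iso X Y X' Y' : d_iso X X' -> d_iso Y Y' -> d_iso (dgSum X Y) (dgSum X' Y').
Proof.
move=> xx yy; apply: (@d_iso_trans _ (dgSum X' Y)).
  exact: (fMor_iso (dgSumL Y) xx).
exact: (fMor_iso (dgSumR X') yy).
Qed.
Lemma sum_zero_iso X : d_iso X (dgSum X (dgZero A)).
Proof.
apply: (bij_d_iso (f := dgInl X (dgZero A)) (g := dgFst X (dgZero A))) => // -[x z].
by congr (_, _); rewrite [z]thinmx0.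
Qed.

Lemma shift_ext n X Y (f g : dgHom X Y) : f =1 g -> dgShiftHom n f =1 dgShiftHom n g.
Proof. by move=> fg x; exact: fg. Qed.
Definition dgShiftFunctor n : dgFunctor A A :=
  @DGFunctor A A (dgShift n) (@dgShiftHom A n) (@shift_ext n)
    (fun _ _ => erefl) (fun _ _ _ _ _ _ => erefl) (@shift_quasi_iso A n).

End Isos.

(** * Finite generation of homology *)

Section NoetherianModules.
Variable R : comPzRingType.
Hypothesis R_noeth : noetherian R.

Definition submod (M : lmodType R) (N : M -> Prop) : Prop :=
  [/\ N 0, forall x y, N x -> N y -> N (x + y) & forall r x, N x -> N (r *: x)].

Lemma span_cat (M : lmodType R) n m (g : 'I_n -> M) (h : 'I_m -> M) (c : 'I_n -> R)
    (d : 'I_m -> R) : exists e : 'I_(n + m) -> R,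
  \sum_k c k *: g k + \sum_k d k *: h k =
  \sum_k e k *: match split k with inl i => g i | inr j => h j end.
Proof.
exists (fun k => match split k with inl i => c i | inr j => d j end).
rewrite big_split_ord /=; congr (_ + _); apply: eq_bigr => k _.
  by case: split_ordP => j /eqP; rewrite ?eq_lrshift // eq_lshift => /eqP ->.
by case: split_ordP => j /eqP; rewrite ?eq_rlshift // eq_rshift => /eqP ->.
Qed.

Lemma submod_fin_gen n (M : lmodType R) (g : 'I_n -> M) (N : M -> Prop) : submod N ->
  (forall x, N x -> exists c : 'I_n -> R, x = \sum_k c k *: g k) ->
  exists m (h : 'I_m -> M), (forall k, N (h k)) /\
    forall x, N x -> exists c : 'I_m -> R, x = \sum_k c k *: h k.
Proof.
elim: n g N => [|n IH] g N [N0 ND NZ] Ng.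
  exists 0%N, (fun=> 0); split=> [[]//|x /Ng [c ->]].
  by exists (fun=> 0); rewrite !big_ord0.
pose g' k := g (widen_ord (leqnSn n) k).
pose I a := exists x, N x /\ exists c : 'I_n -> R,
  x = \sum_k c k *: g' k + a *: g ord_max.
have [|m [a [Ia aI]]] := R_noeth (I := I).
  split.
  - exists 0; split=> //; exists (fun=> 0); rewrite scale0r addr0 big1 // => k _.
    exact: scale0r.
  - move=> a b [x [Nx [c xE]]] [y [Ny [d yE]]]; exists (x + y); split; first exact: ND.
    exists (fun k => c k + d k); rewrite xE yE scalerDl addrACA -big_split.
    by congr (_ + _); apply: eq_bigr => k _; rewrite scalerDl.
  - move=> r a [x [Nx [c xE]]]; exists (r *: x); split; first exact: NZ.
    exists (fun k => r * c k); rewrite xE scalerDr scaler_sumr scalerA.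
    by congr (_ + _); apply: eq_bigr => k _; rewrite scalerA.
have /choice [x xP] := Ia.
pose N' y := N y /\ exists c : 'I_n -> R, y = \sum_k c k *: g' k.
have [|y [_]//|p [h [Nh hN]]] := IH g' N'.
  split.
  - split=> //; exists (fun=> 0); rewrite big1 // => k _; exact: scale0r.
  - move=> u v [Nu [c uE]] [Nv [d vE]]; split; first exact: ND.
    exists (fun k => c k + d k); rewrite uE vE -big_split.
    by apply: eq_bigr => k _; rewrite scalerDl.
  - move=> r u [Nu [c uE]]; split; first exact: NZ.
    by exists (fun k => r * c k); rewrite uE scaler_sumr; apply: eq_bigr => k _; rewrite scalerA.
exists (p + m)%N, (fun k => match split k with inl i => h i | inr j => x j end); split.
  by move=> k; case: split => j; [case: (Nh j)|case: (xP j)].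
move=> z Nz; have [c zE] := Ng z Nz.
have [|b bE] := aI (c ord_max).
  exists z; split=> //; exists (fun k => c (widen_ord (leqnSn n) k)).
  by rewrite zE big_ord_recr.
have /choice [e eP] : forall j, exists e : 'I_n -> R,
    x j = \sum_k e k *: g' k + a j *: g ord_max by move=> j; case: (xP j) => _ [e eE]; exists e.
have NS (J : finType) (F : J -> M) (s : J -> R) : (forall j, N (F j)) -> N (\sum_j s j *: F j).
  by move=> NF; elim/big_ind: _ => // j _; exact: NZ.
have [|d dE] := hN (z - \sum_j b j *: x j).
  split.
    apply: ND => //; rewrite -scaleN1r; apply: NZ; apply: NS => j; by case: (xP j).
  exists (fun k => c (widen_ord (leqnSn n) k) - \sum_j b j * e j k).
  rewrite [in LHS]zE big_ord_recr /= bE scaler_suml.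
  have -> : \sum_j b j *: x j =
      \sum_k (\sum_j b j * e j k) *: g' k + \sum_j (b j * a j) *: g ord_max.
    under eq_bigr => j _ do rewrite (eP j) scalerDr scalerA scaler_sumr.
    rewrite big_split /=; congr (_ + _); rewrite exchange_big; apply: eq_bigr => k _.
    by rewrite scaler_suml; apply: eq_bigr => j _; rewrite scalerA.
  under [RHS]eq_bigr => k _ do rewrite scalerBl.
  rewrite sumrB; abel.
have [f fE] := span_cat h x d b; exists f; rewrite -fE -dE; abel.
Qed.

Lemma fin_gen_ext (M1 M M2 : lmodType R) (f : {linear M1 -> M}) (g : {linear M -> M2}) :
  (forall m, g m = 0 -> exists m1, f m1 = m) ->
  fin_gen M1 -> fin_gen M2 -> fin_gen M.
Proof.
move=> ex [n [u uP]] [m [v vP]]; pose N y := exists x, g x = y.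
have [|y _|p [h [Nh hN]]] := submod_fin_gen (g := v) (N := N).
- split; first by exists 0; exact: raddf0.
    by move=> _ _ [x <-] [y <-]; exists (x + y); exact: raddfD.
  by move=> r _ [x <-]; exists (r *: x); rewrite linearZ.
- exact: vP.
have /choice [w wE] := Nh.
exists (n + p)%N, (fun k => match split k with inl i => f (u i) | inr j => w j end).
move=> x; have [|c cE] := hN (g x); first by exists x.
have [|m1 m1E] := ex (x - \sum_k c k *: w k).
  rewrite linearB /= cE linear_sum; apply/eqP; rewrite subr_eq0; apply/eqP.
  by apply: eq_bigr => k _; rewrite linearZ /= wE.
have [d dE] := uP m1; have [e eE] := span_cat (fun k => f (u k)) w d c.
exists e; rewrite -eE.
have -> : \sum_k d k *: f (u k) = f m1.
  by rewrite dE linear_sum; apply: eq_bigr => k _; rewrite linearZ.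
by rewrite m1E subrK.
Qed.

Lemma fin_gen_surj (M N : lmodType R) (f : {linear M -> N}) :
  (forall y, exists x, f x = y) -> fin_gen M -> fin_gen N.
Proof.
move=> fs [n [g gP]]; exists n, (fun k => f (g k)) => y; have [x <-] := fs y.
have [c ->] := gP x; exists c; rewrite linear_sum; apply: eq_bigr => k _.
exact: linearZ.
Qed.
End NoetherianModules.

Section HomologyElements.
Variable A : dgRing.
Implicit Types X Y Z : dgMod A.

Definition hzero X i : Prop := forall x : X,
  homog (dm_gr X) i x -> dm_d x = 0 -> exists y, dm_d y = x.

Definition hfg X i : Prop := exists n (g : 'I_n -> X),
  (forall k, homog (dm_gr X) i (g k) /\ dm_d (g k) = 0) /\
  forall x, homog (dm_gr X) i x -> dm_d x = 0 ->
    exists (c : 'I_n -> deg0 A) y, x = \sum_k g k ∙ deg0_val (c k) + dm_d y.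

Lemma toH0_surj (a : H0 A) : exists b : deg0 A, a = toH0 b.
Proof.
have [z ->] := hclassP a.
have z0 : cycle_val z \in @in_deg0 A by apply/eqP; exact: (cycle_homog z).
by exists (Deg0 z0); congr hclass; exact: val_inj.
Qed.

Lemma hclass_eqE X i (z w : cycle X i) :
  hclass z = hclass w <-> exists y, dm_d y = cycle_val z - cycle_val w.
Proof.
split=> [/hclass_eqP /asboolP [y [_ dy]]|[y dy]]; first by exists y.
apply/hclass_eqP/asboolP; exists (dm_gr X (i + 1) y); split; first exact: homog_pr.
rewrite pr_d addrK dy raddfB /=; congr (_ - _); exact: cycle_homog.
Qed.

Lemma hclass_eq0 X i (z : cycle X i) :
  hclass z = 0 <-> exists y, dm_d y = cycle_val z.
Proof. by rewrite -(raddf0 (@hclass A X i)) hclass_eqE /= subr0. Qed.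

Lemma act0_homog X i (x : X) (a : deg0 A) :
  homog (dm_gr X) i x -> homog (dm_gr X) i (x ∙ deg0_val a).
Proof. by move=> hx; have := dm_act hx (deg0P a); rewrite addr0. Qed.

Fact act0_cycle X i (z : cycle X i) (a : deg0 A) :
  cycle_val z ∙ deg0_val a \in in_cycle (X := X) i.
Proof.
apply: mk_cycle; first exact/act0_homog/cycle_homog.
by rewrite d_act0 ?cycle_d ?ract0l //; exact: deg0P.
Qed.
Lemma toH0_scale X i (z : cycle X i) (a : deg0 A) :
  toH0 a *: hclass z = hclass (Cycle (act0_cycle z a)).
Proof. by rewrite [LHS]hactE; congr hclass; exact: val_inj. Qed.

Lemma hzeroP X i : (forall h : homology X i, h = 0) <-> hzero X i.
Proof.
split=> [h0 x hx dx|h0 h].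
  by have /hclass_eq0 := h0 (hclass (Cycle (mk_cycle hx dx))).
have [z ->] := hclassP h; apply/hclass_eq0; apply: h0; last exact: cycle_d.
exact: cycle_homog.
Qed.

Lemma cycle_val_sum X i (I : finType) (F : I -> cycle X i) :
  cycle_val (\sum_k F k) = \sum_k cycle_val (F k).
Proof. exact: (raddf_sum (val : cycle X i -> X)). Qed.

Lemma hfgP X i : fin_gen (homology X i) <-> hfg X i.
Proof.
split=> [[n [g gP]]|[n [g [gc gP]]]].
  have /choice [z zE] : forall k, exists z, g k = hclass z by move=> k; exact: hclassP.
  exists n, (fun k => cycle_val (z k)); split.
    by move=> k; split; [exact: cycle_homog|exact: cycle_d].
  move=> x hx dx; have [c] := gP (hclass (Cycle (mk_cycle hx dx))).
  have /choice [b bE] : forall k, exists b, c k = toH0 b by move=> k; exact: toH0_surj.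
  under eq_bigr => k _ do rewrite zE bE toH0_scale.
  rewrite -raddf_sum /= => /hclass_eqE [y]; rewrite cycle_val_sum /= => dy.
  by exists b, y; rewrite dy addrC subrK.
pose z k : cycle X i := Cycle (mk_cycle (proj1 (gc k)) (proj2 (gc k))).
exists n, (fun k => hclass (z k)) => h; have [w ->] := hclassP h.
have [c [y cE]] := gP _ (cycle_homog w) (cycle_d w).
exists (fun k => toH0 (c k)).
under eq_bigr => k _ do rewrite toH0_scale.
rewrite -raddf_sum /=; apply/hclass_eqE; exists y.
by rewrite cycle_val_sum cE /= addrC addKr.
Qed.

Lemma DfbP X : Dfb X <-> (exists n : nat, forall i : int, (n < `|i|)%N -> hzero X i) /\
  forall i, hfg X i.
Proof.
split=> -[[n hn] hf]; split.
- by exists n => i ni; apply/hzeroP; exact: hn.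
- by move=> i; apply/hfgP; exact: hf.
- by exists n => i ni; apply/hzeroP; exact: hn.
- by move=> i; apply/hfgP; exact: hf.
Qed.

Lemma hmap_linear X Y (f : dgHom X Y) i : linear (@hmap A X Y f i).
Proof.
move=> a h k; have [b ->] := toH0_surj a.
have [z ->] := hclassP h; have [w ->] := hclassP k.
rewrite toH0_scale -raddfD /= !hmapE toH0_scale -raddfD /=; congr hclass.
by apply: val_inj; rewrite /= raddfD /= dgh_ract.
Qed.
HB.instance Definition _ X Y (f : dgHom X Y) i :=
  GRing.isLinear.Build (H0 A) (homology X i) (homology Y i) *:%R (@hmap A X Y f i)
    (@hmap_linear X Y f i).

Definition hsurj X Y (f : dgHom X Y) i : Prop := forall w,
  homog (dm_gr Y) i w -> dm_d w = 0 -> exists x y, dm_d x = 0 /\ dm_d y = f x - w.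
Definition hinj X Y (f : dgHom X Y) i : Prop := forall x y,
  homog (dm_gr X) i x -> dm_d x = 0 -> dm_d y = f x -> exists x', dm_d x' = x.

Lemma quasi_iso_surj X Y (f : dgHom X Y) i : quasi_iso f -> hsurj f i.
Proof. by move=> /quasi_isoE [_ fs] w _; exact: fs. Qed.
Lemma quasi_iso_inj X Y (f : dgHom X Y) i : quasi_iso f -> hinj f i.
Proof. by move=> /quasi_isoE [fi _] x y _; exact: fi. Qed.

Lemma hsurjP X Y (f : dgHom X Y) i : hsurj f i -> forall w,
  homog (dm_gr Y) i w -> dm_d w = 0 ->
  exists x y, [/\ homog (dm_gr X) i x, dm_d x = 0 & dm_d y = f x - w].
Proof.
move=> fs w hw dw; have [x [y [dx dy]]] := fs w hw dw.
exists (dm_gr X i x), (dm_gr Y (i + 1) y); split; first exact: homog_pr.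
  by rewrite pr_d dx raddf0.
by rewrite pr_d addrK dy raddfB /= dgh_deg hw.
Qed.

Lemma hzero_surj X Y (f : dgHom X Y) i : hsurj f i -> hzero X i -> hzero Y i.
Proof.
move=> fs h0 w hw dw; have [x [y [hx dx dy]]] := hsurjP fs hw dw.
have [x' dx'] := h0 x hx dx; exists (f x' - y).
by rewrite raddfB /= dgh_d dx' dy opprB addrC subrK.
Qed.

Lemma hfg_surj X Y (f : dgHom X Y) i : hsurj f i -> hfg X i -> hfg Y i.
Proof.
move=> fs /hfgP hX; apply/hfgP.
apply: (@fin_gen_surj _ _ _ (@hmap A X Y f i)) hX => h.
have [w ->] := hclassP h.
have [x [y [hx dx dy]]] := hsurjP fs (cycle_homog w) (cycle_d w).
exists (hclass (Cycle (mk_cycle hx dx))); rewrite /= hmapE; apply/hclass_eqE.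
by exists y.
Qed.

Lemma hzero_inj X Y (f : dgHom X Y) i : hinj f i -> hzero Y i -> hzero X i.
Proof.
move=> fi h0 x hx dx; have [||y dy] := h0 (f x); first exact: dgh_homog.
  by rewrite dgh_d dx raddf0.
exact: fi dy.
Qed.

Lemma hfg_iso X Y (f : dgHom X Y) i : hinj f i -> hsurj f i -> hfg Y i -> hfg X i.
Proof.
move=> fi fs [n [g [gc gP]]].
have /choice [u uP] : forall k, exists u, [/\ homog (dm_gr X) i u, dm_d u = 0
    & exists y, dm_d y = f u - g k].
  move=> k; have [hg dg] := gc k; have [x [y [hx dx dy]]] := hsurjP fs hg dg.
  by exists x; split=> //; exists y.
exists n, u; split=> [k|x hx dx]; first by case: (uP k).
have [||c [y cE]] := gP (f x); first exact: dgh_homog.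
  by rewrite dgh_d dx raddf0.
have /choice [v vE] : forall k, exists v, dm_d v = f (u k) - g k by move=> k; case: (uP k).
have [|||x' dx'] := fi (x - \sum_k u k ∙ deg0_val (c k))
    (y - \sum_k v k ∙ deg0_val (c k)).
- apply: homogB => //; rewrite /homog raddf_sum; apply: eq_bigr => k _ /=.
  by apply: act0_homog; case: (uP k).
- rewrite raddfB /= dx raddf_sum big1 ?subrr // => k _ /=.
  by rewrite d_act0; [case: (uP k) => _ -> _; exact: ract0l|exact: deg0P].
- rewrite [LHS]raddfB [RHS]raddfB /= [dm_d (\sum_(k < n) _)]raddf_sum.
  rewrite [f (\sum_(k < n) _)]raddf_sum cE /=.
  have -> : \sum_k dm_d (v k ∙ deg0_val (c k)) =
      \sum_k f (u k ∙ deg0_val (c k)) - \sum_k g k ∙ deg0_val (c k).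
    rewrite -sumrB; apply: eq_bigr => k _.
    by rewrite d_act0 ?vE ?ractBl ?dgh_ract //; exact: deg0P.
  by abel.
by exists c, x'; rewrite dx' addrC subrK.
Qed.

Lemma Dfb_quasi_iso X Y (s : dgHom X Y) : quasi_iso s -> (Dfb X <-> Dfb Y).
Proof.
move=> qs; split=> /DfbP [[n hn] hf]; apply/DfbP; split.
- by exists n => i ni; apply: (hzero_surj (quasi_iso_surj qs)); exact: hn.
- by move=> i; apply: (hfg_surj (quasi_iso_surj qs)).
- by exists n => i ni; apply: (hzero_inj (quasi_iso_inj qs)); exact: hn.
- by move=> i; apply: (hfg_iso (quasi_iso_inj qs) (quasi_iso_surj qs)).
Qed.

Lemma htp_hsurj X Y (f g : dgHom X Y) i : htp f g -> hsurj f i -> hsurj g i.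
Proof.
move=> [h hE] fs w hw dw; have [x [y [dx dy]]] := fs w hw dw.
exists x, (y - h x); split=> //; have := hE x; rewrite dx raddf0 addr0 => hx.
by rewrite raddfB /= dy hx; abel.
Qed.

Lemma hsurj_comp_inv X Y Z (f : dgHom Y Z) (g : dgHom X Y) i :
  hsurj (dgComp f g) i -> hsurj f i.
Proof.
move=> fs w hw dw; have [x [y [dx dy]]] := fs w hw dw.
by exists (g x), y; rewrite dgh_d dx raddf0.
Qed.

Lemma Dfb_retract X Y : d_retract X Y -> Dfb Y -> Dfb X.
Proof.
move=> [u [v]]; have [V [s [qs [f ->]]]] := fraction v.
have [W [t [qt [k ->]]]] := fraction u.
have [P [p [q [qp pq]]]] := ore k qs.
rewrite -dEq_assoc (dEq_assoc (dInv qs)) (dEq_ore qs qp pq) -!dEq_assoc !dEq_assoc.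
rewrite -dEq_map => e.
have {}e : dEq (dMap (dgComp f q)) (dMap (dgComp t p)).
  rewrite -[dMap (dgComp f q)]dEq_idr -(dEq_invl qp) dEq_assoc.
  rewrite -[dComp _ (dInv qp)]dEq_idr -(dEq_invl qt) dEq_assoc e dEq_idl.
  by rewrite dEq_map.
have [Q [r [qr hr]]] := dEq_htp e.
move=> /(Dfb_quasi_iso qs) /DfbP [[n hn] hf].
have fs i : hsurj f i.
  apply: (@hsurj_comp_inv _ _ _ f (dgComp q r)).
  apply: (htp_hsurj (f := dgComp (dgComp t p) r)); first exact: htp_sym hr.
  by apply: quasi_iso_surj; do 2?apply: quasi_iso_comp.
apply/DfbP; split=> [|i]; last exact: hfg_surj (fs i) (hf i).
by exists n => i ni; exact: hzero_surj (fs i) (hn i ni).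
Qed.

Lemma Dfb_iso X Y : d_iso X Y -> Dfb Y -> Dfb X.
Proof. by move=> /d_iso_retract; exact: Dfb_retract. Qed.

Lemma Dfb_zero : Dfb (dgZero A).
Proof.
apply/DfbP; split=> [|i].
  by exists 0%N => i _ x _ _; exists 0; rewrite raddf0 [x]thinmx0.
exists 0%N, (fun=> 0); split=> [[]//|x _ _].
by exists (fun=> 0), 0; rewrite [LHS]thinmx0 [RHS]thinmx0.
Qed.

Lemma shift_cycle n X (x : X) : @dm_d A (dgShift n X) x = 0 <-> dm_d x = 0.
Proof.
rewrite -[@dm_d _ (dgShift n X) x]/(ksign n (dm_d x)).
by split=> [e|->]; [rewrite -[LHS](ksignK n) e ksign0|exact: ksign0].
Qed.
Lemma shift_boundary n X (x y : X) :
  @dm_d A (dgShift n X) (ksign n y) = x <-> dm_d y = x.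
Proof.
rewrite -[@dm_d _ (dgShift n X) _]/(ksign n (dm_d (ksign n y))).
by rewrite (ksign_add (@dm_d_additive _ X)) ksignK.
Qed.

Lemma Dfb_shift n X : Dfb X -> Dfb (dgShift n X).
Proof.
move=> /DfbP [[m hm] hf]; apply/DfbP; split.
  exists (m + `|n|)%N => i mi x hx /shift_cycle dx.
  have [|y dy] := hm (i - n) _ x hx dx; first by lia.
  by exists (ksign n y : X); exact/shift_boundary.
move=> i; have [k [g [gc gP]]] := hf (i - n); exists k, g; split.
  by move=> j; have [hg dg] := gc j; split=> //; exact/shift_cycle.
move=> x hx /shift_cycle dx; have [c [y ->]] := gP x hx dx.
exists c, (ksign n y : X); congr (_ + _); symmetry; exact/shift_boundary.
Qed.

Hypothesis A_noeth : noetherian (H0 A).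

Lemma Dfb_cone X Y (f : dgHom X Y) : Dfb X -> Dfb Y -> Dfb (dgCone f).
Proof.
move=> /(Dfb_shift 1) /DfbP [[n hn] hX] /DfbP [[m hm] hY].
have ex i (z : dgCone f) : homog (dm_gr (dgCone f)) i z -> dm_d z = 0 ->
    (exists x1, @dm_d A (dgShift 1 X) x1 = z.2) ->
    exists y, [/\ homog (dm_gr Y) i y, dm_d y = 0 &
      exists w, dm_d w = z - dgConeIn f y].
  case: z => y x hz; rewrite cone_dE /= => -[e1 e2] [x0 dx0].
  have [hy hx] : homog (dm_gr Y) i y /\ homog (dm_gr (dgShift 1 X)) i x.
    by split; [exact: (congr1 fst hz)|exact: (congr1 snd hz)].
  pose x1 := dm_gr (dgShift 1 X) (i + 1) x0.
  have hx1 : homog (dm_gr X) i x1.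
    by rewrite /x1 -[dm_gr _ _ _]/(dm_gr X (i + 1 - 1) x0) addrK; exact: homog_pr.
  have e3 : - dm_d (x1 : X) = x.
    have <- : @dm_d A (dgShift 1 X) x1 = x by rewrite /x1 pr_d addrK dx0 hx.
    by [].
  exists (y - f x1); split.
  - by apply: homogB => //; exact: dgh_homog.
  - by rewrite raddfB /= dgh_d -[X in f X]opprK e3 raddfN /= opprK.
  - exists (0, x1); rewrite cone_dE /= raddf0 add0r e3.
    by apply/eqP; rewrite -subr_eq0; apply/eqP; congr (_, _) => /=; abel.
apply/DfbP; split.
  exists (n + m)%N => i ni z hz dz.
  have [|||x1 dx1] := hn i _ z.2; first by lia.
  - exact: (congr1 snd hz).
  - exact: (congr1 snd dz).
  have [|y [hy dy [w dw]]] := ex i z hz dz; first by exists x1.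
  have [|v dv] := hm i _ y hy dy; first by lia.
  by exists (w + dgConeIn f v); rewrite raddfD /= dw cone_in_d dv subrK.
move=> i; apply/hfgP.
have /hfgP fX := hX i; have /hfgP fY := hY i.
apply: (fin_gen_ext A_noeth (f := @hmap A _ _ (dgConeIn f) i)
  (g := @hmap A _ _ (dgConeOut f) i)) fY fX => h.
have [z ->] := hclassP h; rewrite /= hmapE => /hclass_eq0 /= dx1.
have [y [hy dy [w dw]]] := ex i _ (cycle_homog z) (cycle_d z) dx1.
exists (hclass (Cycle (mk_cycle hy dy))); rewrite hmapE; apply/hclass_eqE.
by exists (- w); rewrite raddfN /= dw opprB.
Qed.
End HomologyElements.

(** * Thick subcategories *)

Section ThickLemmas.
Variable A : dgRing.
Implicit Types X Y Z W : dgMod A.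

Lemma dEq_idE X (f : dgHom X X) : f =1 id -> dEq (dMap f) (dMap (dgId X)).
Proof. exact: (@dEq_ext _ _ _ f (dgId X)). Qed.
Lemma d_is_iso_id X : d_is_iso (dMap (dgId X)).
Proof. by exists (dMap (dgId X)); rewrite dEq_idl. Qed.
Lemma d_is_iso_comp X Y Z (u : dMor Y Z) (v : dMor X Y) :
  d_is_iso u -> d_is_iso v -> d_is_iso (dComp u v).
Proof.
move=> [u' [h1 h2]] [v' [k1 k2]]; exists (dComp v' u'); split.
  by rewrite -dEq_assoc (dEq_assoc u') h1 dEq_idl.
by rewrite -dEq_assoc (dEq_assoc v) k2 dEq_idl.
Qed.

Lemma exact_triangle_iso X Y Z W (u : dMor X Y) (v : dMor Y Z)
    (w : dMor Z (dgShift 1 X)) (s : dMor Y W) (t : dMor W Y) :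
  dEq (dComp t s) (dMap (dgId Y)) -> dEq (dComp s t) (dMap (dgId W)) ->
  exact_triangle u v w -> exact_triangle (dComp s u) (dComp v t) w.
Proof.
move=> ts st [X' [Y' [f [a [b [c [[ia ib ic] [e1 e2 e3]]]]]]]].
exists X', Y', f, a, (dComp b t), c; split; split=> //.
- by apply: d_is_iso_comp => //; exists s.
- by rewrite -dEq_assoc (dEq_assoc t) ts dEq_idl.
- by rewrite dEq_assoc e2 -!dEq_assoc.
Qed.

Lemma exact_triangle_cone X Y (f : dgHom X Y) :
  exact_triangle (dMap f) (dMap (dgConeIn f)) (dMap (dgConeOut f)).
Proof.
exists X, Y, f, (dMap (dgId X)), (dMap (dgId Y)), (dMap (dgId _)); split; split=> //;
  try exact: d_is_iso_id.
- by rewrite dEq_idl dEq_idr.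
- by rewrite dEq_idl dEq_idr.
- rewrite dEq_idr /=; rewrite (dEq_idE (f := dgShiftHom 1 (dgId X))) ?dEq_idl //.
Qed.

Lemma Dfb_sum X Y : Dfb X -> Dfb Y -> Dfb (dgSum X Y).
Proof.
move=> /DfbP [[n hn] hX] /DfbP [[m hm] hY].
have sum_homog i (z : dgSum X Y) : homog (dm_gr (dgSum X Y)) i z ->
    homog (dm_gr X) i z.1 /\ homog (dm_gr Y) i z.2.
  by move=> hz; split; [exact: (congr1 fst hz)|exact: (congr1 snd hz)].
apply/DfbP; split.
  exists (n + m)%N => i ni [x y] /sum_homog [hx hy]; rewrite sum_dE => -[dx dy].
  have [|x' dx'] := hn i _ x hx dx; first by lia.
  have [|y' dy'] := hm i _ y hy dy; first by lia.
  by exists (x', y'); rewrite sum_dE /= dx' dy'.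
move=> i; have [k [g [gc gP]]] := hX i; have [l [h [hc hP]]] := hY i.
exists (k + l)%N, (fun j => match split j with
  inl j => (g j, 0) | inr j => (0, h j) end : dgSum X Y); split.
  move=> j; case: split => a; split.
  - rewrite /homog sum_degE /= raddf0; congr (_, _); by case: (gc a).
  - by rewrite sum_dE /= raddf0; case: (gc a) => _ ->.
  - rewrite /homog sum_degE /= raddf0; congr (_, _); by case: (hc a).
  - by rewrite sum_dE /= raddf0; case: (hc a) => _ ->.
move=> [x y] /sum_homog [hx hy]; rewrite sum_dE => -[dx dy].
have [c [x' xE]] := gP x hx dx; have [d [y' yE]] := hP y hy dy.
exists (fun j => match split j with inl j => c j | inr j => d j end), (x', y').
rewrite big_split_ord /= sum_dE /= [x in LHS]xE [y in LHS]yE.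
have e1 : \sum_j (match split (lshift l j) with
      inl a => (g a, 0) | inr a => (0, h a) end : dgSum X Y)
   ∙ deg0_val (match split (lshift l j) with inl a => c a | inr a => d a end) =
   (\sum_j g j ∙ deg0_val (c j), 0).
  rewrite -[(\sum_j _, 0)]/(dgInl X Y _) raddf_sum; apply: eq_bigr => j _.
  case: split_ordP => a /eqP; rewrite ?eq_lrshift // eq_lshift => /eqP ->.
  by congr (_, _); exact: ract0l.
have e2 : \sum_j (match split (rshift k j) with
      inl a => (g a, 0) | inr a => (0, h a) end : dgSum X Y)
   ∙ deg0_val (match split (rshift k j) with inl a => c a | inr a => d a end) =
   (0, \sum_j h j ∙ deg0_val (d j)).
  rewrite -[(0, \sum_j _)]/(dgInr X Y _) raddf_sum; apply: eq_bigr => j _.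
  case: split_ordP => a /eqP; rewrite ?eq_rlshift // eq_rshift => /eqP ->.
  by congr (_, _); exact: ract0l.
rewrite e1 e2; congr (_, _) => /=; abel.
Qed.

Section ThickDfb.
Variable G : dgMod A -> Prop.
Notation S := (@Dfb A).

Lemma thick1_iso X Y : thick1 S G X -> d_iso X Y -> Dfb Y -> thick1 S G Y.
Proof.
move=> tX XY SY; apply: (thick1_summand SY (Dfb_zero A) tX).
exact: d_iso_trans XY (sum_zero_iso Y).
Qed.

Lemma thick1_Dfb X : (forall Y, G Y -> Dfb Y) -> thick1 S G X -> Dfb X.
Proof.
move=> hG; elim=> {X} [X /hG//||X Y _ hX _ hY|//|n X _ hX].
- exact: Dfb_zero.
- exact: Dfb_sum.
- exact: Dfb_shift.
Qed.

Lemma thick_Dfb n X : (forall Y, G Y -> Dfb Y) -> thick S G n X -> Dfb X.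
Proof.
by move=> hG; case: n => [[]|[|n]] //=; [exact: thick1_Dfb|case].
Qed.

Lemma thick_iso n X Y : thick S G n X -> d_iso X Y -> Dfb Y -> thick S G n Y.
Proof.
case: n => [|[|n]].
- by move=> [_ X0] XY SY; split=> //; exact: d_iso_trans (d_iso_sym XY) X0.
- exact: thick1_iso.
move=> [_ [X' [X1 [X2 [u [v [w [SX' t1 t2 ex]]]]]]]] XY SY; split=> //.
have [s [t [ts st]]] := sum_d_iso XY (d_iso_refl X').
exists X', X1, X2, (dComp s u), (dComp v t), w; split=> //.
exact: exact_triangle_iso.
Qed.

(* Exact triangles may be taken to be mapping cone triangles. *)
Lemma thickSP n X : (forall Y, G Y -> Dfb Y) -> thick S G n.+2 X <-> Dfb X /\
  exists X' X1 Y (f : dgHom X1 Y),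
    [/\ Dfb X', thick1 S G X1, thick S G n.+1 (dgCone f) & d_iso Y (dgSum X X')].
Proof.
move=> hG; split=> [[SX [X' [X1 [X2 [u [v [w [SX' t1 t2 ex]]]]]]]]|].
  split=> //; have [X1' [Y' [f [a [b [c [[ia ib ic] _]]]]]]] := ex.
  have ia' : d_iso X1 X1' by exists a.
  have ic' : d_iso X2 (dgCone f) by exists c.
  exists X', X1', Y', f; split=> //.
  - apply: (thick1_iso t1 ia'); apply: (Dfb_iso (d_iso_sym ia')).
    exact: thick1_Dfb t1.
  - apply: (@thick_iso n.+1 X2 _ t2 ic'); apply: (Dfb_iso (d_iso_sym ic')).
    exact: (@thick_Dfb n.+1 X2).
  - by apply: d_iso_sym; exists b.
move=> [SX [X' [X1 [Y [f [SX' t1 t2 [s [t [ts st]]]]]]]]]; split=> //.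
exists X', X1, (dgCone f), (dComp s (dMap f)), (dComp (dMap (dgConeIn f)) t).
exists (dMap (dgConeOut f)); split=> //.
exact/exact_triangle_iso/exact_triangle_cone.
Qed.
End ThickDfb.
End ThickLemmas.

Section Retracts.
Variable A : dgRing.
Implicit Types X Y Z W T : dgMod A.

Lemma split_quasi_iso X Q V (f : dgHom V X) (k : dgHom Q V) (t : dgHom Q X) :
  quasi_iso t -> htp (dgComp f k) t ->
  quasi_iso (dgCopair k (dgFibOut f)).
Proof.
move=> /quasi_isoE [ti ts] [h /= hE].
have hc x : dm_d x = 0 -> f (k x) = t x + dm_d (h x).
  by move=> dx; have := hE x; rewrite dx raddf0 addr0 => ->; abel.
apply/quasi_isoE; split=> [[x [y w]] v|w dw].
  rewrite sum_dE fib_dE /= => -[dx /eqP]; rewrite oppr_eq0 addr_eq0 => /eqP dy dw dv.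
  have [|x0 dx0] := ti x (f v + y - h x) dx.
    by rewrite raddfB raddfD /= dgh_d dv raddfD /= hc // dy; abel.
  pose w3 := v - k x0.
  have dw3 : dm_d w3 = w by rewrite raddfB /= dgh_d dv dx0; abel.
  have [|z [e [dz de]]] := ts (- y - f w3).
    by rewrite raddfB raddfN /= dgh_d dw3 dy; abel.
  exists (x0, (- e - h z, w3 + k z)); rewrite sum_dE fib_dE /=.
  rewrite dx0 [dm_d (w3 + _)]raddfD /= dw3 dgh_d dz raddf0 addr0.
  have -> : dm_d (- e - h z) = - (t z - (- y - f w3)) - dm_d (h z).
    by rewrite raddfB raddfN /= de.
  have -> : f (w3 + k z) = f w3 + (t z + dm_d (h z)) by rewrite raddfD /= hc.
  by congr (_, (_, _)); abel.
have [|z [e [dz de]]] := ts (f w); first by rewrite dgh_d dw raddf0.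
exists (z, (e + h z, w - k z)), 0; rewrite sum_dE fib_dE /= dz.
rewrite [dm_d (w - _)]raddfB /= dgh_d dz raddf0 dw subr0 [dm_d (e + _)]raddfD /= de.
have -> : f (w - k z) = f w - (t z + dm_d (h z)) by rewrite raddfB /= hc.
rewrite raddf0; split; last by abel.
by congr (_, (_, _)); abel.
Qed.

Lemma retract_summand X T : d_retract X T -> exists X', d_iso T (dgSum X X').
Proof.
move=> [u [v vu]]; have [V [s [qs [f ve]]]] := fraction v.
have [X0 [t0 [qt0 [k0 ie]]]] := fraction (dComp (dInv qs) u).
have e : dEq (dMap (dgComp f k0)) (dMap t0).
  rewrite -[dMap t0]dEq_idl -vu ve -(dEq_assoc (dMap f)) ie -!dEq_assoc dEq_invl dEq_idr.
  exact: dEq_map.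
have [Q [r [qr hr]]] := dEq_htp e.
have qt := quasi_iso_comp qt0 qr.
have q : quasi_iso (dgCopair (dgComp k0 r) (dgFibOut f)).
  by apply: (split_quasi_iso qt); apply: htp_trans hr; exact: htp_ext.
exists (dgFib f); apply: d_iso_trans (d_iso_sym (quasi_iso_d_iso qs)) _.
apply: d_iso_trans (d_iso_sym (quasi_iso_d_iso q)) _.
apply: sum_d_iso; [exact: quasi_iso_d_iso qt|exact: d_iso_refl].
Qed.

Variable G : dgMod A -> Prop.
Hypothesis hG : forall Y, G Y -> Dfb Y.
Notation S := (@Dfb A).

Lemma thick_retract n X T : d_retract X T -> thick S G n.+1 T -> thick S G n.+1 X.
Proof.
move=> XT tT; have [X' iX'] := retract_summand XT.
have ST : Dfb T := thick_Dfb hG tT.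
have SX : Dfb X := Dfb_retract XT ST.
have SX' : Dfb X'.
  apply: Dfb_retract ST; apply: d_retract_trans (d_iso_retract (d_iso_sym iX')).
  exists (dMap (dgInr X X')), (dMap (dgSnd X X')); rewrite -dEq_map.
  exact: dEq_ext.
case: n tT => [|n] tT; first exact: thick1_summand SX SX' tT iX'.
apply/(thickSP _ _ hG); split=> //.
move/(thickSP _ _ hG): tT => [_ [T' [X1 [Y [f [ST' t1 t2 iY]]]]]].
exists (dgSum X' T'), X1, Y, f; split=> //; first exact: Dfb_sum.
apply: d_iso_trans iY _; apply: d_iso_trans (sum_d_iso iX' (d_iso_refl T')) _.
have lin1 : linear (fun z : dgSum (dgSum X X') T' => (z.1.1, (z.1.2, z.2)) : dgSum X (dgSum X' T')).
  by [].
have lin2 : linear (fun z : dgSum X (dgSum X' T') => ((z.1, z.2.1), z.2.2) : dgSum (dgSum X X') T').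
  by [].
pose a := @DGHom _ _ _ _ lin1 (fun _ _ => erefl) (fun _ => erefl).
pose b := @DGHom _ _ _ _ lin2 (fun _ _ => erefl) (fun _ => erefl).
by apply: (bij_d_iso (f := a) (g := b)) => [[[]]|[? []]].
Qed.
End Retracts.

(** * Localisation and restriction of scalars *)

Lemma quasi_iso_bijective (A : dgRing) (X Y : dgMod A) (f : dgHom X Y) :
  (forall x, f x = 0 -> x = 0) -> (forall y, exists x, f x = y) -> quasi_iso f.
Proof.
move=> fi fs; apply/quasi_isoE; split=> [x y _ e|w dw].
  have [x' x'E] := fs y; exists x'; apply/eqP; rewrite -subr_eq0; apply/eqP/fi.
  by rewrite raddfB /= -dgh_d x'E e subrr.
have [x xE] := fs w; exists x, 0; rewrite xE subrr raddf0; split=> //.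
by apply: fi; rewrite -dgh_d xE.
Qed.

Section Localisation.
Variables (A : dgRing) (p : primeIdeal (H0 A)).
Notation P := (preim_prime p).
Notation L := (dgLocMod p).
Implicit Types X Y Z : dgMod A.

Definition lfrac X (x : X) (s : primeC P) : L X := frac (x : over0 X) s.

Lemma lfracP X (q : L X) : exists x s, q = lfrac x s.
Proof. by have [x [s e]] := fracP (q : locMod p X); exists x, s. Qed.
Lemma lfrac_eq0 X (x : X) s : lfrac x s = 0 <-> exists u : primeC P, x ∙ deg0_val (den u) = 0.
Proof.
rewrite -[0 : L X](frac_0 (over0 X) (primeC1 P)); split=> [/frac_eqP [u]|[u ux]].
  rewrite scaler0 mulr1 => ux; by exists u.
by apply/frac_eqP; exists u; rewrite scaler0 /= mulr1.
Qed.
Lemma lfrac_cancel X (x : X) s u :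
  lfrac (x ∙ deg0_val (den u)) (primeCM s u) = lfrac x s.
Proof. exact: (frac_cancel (x : over0 X)). Qed.
Lemma lfrac_d X (x : X) s : dm_d (lfrac x s) = lfrac (dm_d x) s.
Proof. exact: loc_dE. Qed.
Lemma lfrac_deg X i (x : X) s : dm_gr (L X) i (lfrac x s) = lfrac (dm_gr X i x) s.
Proof. exact: loc_prE. Qed.
Lemma lfracD X (x y : X) s : lfrac (x + y) s = lfrac x s + lfrac y s.
Proof. exact: fracD. Qed.
Lemma lfracB X (x y : X) s : lfrac (x - y) s = lfrac x s - lfrac y s.
Proof. exact: fracB. Qed.
Lemma lfrac0 X s : lfrac (0 : X) s = 0.
Proof. exact: frac_0. Qed.
Lemma lfrac_common X Y (q : L X) (r : L Y) : exists x y s, q = lfrac x s /\ r = lfrac y s.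
Proof.
have [x [s ->]] := lfracP q; have [y [t ->]] := lfracP r.
exists (x ∙ deg0_val (den t)), (y ∙ deg0_val (den s)), (primeCM s t).
by rewrite lfrac_cancel primeCMC lfrac_cancel.
Qed.
Lemma lfrac_sum X (I : finType) (F : I -> X) s :
  lfrac (\sum_k F k) s = \sum_k lfrac (F k) s.
Proof. exact: frac_sum. Qed.

Lemma lfrac_cycle X (x : X) s : dm_d (lfrac x s) = 0 ->
  exists x' s', lfrac x s = lfrac x' s' /\ dm_d x' = 0 /\
    forall i, homog (dm_gr X) i x -> homog (dm_gr X) i x'.
Proof.
rewrite lfrac_d => /lfrac_eq0 [u du].
exists (x ∙ deg0_val (den u)), (primeCM s u); rewrite lfrac_cancel; split=> //.
split; first by rewrite d_act0 //; exact: deg0P.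
by move=> i hx; exact: act0_homog.
Qed.

Section OnMaps.
Variables (n : int) (X Y : dgMod A) (f : gHom n X Y).
Definition over0_fun : over0 X -> over0 Y := f.
Lemma over0_linear : linear over0_fun.
Proof.
move=> a x y; rewrite /over0_fun raddfD; congr (_ + _); exact: (gh_ract f).
Qed.
HB.instance Definition _ :=
  GRing.isLinear.Build (deg0 A) (over0 X) (over0 Y) *:%R over0_fun over0_linear.
Definition loc_fun : L X -> L Y := loc_map (P := P) over0_fun.
Lemma loc_funE x s : loc_fun (lfrac x s) = lfrac (f x) s.
Proof. exact: loc_mapE. Qed.
Lemma loc_fun_linear : linear loc_fun.
Proof.
apply: ract_linear => [x y|q a]; first exact: (raddfB (loc_map (P := P) over0_fun)).
have [x [s ->]] := lfracP q; have [b [t ->]] := fracP (a : locRing p).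
have e Z (z : Z) : lfrac z s ∙ (frac b t : dgLoc p) = lfrac (z ∙ (b : A)) (primeCM s t).
  exact: loc_actE.
by rewrite e !loc_funE e gh_ract.
Qed.
Lemma loc_fun_deg i q : dm_gr (L Y) (i + n) (loc_fun q) = loc_fun (dm_gr (L X) i q).
Proof.
by have [x [s ->]] := lfracP q; rewrite lfrac_deg !loc_funE lfrac_deg gh_deg.
Qed.
Definition gLoc : gHom n (L X) (L Y) := GHom loc_fun_linear loc_fun_deg.
End OnMaps.

Section OnHoms.
Variables (X Y : dgMod A) (f : dgHom X Y).
Notation k := (gLoc (gOf f)).
Lemma lochom_deg i q : dm_gr (L Y) i (k q) = k (dm_gr (L X) i q).
Proof. by rewrite -[i in LHS]addr0 gh_deg. Qed.
Lemma lochom_d q : dm_d (k q) = k (dm_d q).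
Proof.
by have [x [s ->]] := lfracP q; rewrite lfrac_d ![k _]loc_funE lfrac_d /= dgh_d.
Qed.
Definition dgLocHom : dgHom (L X) (L Y) := DGHom (gh_linear k) lochom_deg lochom_d.
Lemma dgLocHomE x s : dgLocHom (lfrac x s) = lfrac (f x) s.
Proof. exact: loc_funE. Qed.
End OnHoms.

Lemma loc_quasi_iso X Y (f : dgHom X Y) : quasi_iso f -> quasi_iso (dgLocHom f).
Proof.
move=> /quasi_isoE [fi fs]; apply/quasi_isoE; split=> [q r dq|r dr].
  have [x0 [s0 qE]] := lfracP q; rewrite qE in dq *.
  have [x [s [-> [dx _]]]] := lfrac_cycle dq; have [y [t ->]] := lfracP r.
  rewrite dgLocHomE lfrac_d => /eqP; rewrite -subr_eq0.
  rewrite -(lfrac_cancel (dm_d y) t s) -(lfrac_cancel (f x) s t) (primeCMC s t).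
  rewrite -lfracB => /eqP.
  move=> /lfrac_eq0 [u]; rewrite ractBl !ractA => ue.
  pose v : primeC P := primeCM t u.
  have [||x' dx'] := fi (x ∙ deg0_val (den v)) (y ∙ deg0_val (den s * den u)).
  - by rewrite d_act0 ?dx ?ract0l //; exact: deg0P.
  - rewrite d_act0 ?dgh_ract; last exact: deg0P.
    by apply/eqP; rewrite -subr_eq0; apply/eqP; exact: ue.
  by exists (lfrac x' (primeCM s v)); rewrite lfrac_d dx' lfrac_cancel.
have [y0 [s0 rE]] := lfracP r; rewrite rE in dr *.
have [y [s [-> [dy _]]]] := lfrac_cycle dr.
have [x [z [dx dz]]] := fs y dy; exists (lfrac x s), (lfrac z s).
by rewrite dgLocHomE !lfrac_d dx dz lfracB lfrac0.
Qed.

Definition dgLocFunctor : dgFunctor A (dgLoc p).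
Proof.
exists L dgLocHom => [X Y f g fg q|X q|X Y Z g f q|]; last exact: loc_quasi_iso.
- by have [x [s ->]] := lfracP q; rewrite !dgLocHomE fg.
- by have [x [s ->]] := lfracP q; rewrite !dgLocHomE.
- by have [x [s ->]] := lfracP q; rewrite /= !loc_funE.
Defined.

Lemma loc_sum_iso X Y : d_iso (L (dgSum X Y)) (dgSum (L X) (L Y)).
Proof.
apply: (@quasi_iso_d_iso _ _ _ (dgPair (dgLocHom (dgFst X Y)) (dgLocHom (dgSnd X Y)))).
apply: quasi_iso_bijective => [q|[q r]].
  have [[x y] [s ->]] := lfracP q; rewrite /= !loc_funE /= => -[].
  move=> /lfrac_eq0 [u ux] /lfrac_eq0 [v vy]; apply/lfrac_eq0; exists (primeCM u v).
  congr (_, _) => /=; first by rewrite -[LHS]ractA ux ract0l.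
  rewrite -[LHS]/(y ∙ (deg0_val (den u) * deg0_val (den v))) comm_deg0; last exact: deg0P.
  by rewrite -ractA vy ract0l.
have [x [y [s [-> ->]]]] := lfrac_common q r.
by exists (lfrac ((x, y) : dgSum X Y) s); rewrite /= !loc_funE.
Qed.

Section Cone.
Variables (X Y : dgMod A) (f : dgHom X Y).
Lemma cone_top_linear : linear (fun x : X => (0, x) : dgCone f).
Proof. by move=> a x y; congr (_, _); rewrite /= scaler0 addr0. Qed.
Lemma cone_top_deg i x : dm_gr (dgCone f) (i + 1) (0, x) = (0, dm_gr X i x).
Proof. by rewrite cone_degE /= raddf0 addrK. Qed.
Definition gConeTop : gHom 1 X (dgCone f) := GHom cone_top_linear cone_top_deg.

Lemma loc_cone_top q : dm_d (gLoc gConeTop q) + gLoc gConeTop (dm_d q) =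
  dgLocHom (dgConeIn f) (dgLocHom f q).
Proof.
have [x [s ->]] := lfracP q; rewrite !dgLocHomE lfrac_d ![gLoc _ _]loc_funE lfrac_d.
rewrite -lfracD; congr lfrac; rewrite cone_dE /= raddf0 add0r.
by congr (_, _) => /=; rewrite ?addr0 ?addNr.
Qed.

Lemma loc_cone_iso : d_iso (L (dgCone f)) (dgCone (dgLocHom f)).
Proof.
apply: d_iso_sym; apply: (@quasi_iso_d_iso _ _ _ (coneRec loc_cone_top)).
have E y x s : coneRec loc_cone_top (lfrac y s, lfrac x s) = lfrac ((y, x) : dgCone f) s.
  rewrite /= !loc_funE -lfracD; congr lfrac.
  by congr (_, _); rewrite /= ?addr0 ?add0r.
apply: quasi_iso_bijective => [[r q]|z]; last first.
  by have [[y x] [s ->]] := lfracP z; exists (lfrac y s, lfrac (x : X) s); exact: E.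
have [y [x [s [-> ->]]]] := lfrac_common (r : L Y) (q : L X).
rewrite E => /lfrac_eq0 [u e]; congr (_, _).
  by apply/lfrac_eq0; exists u; exact: (congr1 fst e).
by apply/lfrac_eq0; exists u; exact: (congr1 snd e).
Qed.
End Cone.

Definition gUnshift n X : gHom (- n) (dgShift n X) X :=
  @GHom A (- n) (dgShift n X) X id (fun _ _ _ => erefl) (fun _ _ => erefl).

Lemma loc_shift_iso n X : d_iso (L (dgShift n X)) (dgShift n (L X)).
Proof.
pose k := gLoc (gUnshift n X).
have kE (x : X) s : k (lfrac (x : dgShift n X) s) = lfrac x s by exact: loc_funE.
have deg i q : dm_gr (dgShift n (L X)) i (k q) = k (dm_gr (L (dgShift n X)) i q).
  exact: (gh_deg k i q).
have dd q : @dm_d _ (dgShift n (L X)) (k q) = k (dm_d q).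
  have [x [s ->]] := lfracP q; rewrite lfrac_d !kE.
  rewrite -[LHS]/(ksign n (dm_d (lfrac (x : X) s))) lfrac_d.
  exact: (loc_ksign n (dm_d (x : X)) s).
apply: (@quasi_iso_d_iso _ _ _ (@DGHom _ _ (dgShift n (L X)) k (gh_linear k) deg dd)).
apply: quasi_iso_bijective => [q|q] /=.
  have [x [s ->]] := lfracP q => e; have {}e : k (lfrac x s) = 0 by exact: e.
  by rewrite kE in e; case/lfrac_eq0: e => u ux; apply/lfrac_eq0; exists u.
have [x [s ->]] := lfracP (q : L X); exists (lfrac (x : dgShift n X) s); exact: kE.
Qed.

Lemma loc_zero_iso : d_iso (L (dgZero A)) (dgZero (dgLoc p)).
Proof.
apply: (@quasi_iso_d_iso _ _ _ (dgZ _ _)); apply: quasi_iso_acyclic; last first.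
  exact: acyclic_zero.
move=> q _; exists 0; have [x [s ->]] := lfracP q.
by rewrite raddf0 [x]thinmx0; symmetry; exact: lfrac0.
Qed.

Lemma Dfb_loc X : Dfb X -> Dfb (L X).
Proof.
move=> /DfbP [[m hm] hf].
have cyc i (q : L X) : homog (dm_gr (L X)) i q -> dm_d q = 0 ->
    exists x s, [/\ q = lfrac x s, homog (dm_gr X) i x & dm_d x = 0].
  move=> /loc_homogP [x0 [s0 [hx0 qE]]] dq.
  have {}qE : q = lfrac x0 s0 := qE; rewrite qE in dq *.
  have [x [s [-> [dx hx]]]] := lfrac_cycle dq; exists x, s; split=> //; exact: hx.
apply/DfbP; split.
  exists m => i mi q hq dq; have [x [s [-> hx dx]]] := cyc i q hq dq.
  by have [y dy] := hm i mi x hx dx; exists (lfrac y s); rewrite lfrac_d dy.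
move=> i; have [n [g [gc gP]]] := hf i.
exists n, (fun k => lfrac (g k) (primeC1 P)); split.
  move=> k; have [hg dg] := gc k; rewrite lfrac_d dg lfrac0; split=> //.
  by rewrite /homog lfrac_deg hg.
move=> q hq dq; have [x [s [-> hx dx]]] := cyc i q hq dq.
have [c [y ->]] := gP x hx dx.
have h0 k : (frac (deg0_val (c k) : over0 (regMod A)) s : locRing p) \in @in_deg0 (dgLoc p).
  by apply/eqP; apply: (loc_homog (X := regMod A)); exact: deg0P.
exists (fun k => Deg0 (h0 k)), (lfrac y s).
rewrite lfracD lfrac_sum lfrac_d; congr (_ + _); apply: eq_bigr => k _.
by symmetry; rewrite [LHS]loc_actE primeC1M.
Qed.

Variable G : dgMod A -> Prop.
Hypothesis hG : forall Y, G Y -> Dfb Y.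

Lemma locFull_Dfb (Y : dgMod (dgLoc p)) : locFull p G Y -> Dfb Y.
Proof. by move=> [X /hG hX ->]; exact: Dfb_loc. Qed.

Lemma thick1_loc X : thick1 (@Dfb A) G X -> thick1 (@Dfb (dgLoc p)) (locFull p G) (L X).
Proof.
have D := thick1_Dfb locFull_Dfb.
elim=> {X} [X GX||X Y _ tX _ tY|X Y Z SX SY _ tZ ZXY|n X _ tX].
- by apply: thick1_gen; exists X.
- apply: (thick1_iso (X := dgZero _)); [exact: thick1_zero|exact: d_iso_sym loc_zero_iso|].
  exact: Dfb_loc (Dfb_zero A).
- apply: (thick1_iso (thick1_sum tX tY)); first exact: d_iso_sym (loc_sum_iso X Y).
  by apply: Dfb_iso (loc_sum_iso X Y) _; apply: Dfb_sum; exact: D.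
- apply: (thick1_summand (Dfb_loc SX) (Dfb_loc SY) tZ).
  exact: d_iso_trans (fMor_iso dgLocFunctor ZXY) (loc_sum_iso X Y).
- apply: (thick1_iso (thick1_shift n tX)); first exact: d_iso_sym (loc_shift_iso n X).
  by apply: Dfb_iso (loc_shift_iso n X) _; apply: Dfb_shift; exact: D.
Qed.

Lemma thick_loc n X : thick (@Dfb A) G n X -> thick (@Dfb (dgLoc p)) (locFull p G) n (L X).
Proof.
elim: n X => [|[|n] IH] X.
- move=> [SX X0]; split; first exact: Dfb_loc.
  exact: d_iso_trans (fMor_iso dgLocFunctor X0) loc_zero_iso.
- exact: thick1_loc.
move/(thickSP _ _ hG) => [SX [X' [X1 [Y [f [SX' t1 t2 iY]]]]]].
apply/(thickSP _ _ locFull_Dfb); split; first exact: Dfb_loc.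
exists (L X'), (L X1), (L Y), (dgLocHom f); split.
- exact: Dfb_loc.
- exact: thick1_loc.
- apply: (thick_iso (IH _ t2) (loc_cone_iso f)).
  apply: Dfb_iso (d_iso_sym (loc_cone_iso f)) _; apply: Dfb_loc.
  exact: thick_Dfb t2.
- exact: d_iso_trans (fMor_iso dgLocFunctor iY) (loc_sum_iso X X').
Qed.
End Localisation.

Section Restriction.
Variables (A : dgRing) (p : primeIdeal (H0 A)).
Notation P := (preim_prime p).
Notation B := (dgLoc p).
Notation L := (dgLocMod p).

Definition loc_inc (a : A) (s : primeC P) : B := frac (a : over0 (regMod A)) s.
Notation inc a := (loc_inc a (primeC1 P)).

Lemma loc_incM a b s t : loc_inc a s * loc_inc b t = loc_inc (a * b) (primeCM s t).
Proof. exact: loc_actE. Qed.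
Lemma incM a b : inc (a * b) = inc a * inc b.
Proof. by rewrite loc_incM primeC1M. Qed.
Lemma incD a b : inc (a + b) = inc a + inc b.
Proof. exact: fracD. Qed.
Lemma inc_homog i a s : homog (dg_gr A) i a -> homog (dg_gr B) i (loc_inc a s).
Proof. exact: (loc_homog (X := regMod A)). Qed.
Lemma inc_d a : dg_d (inc a) = inc (dg_d a).
Proof. exact: (@loc_dE A p (regMod A)). Qed.
Lemma lfrac_act (X : dgMod A) (x : X) s a t :
  lfrac x s ∙ loc_inc a t = lfrac (x ∙ a) (primeCM s t).
Proof. exact: loc_actE. Qed.

Definition resT (Z : dgMod B) : Type := Z.
HB.instance Definition _ Z := GRing.Zmodule.on (resT Z).

Section Module.
Variable Z : dgMod B.
Definition res_scale (a : (A : pzRingType)^c) (z : resT Z) : resT Z := (z : Z) ∙ inc a.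
Lemma res_scaleA a b z : res_scale a (res_scale b z) = res_scale (a * b) z.
Proof. by rewrite /res_scale ractA -incM. Qed.
Lemma res_scale1 : left_id 1 res_scale.
Proof. by move=> z; exact: (ract1 (z : Z)). Qed.
Lemma res_scaleDr : right_distributive res_scale +%R.
Proof. by move=> a x y; exact: (ractDl _ (x : Z) y). Qed.
Lemma res_scaleDl z : {morph res_scale^~ z : a b / a + b}.
Proof. by move=> a b; rewrite /res_scale incD ractDr. Qed.
HB.instance Definition _ := GRing.Zmodule_isLmodule.Build (A : pzRingType)^c (resT Z)
  res_scaleA res_scale1 res_scaleDr res_scaleDl.

Lemma res_act i j (x : resT Z) (a : A) :
  homog (dm_gr Z) i x -> homog (dg_gr A) j a -> homog (dm_gr Z) (i + j) (x ∙ a).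
Proof. by move=> hx ha; apply: (dm_act hx); exact: inc_homog. Qed.
Lemma res_leibniz i (x : resT Z) (a : A) : homog (dm_gr Z) i x ->
  @dm_d B Z (x ∙ a) = (dm_d (x : Z) : resT Z) ∙ a + ksign i (x ∙ dg_d a).
Proof. by move=> hx; rewrite [LHS](dm_leibniz _ hx) inc_d. Qed.
Definition dgRes : dgMod A := @DGMod A (resT Z) (dm_gr Z) (@dm_d B Z) res_act
  (@dm_d_additive B Z) (@dm_d_deg B Z) (@dm_dd B Z) res_leibniz.
End Module.

Lemma res_hom_linear (X Y : dgMod B) (f : dgHom X Y) : linear (f : dgRes X -> dgRes Y).
Proof.
by apply: ract_linear => [x y|x a]; [exact: (raddfB f)|exact: (dgh_ract f)].
Qed.
Definition dgResHom (X Y : dgMod B) (f : dgHom X Y) : dgHom (dgRes X) (dgRes Y) :=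
  @DGHom A (dgRes X) (dgRes Y) f (res_hom_linear f) (dgh_deg f) (dgh_d f).

Lemma res_quasi_iso X Y (f : dgHom X Y) : quasi_iso f -> quasi_iso (dgResHom f).
Proof. by move=> /quasi_isoE qf; apply/quasi_isoE. Qed.

Definition dgResFunctor : dgFunctor B A :=
  @DGFunctor B A dgRes dgResHom (fun _ _ _ _ e => e) (fun _ _ => erefl)
    (fun _ _ _ _ _ _ => erefl) res_quasi_iso.

Lemma res_bij_iso (X : dgMod A) (Y : dgMod A) (f : dgHom X Y) (g : Y -> X) :
  cancel f g -> cancel g f -> d_iso X Y.
Proof.
move=> fK gK; apply: (@quasi_iso_d_iso _ _ _ f); apply: quasi_iso_bijective.
  by move=> x e; rewrite -[LHS]fK e -(raddf0 f) fK.
by move=> y; exists (g y).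
Qed.

Lemma res_sum_iso (X Y : dgMod B) : d_iso (dgRes (dgSum X Y)) (dgSum (dgRes X) (dgRes Y)).
Proof.
have lin : linear (id : dgRes (dgSum X Y) -> dgSum (dgRes X) (dgRes Y)).
  by move=> a x y; congr (_, _).
exact: (@res_bij_iso _ _ (@DGHom A (dgRes (dgSum X Y)) (dgSum (dgRes X) (dgRes Y)) id lin
  (fun _ _ => erefl) (fun _ => erefl)) id).
Qed.

Lemma res_cone_iso (X Y : dgMod B) (f : dgHom X Y) :
  d_iso (dgRes (dgCone f)) (dgCone (dgResHom f)).
Proof.
have lin : linear (id : dgRes (dgCone f) -> dgCone (dgResHom f)).
  by move=> a x y; congr (_, _).
exact: (@res_bij_iso _ _ (@DGHom A (dgRes (dgCone f)) (dgCone (dgResHom f)) id lin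
  (fun _ _ => erefl) (fun _ => erefl)) id).
Qed.

Lemma res_shift_iso n (X : dgMod B) : d_iso (dgRes (dgShift n X)) (dgShift n (dgRes X)).
Proof.
have lin : linear (id : dgRes (dgShift n X) -> dgShift n (dgRes X)) by [].
exact: (@res_bij_iso _ _ (@DGHom A (dgRes (dgShift n X)) (dgShift n (dgRes X)) id lin
  (fun _ _ => erefl) (fun _ => erefl)) id).
Qed.

Section Unit.
Variable X : dgMod A.
Lemma iota_linear : linear (fun x : X => lfrac x (primeC1 P) : dgRes (L X)).
Proof.
apply: ract_linear => [x y|x a]; first exact: lfracB.
by rewrite -[RHS]/(lfrac x (primeC1 P) ∙ inc a) lfrac_act primeC1M.
Qed.
Lemma iota_deg i (x : X) :
  dm_gr (dgRes (L X)) i (lfrac x (primeC1 P)) = lfrac (dm_gr X i x) (primeC1 P).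
Proof. exact: lfrac_deg. Qed.
Lemma iota_d (x : X) :
  @dm_d A (dgRes (L X)) (lfrac x (primeC1 P)) = lfrac (dm_d x) (primeC1 P).
Proof. exact: lfrac_d. Qed.
Definition dgIota : dgHom X (dgRes (L X)) := DGHom iota_linear iota_deg iota_d.

Lemma inv_in_deg0 (s : primeC P) : loc_inc 1 s \in @in_deg0 B.
Proof. by apply/eqP; apply: inc_homog; exact: dg_one. Qed.
Definition dgDiv (s : primeC P) : dgHom (dgRes (L X)) (dgRes (L X)) :=
  dgResHom (dgSmul (L X) (Deg0 (inv_in_deg0 s))).
Lemma dgDivE s (x : X) t : dgDiv s (lfrac x t) = lfrac x (primeCM t s).
Proof. by rewrite [LHS]lfrac_act ract1. Qed.
Lemma res_smulE (a : deg0 A) (x : X) t :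
  dgSmul (dgRes (L X)) a (lfrac x t) = lfrac (x ∙ deg0_val a) t.
Proof. by rewrite [LHS]lfrac_act primeCM1. Qed.
Lemma dgDivK s q : dgDiv s (dgSmul _ (den s) q) = q.
Proof.
have [x [t ->]] := lfracP (q : L X); rewrite res_smulE dgDivE; exact: lfrac_cancel.
Qed.
End Unit.

End Restriction.

(** * Finite cellular modules *)

Section Cells.
Variable A : dgRing.
Implicit Types X Y Z F : dgMod A.

Lemma ractNr X (x : X) (a : A) : x ∙ (- a) = - (x ∙ a).
Proof. exact: scaleNr. Qed.

Lemma act_deg X k i (w : X) (a : A) : homog (dm_gr X) k w ->
  dm_gr X i (w ∙ a) = w ∙ dg_gr A (i - k) a.
Proof.
move=> hw; have [s [_ e]] := pr_decomp (dg_gr A) a.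
have ract_sumr (I : Type) (r : seq I) (E : I -> A) :
    w ∙ (\sum_(j <- r) E j) = \sum_(j <- r) w ∙ E j.
  by elim: r => [|j r IH]; rewrite ?big_nil ?ract0r // !big_cons ractDr IH.
rewrite e ract_sumr !raddf_sum /= ract_sumr; apply: eq_bigr => j _.
have h := dm_act hw (homog_pr (dg_gr A) j a).
rewrite -[in LHS]h !pr_pr h (addrC k) -subr_eq; case: eqP => // _.
by rewrite ract0r.
Qed.

Inductive cellular : dgMod A -> Prop :=
| cell_zero : cellular (dgZero A)
| cell_attach n F (f : dgHom (dgShift n (regMod A)) F) :
    cellular F -> cellular (dgCone f).

Section Elt.
Variables (n : int) (X : dgMod A) (z : X).
Hypotheses (hz : homog (dm_gr X) n z) (dz : dm_d z = 0).
Lemma elt_linear : linear (fun a : dgShift n (regMod A) => z ∙ (a : A)).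
Proof.
apply: ract_linear => [a b|a b]; first exact: ractBr.
by rewrite ractA.
Qed.
Lemma elt_deg i (a : dgShift n (regMod A)) :
  dm_gr X i (z ∙ (a : A)) = z ∙ (dm_gr (dgShift n (regMod A)) i a : A).
Proof. exact: act_deg. Qed.
Lemma elt_d (a : dgShift n (regMod A)) : dm_d (z ∙ (a : A)) = z ∙ (dm_d a : A).
Proof.
rewrite (dm_leibniz _ hz) dz ract0l add0r.
by rewrite -[dm_d a]/(ksign n (dg_d (a : A))) /ksign; case: ifP; rewrite ?ractNr //.
Qed.
Definition dgElt : dgHom (dgShift n (regMod A)) X := DGHom elt_linear elt_deg elt_d.
End Elt.

Section AttachRec.
Variables (n k : int) (F Z : dgMod A) (f : dgHom (dgShift n (regMod A)) F).
Variables (h : gHom k F Z) (w : Z).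
Hypothesis hw : homog (dm_gr Z) (n + 1 + k) w.
Notation m := (fun z : dgCone f => h z.1 + w ∙ (z.2 : A)).
Lemma attach_linear : linear m.
Proof.
apply: ract_linear => [[x a] [y b]|[x a] b] /=; first by rewrite raddfB ractBr; abel.
by rewrite (gh_ract h) ractDl ractA.
Qed.
Lemma attach_deg i z : dm_gr Z (i + k) (m z) = m (dm_gr (dgCone f) i z).
Proof.
case: z => x a; rewrite cone_degE raddfD /= gh_deg (act_deg _ _ hw).
congr (_ + _ ∙ _); rewrite -[RHS]/(dg_gr A (i - 1 - n) a); congr (dg_gr A _ a).
by lia.
Qed.
Definition gAttach : gHom k (dgCone f) Z := GHom attach_linear attach_deg.
End AttachRec.

Section Top.
Variables (n : int) (F : dgMod A) (f : dgHom (dgShift n (regMod A)) F).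
Definition cellTop : dgCone f := (0, (1 : A)).
Definition cellBd : F := f (1 : A).
Lemma cellTop_homog : homog (dm_gr (dgCone f)) (n + 1) cellTop.
Proof.
rewrite /homog cone_degE /= raddf0; congr (_, _).
rewrite -[LHS]/(dg_gr A (n + 1 - 1 - n) 1); have -> : n + 1 - 1 - n = 0 by lia.
exact: dg_one.
Qed.
Lemma cellTop_d : dm_d cellTop = (cellBd, 0).
Proof.
rewrite cone_dE /= raddf0 add0r; congr (_, _).
rewrite -[LHS]/(- ksign n (dg_d (1 : A))) d_deg0; last exact: dg_one.
by rewrite ksign0 oppr0.
Qed.
Lemma cellBd_d : dm_d cellBd = 0.
Proof.
rewrite dgh_d -[dm_d _]/(ksign n (dg_d (1 : A))) d_deg0; last exact: dg_one.
by rewrite ksign0; exact: (raddf0 f).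
Qed.
Lemma cellE (x : F) (a : A) : ((x, a) : dgCone f) = (x, 0) + cellTop ∙ a.
Proof.
congr (_, _); first by rewrite -[RHS]/(x + (0 : F) ∙ a) ract0l addr0.
by rewrite -[RHS]/(0 + (1 : A) * a) add0r mul1r.
Qed.
Lemma cellBdE (a : A) : f a = cellBd ∙ a.
Proof. by rewrite -(dgh_ract f); congr (f _); symmetry; exact: (mul1r a). Qed.
End Top.

Lemma cellular_null F Z (g : dgHom F Z) : cellular F -> acyclic Z ->
  exists h : gHom 1 F Z, forall x, dm_d (h x) + h (dm_d x) = g x.
Proof.
move=> cF; elim: cF Z g => {F} [|n F f _ IH] Z g aZ.
  by exists (gZero _ _ 1) => x; rewrite [x]thinmx0 !raddf0 addr0.
have [h hE] := IH Z (dgComp g (dgConeIn f)) aZ.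
have dtop : dm_d (g (cellTop f)) = g (cellBd f, 0) by rewrite dgh_d cellTop_d.
have [|w0 dw0] := aZ (g (cellTop f) - h (cellBd f)).
  rewrite raddfB /= dtop; have := hE (cellBd f); rewrite cellBd_d raddf0 addr0 => ->.
  by rewrite subrr.
pose w := dm_gr Z (n + 1 + 1) w0.
have hw : homog (dm_gr Z) (n + 1 + 1) w by exact: homog_pr.
have hB : homog (dm_gr F) n (cellBd f).
  apply: (dgh_homog f); rewrite /homog -[LHS]/(dg_gr A (n - n) 1) subrr.
  exact: dg_one.
have dw : dm_d w = g (cellTop f) - h (cellBd f).
  rewrite /w pr_d addrK dw0 raddfB /=; congr (_ - _).
    exact: (dgh_homog g (cellTop_homog f)).
  exact: (gh_homog h hB).
exists (gAttach f h hw) => -[x a]; rewrite cone_dE /= cellE.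
have -> : (- @dm_d A (dgShift n (regMod A)) a : A) = - ksign n (dg_d (a : A)) by [].
rewrite !raddfD /= (dm_leibniz _ hw) dw ractNr (cellBdE f a) gh_ract dgh_ract ractBl.
rewrite -[g (x, 0)](hE x).
have -> : w ∙ ksign n (dg_d (a : A)) = ksign (n + 1 + 1) (w ∙ dg_d (a : A)).
  rewrite /ksign; have -> : odd `|(n + 1 + 1)%R|%N = odd `|n|%N by lia.
  by case: ifP => // _; rewrite ractNr.
abel.
Qed.
End Cells.

Section CellLocal.
Variables (A : dgRing) (p : primeIdeal (H0 A)).
Implicit Types X Y Z F : dgMod A.
Notation P := (preim_prime p).
Notation RL := (fun X => dgRes (dgLocMod p X)).

Lemma deg0C (a b : deg0 A) : deg0_val a * deg0_val b = deg0_val b * deg0_val a.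
Proof. exact/comm_deg0/deg0P. Qed.

Lemma iota_ract Y (y : Y) (a : A) : dgIota p Y (y ∙ a) = dgIota p Y y ∙ a.
Proof. exact: (dgh_ract (dgIota p Y)). Qed.

Lemma iotaD Y (x y : Y) : dgIota p Y (x + y) = dgIota p Y x + dgIota p Y y.
Proof. exact: lfracD. Qed.
Lemma res_lfrac Y (y : Y) t (a : A) : (lfrac y t : RL Y) ∙ a = lfrac (y ∙ a) t.
Proof. by rewrite [LHS]lfrac_act primeCM1. Qed.

Lemma iota_eq0 Y (y : Y) : dgIota p Y y = 0 -> exists s : primeC P, y ∙ deg0_val (den s) = 0.
Proof. by move=> /lfrac_eq0. Qed.

Lemma cellular_lift F Y k (g : gHom k F (RL Y)) : cellular F ->
  exists (s : primeC P) (h : gHom k F Y),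
    forall x, dgIota p Y (h x) = g x ∙ deg0_val (den s).
Proof.
move=> cF; elim: cF Y g => {F} [|n F f _ IH] Y g.
  exists (primeC1 P), (gZero _ _ k) => x.
  by rewrite [x]thinmx0 !raddf0 ract0l.
have [s1 [h1 hE1]] := IH Y (gPre g (dgConeIn f)).
have [y [t [hy yE]]] : exists (y : Y) t, homog (dm_gr Y) (n + 1 + k) y /\
    g (cellTop f) = lfrac y t :> dgLocMod p Y.
  have /loc_homogP [y [t [hy e]]] := gh_homog g (cellTop_homog f).
  by exists y, t.
pose h := gPost (dgSmul Y (den t)) h1.
have hw : homog (dm_gr Y) (n + 1 + k) (y ∙ deg0_val (den s1)) by exact: act0_homog.
exists (primeCM s1 t), (gAttach f h hw) => -[x a].
have -> : gAttach f h hw (x, a) = h1 x ∙ deg0_val (den t) + y ∙ deg0_val (den s1) ∙ (a : A).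
  by [].
rewrite iotaD !iota_ract hE1 cellE raddfD /= gh_ract ractDl !ractA.
congr (_ + _); rewrite -(comm_deg0 (a : A) (deg0P (den s1 * den t))).
rewrite -!ractA; congr (_ ∙ _).
rewrite yE !res_lfrac ractA.
by rewrite -(lfrac_cancel (y ∙ deg0_val (den s1)) (primeC1 P) t) primeC1M ractA.
Qed.

Lemma cellular_zero F Y k (g : gHom k F Y) : cellular F ->
  (forall x, dgIota p Y (g x) = 0) ->
  exists s : primeC P, forall x, g x ∙ deg0_val (den s) = 0.
Proof.
move=> cF; elim: cF Y g => {F} [|n F f _ IH] Y g g0.
  by exists (primeC1 P) => x; rewrite [x]thinmx0 raddf0 ract0l.
have [|s sE] := IH Y (gPre g (dgConeIn f)); first by move=> x; exact: g0.
have [t tE] := iota_eq0 (g0 (cellTop f)).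
exists (primeCM s t) => -[x a]; rewrite cellE raddfD /= gh_ract ractDl.
have e : deg0_val (den (primeCM s t)) = deg0_val (den s) * deg0_val (den t) by [].
rewrite -[g (x, 0) ∙ _]ractA [g (x, 0) ∙ _]sE ract0l add0r.
have at0 : (a : A) * (deg0_val (den s) * deg0_val (den t)) =
    deg0_val (den t) * (deg0_val (den s) * (a : A)).
  by rewrite -e -(comm_deg0 _ (deg0P (den (primeCM s t)))) e deg0C mulrA.
by rewrite ractA at0 -ractA tE ract0l.
Qed.

End CellLocal.

Section Approximation.
Variable A : dgRing.
Implicit Types X Y Z F : dgMod A.

Lemma Dfb_regMod : homology_fin_gen (regMod A) -> Dfb (regMod A).
Proof.
move=> [s [g [gs gP]]]; split.
  exists (\max_(i <- s) `|i|%N) => i si h; have [c ->] := gP i h.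
  have -> : g i = [::]; last by rewrite big_ord0.
  apply: gs; apply/negP => is_s.
  by have := @leq_bigmax_seq _ s xpredT (fun i : int => `|i|%N) i is_s isT; rewrite leqNgt si.
move=> i; exists (size (g i)), (fun k => (g i)`_k) => h; have [c ->] := gP i h.
by exists (fun k => c k).
Qed.

Section EltTop.
Variables (n : int) (X : dgMod A) (x : X).
Hypothesis hx : homog (dm_gr X) (n + 1) x.
Lemma elt_top_linear : linear (fun a : dgShift n (regMod A) => x ∙ (a : A)).
Proof.
apply: ract_linear => [a b|a b]; first exact: ractBr.
by rewrite ractA.
Qed.
Lemma elt_top_deg i (a : dgShift n (regMod A)) :
  dm_gr X (i + 1) (x ∙ (a : A)) = x ∙ (dm_gr (dgShift n (regMod A)) i a : A).
Proof.
rewrite (act_deg _ _ hx) -[dm_gr _ i a]/(dg_gr A (i - n) a); congr (_ ∙ dg_gr A _ a).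
by lia.
Qed.
Definition gElt : gHom 1 (dgShift n (regMod A)) X := GHom elt_top_linear elt_top_deg.
End EltTop.

Lemma attach_cell n F X (phi : dgHom F X) (z : F) (x : X) : cellular F ->
  homog (dm_gr F) n z -> dm_d z = 0 -> homog (dm_gr X) (n + 1) x -> dm_d x = phi z ->
  exists F' (phi' : dgHom F' X) (i : dgHom F F'),
  [/\ cellular F', forall y, phi' (i y) = phi y, forall y, i y = 0 -> y = 0,
    forall k w, k < n + 1 -> homog (dm_gr F') k w ->
      exists y, homog (dm_gr F) k y /\ w = i y
    & exists e, dm_d e = i z /\ phi' e = x].
Proof.
move=> cF hz dz hx dx; pose f := dgElt hz dz.
have H a : dm_d (gElt hx a) + gElt hx (dm_d a) = phi (f a).
  rewrite /= (dm_leibniz _ hx) dx (dgh_ract phi).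
  rewrite -[@dm_d _ (dgShift n _) a]/(ksign n (dg_d (a : A))).
  have -> : x ∙ ksign n (dg_d (a : A)) = - ksign (n + 1) (x ∙ dg_d (a : A)).
    rewrite /ksign; have -> : odd `|(n + 1)%R|%N = ~~ odd `|n|%N by lia.
    by case: (odd _); rewrite /= ?opprK ?ractNr.
  by rewrite addrK.
exists (dgCone f), (coneRec H), (dgConeIn f); split.
- exact: cell_attach.
- by move=> y; rewrite /= ract0r addr0.
- by move=> y [].
- move=> k [y a] kn hw; exists y; split; first exact: (congr1 fst hw).
  congr (_, _); have <- : dg_gr A (k - 1 - n) a = a by exact: (congr1 snd hw).
  by apply: dg_nonneg; lia.
- exists (cellTop f); rewrite cellTop_d /=; split.
    by congr (_, _); rewrite /cellBd /= ract1.
  by rewrite raddf0 add0r ract1.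
Qed.

Lemma attach_cells n m F X (phi : dgHom F X) (z : 'I_m -> F) (x : 'I_m -> X) :
  cellular F ->
  (forall j, [/\ homog (dm_gr F) n (z j), dm_d (z j) = 0,
    homog (dm_gr X) (n + 1) (x j) & dm_d (x j) = phi (z j)]) ->
  exists F' (phi' : dgHom F' X) (i : dgHom F F'),
  [/\ cellular F', forall y, phi' (i y) = phi y, forall y, i y = 0 -> y = 0,
    forall k w, k < n + 1 -> homog (dm_gr F') k w ->
      exists y, homog (dm_gr F) k y /\ w = i y
    & forall j, exists e, dm_d e = i (z j) /\ phi' e = x j].
Proof.
move=> cF; elim: m z x => [|m IH] z x zx.
  exists F, phi, (dgId F); split=> // [k w _ hw|[]//]; by exists w.
pose w j := widen_ord (leqnSn m) j.
have [F1 [phi1 [i1 [cF1 p1 inj1 s1 e1]]]] := IH (z \o w) (x \o w) (fun j => zx (w j)).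
have [hz dz hx dx] := zx ord_max.
have [|||F2 [phi2 [i2 [cF2 p2 inj2 s2 e2]]]] :=
  attach_cell (phi := phi1) (z := i1 (z ord_max)) (x := x ord_max) cF1 _ _ hx _.
- exact: dgh_homog.
- by rewrite dgh_d dz raddf0.
- by rewrite p1.
exists F2, phi2, (dgComp i2 i1); split=> //=.
- by move=> y; rewrite p2 p1.
- by move=> y /inj2 /inj1.
- move=> k v kn hv; have [y [hy ->]] := s2 k v kn hv.
  by have [u [hu ->]] := s1 k y kn hy; exists u.
- move=> j; have [jm|mj] := ltnP j m.
    have [e [de pe]] := e1 (Ordinal jm).
    have wj : w (Ordinal jm) = j by exact: val_inj.
    by rewrite /= wj in de pe; exists (i2 e); rewrite dgh_d de p2 pe.
  have -> : j = ord_max by apply: val_inj => /=; have := ltn_ord j; lia.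
  exact: e2.
Qed.

Hypothesis H0_noeth : noetherian (H0 A).

Lemma homology_kernel k F X (phi : dgHom F X) : hfg F k ->
  exists m (z : 'I_m -> F) (x : 'I_m -> X),
  (forall j, [/\ homog (dm_gr F) k (z j), dm_d (z j) = 0,
    homog (dm_gr X) (k + 1) (x j) & dm_d (x j) = phi (z j)]) /\
  forall y v, homog (dm_gr F) k y -> dm_d y = 0 -> dm_d v = phi y ->
    exists (c : 'I_m -> deg0 A) u, y = \sum_j z j ∙ deg0_val (c j) + dm_d u.
Proof.
move=> /hfgP [l [g gP]]; pose N (h : homology F k) := hmap phi h = 0.
have [|h _|m [q [Nq qN]]] := submod_fin_gen H0_noeth (g := g) (N := N).
- split; rewrite /N; first exact: raddf0.
    by move=> h h' e e'; rewrite raddfD /= e e' addr0.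
  by move=> r h e; rewrite linearZ /= e scaler0.
- exact: gP.
have /choice [z zE] : forall j, exists z, q j = hclass z by move=> j; exact: hclassP.
have /choice [x xE] : forall j, exists x, homog (dm_gr X) (k + 1) x /\
    dm_d x = phi (cycle_val (z j)).
  move=> j; have := Nq j; rewrite /N zE hmapE => /hclass_eq0 [x /= dx].
  exists (dm_gr X (k + 1) x); split; first exact: homog_pr.
  by rewrite pr_d addrK dx; apply: dgh_homog; exact: cycle_homog.
exists m, (fun j => cycle_val (z j)), x; split.
  move=> j; have [hx dx] := xE j; split=> //; [exact: cycle_homog|exact: cycle_d].
move=> y v hy dy dv; have [|c cE] := qN (hclass (Cycle (mk_cycle hy dy))).
  by rewrite /N hmapE; apply/hclass_eq0; exists v.
have /choice [b bE] : forall j, exists b, c j = toH0 b by move=> j; exact: toH0_surj.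
move: cE; under eq_bigr => j _ do rewrite zE bE toH0_scale.
rewrite -raddf_sum /= => /hclass_eqE [u]; rewrite cycle_val_sum /= => du.
by exists b, u; rewrite du addrC subrK.
Qed.

Hypothesis H_fg : homology_fin_gen (regMod A).

Lemma cellular_Dfb F : cellular F -> Dfb F.
Proof.
elim=> {F} [|n F f _ IH]; first exact: Dfb_zero.
by apply: Dfb_cone => //; apply: Dfb_shift; exact: Dfb_regMod.
Qed.

Lemma cellular_approx X (N : int) : Dfb X ->
  exists F (phi : dgHom F X), cellular F /\
    forall i : int, i <= N -> hinj phi i /\ hsurj phi i.
Proof.
move=> /DfbP [[n hn] hf].
suff S (m : nat) : exists F (phi : dgHom F X), cellular F /\
    forall i : int, i < - n%:Z + m%:Z -> hinj phi i /\ hsurj phi i.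
  have [F [phi [cF hphi]]] := S `|(N + n%:Z + 1)%R|%N.
  by exists F, phi; split=> // i iN; apply: hphi; lia.
elim: m => [|m [F [phi [cF hphi]]]].
  exists (dgZero A), (dgZ _ _); split; first exact: cell_zero.
  move=> i ni; split.
    by move=> x y _ _ _; exists 0; rewrite raddf0 [x]thinmx0.
  move=> w hw dw; have [|y dy] := hn i _ w hw dw; first by lia.
  by exists 0, (- y); rewrite !raddf0 raddfN /= dy sub0r.
set k : int := - n%:Z + m%:Z in hphi.
have kE : - n%:Z + m.+1%:Z = k + 1 by rewrite /k; lia.
rewrite kE; have [q [g [gc gP]]] := hf k.
have [|F1 [phi1 [i1 [cF1 p1 inj1 s1 e1]]]] :=
    @attach_cells (k - 1) q F X phi (fun=> 0) g cF.
  move=> j; have [hg dg] := gc j; rewrite subrK dg !raddf0; split=> //.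
  exact: homog0.
rewrite subrK in s1.
have hp1 i : i <= k -> hsurj phi1 i.
  rewrite le_eqVlt => /orP [/eqP ->|ik] w hw dw.
    have [c [y ->]] := gP w hw dw.
    have /choice [e eE] := e1.
    exists (\sum_j e j ∙ deg0_val (c j)), (- y); split.
      rewrite raddf_sum big1 // => j _ /=; have [de _] := eE j.
      by rewrite d_act0 ?de ?raddf0 ?ract0l //; exact: deg0P.
    rewrite raddfN raddf_sum /=.
    have -> : \sum_j phi1 (e j ∙ deg0_val (c j)) = \sum_j g j ∙ deg0_val (c j).
      by apply: eq_bigr => j _; rewrite dgh_ract; have [_ ->] := eE j.
    abel.
  have [x [y [dx dy]]] := (hphi i ik).2 w hw dw.
  by exists (i1 x), y; rewrite dgh_d dx raddf0 p1.
have hq1 i : i < k -> hinj phi1 i.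
  move=> ik x y hx dx dy; have [x0 [hx0 xE]] := s1 i x ik hx.
  rewrite xE in dx dy *; have dx0 : dm_d x0 = 0 by apply: inj1; rewrite -dgh_d.
  have [|x' dx'] := (hphi i ik).1 x0 y hx0 dx0; first by rewrite dy p1.
  by exists (i1 x'); rewrite dgh_d dx'.
have /DfbP [_ /(_ k) fF1] := cellular_Dfb cF1.
have [l [z [x [zx ker]]]] := homology_kernel phi1 fF1.
have [F2 [phi2 [i2 [cF2 p2 inj2 s2 e2]]]] := attach_cells cF1 zx.
exists F2, phi2; split=> // i ik; split; last first.
  move=> w hw dw; have [|u [y [du dy]]] := hp1 i _ w hw dw; first by lia.
  by exists (i2 u), y; rewrite dgh_d du raddf0 p2.
move=> u y hu du dy; have [u0 [hu0 uE]] := s2 i u ik hu.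
rewrite uE in du dy *; have du0 : dm_d u0 = 0 by apply: inj2; rewrite -dgh_d.
rewrite p2 in dy; have [ik'|ki] := ltP i k.
  by have [v dv] := hq1 i ik' u0 y hu0 du0 dy; exists (i2 v); rewrite dgh_d dv.
have {}ki : i = k by lia.
rewrite ki in hu0; have [c [v ->]] := ker u0 y hu0 du0 dy.
have /choice [e eE] := e2.
exists (\sum_j e j ∙ deg0_val (c j) + i2 v).
rewrite [LHS]raddfD [RHS]raddfD /= dgh_d !raddf_sum; congr (_ + _).
apply: eq_bigr => j _ /=; have [de _] := eE j.
by rewrite d_act0 ?de ?dgh_ract //; exact: deg0P.
Qed.
End Approximation.

(** * Truncation *)

Section Truncation.
Variables (A : dgRing) (N : int).
Implicit Types X Y Z : dgMod A.

Section Quot.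
Variable X : dgMod A.

(* The DG submodule with components X_i for i > N and dX_(N+1) for i = N; it is
   closed under the action of A because A is non-negative. *)
Definition above : {pred X} := fun x =>
  `[< (forall i, i < N -> dm_gr X i x = 0) /\ exists y, dm_d y = dm_gr X N x >].

Lemma above_zmod_closed : zmod_closed above.
Proof.
split.
  by apply/asboolP; split=> [i _|]; [exact: raddf0|exists 0; rewrite !raddf0].
move=> x y /asboolP [x0 [u du]] /asboolP [y0 [v dv]]; apply/asboolP; split=> [i iN|].
  by rewrite raddfB /= x0 // y0 // subr0.
by exists (u - v); rewrite !raddfB /= du dv.
Qed.
HB.instance Definition _ := GRing.isZmodClosed.Build X above above_zmod_closed.

Lemma above_act x (a : A) : x \in above -> x ∙ a \in above.
Proof.
move=> /asboolP [x0 [y dy]]; apply/asboolP.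
have [s [_ e]] := pr_decomp (dm_gr X) x.
have E i : dm_gr X i (x ∙ a) = \sum_(j <- s) dm_gr X j x ∙ dg_gr A (i - j) a.
  rewrite [in LHS]e ract_sum raddf_sum; apply: eq_bigr => j _.
  exact: (act_deg _ _ (homog_pr _ _ _)).
split=> [i iN|].
  rewrite E big1 // => j _; have [jN|Nj] := ltP j N; first by rewrite x0 // ract0l.
  by rewrite dg_nonneg ?ract0r //; lia.
have /choice [u uE] : forall j, exists u, dm_d u = dm_gr X j x ∙ dg_gr A (N - j) a.
  move=> j; have [jN|Nj|->] := ltgtP j N.
  - by exists 0; rewrite raddf0 x0 // ract0l.
  - by exists 0; rewrite raddf0 dg_nonneg ?ract0r //; lia.
  - exists (y ∙ dg_gr A 0 a); rewrite subrr d_act0 ?dy //; exact: homog_pr.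
exists (\sum_(j <- s) u j); rewrite raddf_sum E; apply: eq_bigr => j _; exact: uE.
Qed.

Lemma above_d x : x \in above -> dm_d x \in above.
Proof.
move=> /asboolP [x0 [y dy]]; apply/asboolP; split=> [i iN|].
  rewrite dm_d_deg; have [iN'|Ni] := ltP (i + 1) N; first by rewrite x0 // raddf0.
  have -> : i + 1 = N by lia.
  by rewrite -dy dm_dd.
by exists (dm_gr X (N + 1) x); rewrite pr_d addrK.
Qed.

Lemma above_gr i x : x \in above -> dm_gr X i x \in above.
Proof.
move=> /asboolP [x0 [y dy]]; apply/asboolP; split=> [j jN|].
  by rewrite pr_pr; case: eqP => [<-|_] //; rewrite x0.
by rewrite pr_pr; case: eqP => [<-|_]; [exists y|exists 0; rewrite raddf0].
Qed.

Definition trunc := Quotient.quot above.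
HB.instance Definition _ := GRing.Zmodule.on trunc.
Definition tr_class (x : X) : trunc := \pi_(Quotient.quot above) x.

Lemma tr_classB : zmod_morphism tr_class.
Proof. by move=> x y; rewrite /tr_class raddfB. Qed.
HB.instance Definition _ := GRing.isZmodMorphism.Build X trunc tr_class tr_classB.

Lemma tr_classP (q : trunc) : exists x, q = tr_class x.
Proof. by exists (repr q); rewrite /tr_class reprK. Qed.
Lemma tr_class_eq x y : tr_class x = tr_class y <-> x - y \in above.
Proof. by split=> [/eqP|h]; [|apply/eqP]; rewrite -Quotient.idealrBE. Qed.
Lemma tr_class_eq0 x : tr_class x = 0 <-> x \in above.
Proof. by rewrite -(raddf0 tr_class) tr_class_eq subr0. Qed.

Definition tr_lift (f : X -> X) (q : trunc) : trunc := tr_class (f (repr q)).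
Lemma tr_liftE (f : X -> X) x : zmod_morphism f ->
  (forall z, z \in above -> f z \in above) -> tr_lift f (tr_class x) = tr_class (f x).
Proof.
move=> fB fa; apply/tr_class_eq; rewrite -fB; apply: fa; apply/tr_class_eq.
by rewrite /tr_class reprK.
Qed.

Definition tr_scale (a : (A : pzRingType)^c) : trunc -> trunc :=
  tr_lift (fun x : X => x ∙ (a : A)).
Lemma tr_scaleE a x : tr_scale a (tr_class x) = tr_class (x ∙ (a : A)).
Proof.
apply: tr_liftE => [u v|z]; [exact: ractBl|exact: above_act].
Qed.
Lemma tr_scaleA a b q : tr_scale a (tr_scale b q) = tr_scale (a * b) q.
Proof. by have [x ->] := tr_classP q; rewrite !tr_scaleE ractA. Qed.
Lemma tr_scale1 : left_id 1 tr_scale.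
Proof.
move=> q; have [x ->] := tr_classP q.
by rewrite tr_scaleE; congr tr_class; exact: ract1.
Qed.
Lemma tr_scaleDr : right_distributive tr_scale +%R.
Proof.
move=> a q r; have [x ->] := tr_classP q; have [y ->] := tr_classP r.
by rewrite -raddfD !tr_scaleE -raddfD; congr tr_class; exact: ractDl.
Qed.
Lemma tr_scaleDl q : {morph tr_scale^~ q : a b / a + b}.
Proof.
move=> a b; have [x ->] := tr_classP q.
by rewrite !tr_scaleE -raddfD; congr tr_class; exact: ractDr.
Qed.
HB.instance Definition _ := GRing.Zmodule_isLmodule.Build (A : pzRingType)^c trunc
  tr_scaleA tr_scale1 tr_scaleDr tr_scaleDl.
Lemma tr_ract x (a : A) : tr_class x ∙ a = tr_class (x ∙ a).
Proof. exact: tr_scaleE. Qed.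

Definition tr_pr i : trunc -> trunc := tr_lift (dm_gr X i).
Lemma tr_prE i x : tr_pr i (tr_class x) = tr_class (dm_gr X i x).
Proof. by apply: tr_liftE => [u v|z]; [exact: raddfB|exact: above_gr]. Qed.
Definition tr_d : trunc -> trunc := tr_lift (@dm_d A X).
Lemma tr_dE x : tr_d (tr_class x) = tr_class (dm_d x).
Proof. by apply: tr_liftE => [u v|z]; [exact: raddfB|exact: above_d]. Qed.

Lemma tr_pr_additive i : zmod_morphism (tr_pr i).
Proof.
move=> q r; have [x ->] := tr_classP q; have [y ->] := tr_classP r.
by rewrite -raddfB !tr_prE -raddfB; congr tr_class; exact: raddfB.
Qed.
Lemma tr_d_additive : zmod_morphism tr_d.
Proof.
move=> q r; have [x ->] := tr_classP q; have [y ->] := tr_classP r.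
by rewrite -raddfB !tr_dE -raddfB; congr tr_class; exact: raddfB.
Qed.
Lemma tr_pr_pr i j q : tr_pr i (tr_pr j q) = if i == j then tr_pr j q else 0.
Proof.
have [x ->] := tr_classP q; rewrite !tr_prE pr_pr.
by case: ifP => // _; exact: raddf0.
Qed.
Lemma tr_pr_decomp q : exists s : seq int, uniq s /\ q = \sum_(i <- s) tr_pr i q.
Proof.
have [x ->] := tr_classP q; have [s [us e]] := pr_decomp (dm_gr X) x.
exists s; split=> //; rewrite {1}e raddf_sum; apply: eq_bigr => i _.
by rewrite tr_prE.
Qed.
Definition tr_gr : grading trunc := Grading tr_pr_additive tr_pr_pr tr_pr_decomp.

Lemma tr_homogP i q : homog tr_gr i q -> exists x, homog (dm_gr X) i x /\ q = tr_class x.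
Proof.
have [x ->] := tr_classP q => e; exists (dm_gr X i x); split; first exact: homog_pr.
by rewrite -tr_prE; symmetry; exact: e.
Qed.
Lemma tr_act i j q (a : A) : homog tr_gr i q -> homog (dg_gr A) j a ->
  homog tr_gr (i + j) (q ∙ a).
Proof.
move=> /tr_homogP [x [hx ->]] ha; rewrite tr_ract /homog [LHS]tr_prE.
by rewrite (dm_act hx ha).
Qed.
Lemma tr_d_deg i q : tr_gr i (tr_d q) = tr_d (tr_gr (i + 1) q).
Proof.
have [x ->] := tr_classP q.
have -> : tr_gr (i + 1) (tr_class x) = tr_class (dm_gr X (i + 1) x) by exact: tr_prE.
by rewrite !tr_dE [LHS]tr_prE dm_d_deg.
Qed.
Lemma tr_dd q : tr_d (tr_d q) = 0.
Proof. by have [x ->] := tr_classP q; rewrite !tr_dE dm_dd raddf0. Qed.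
Lemma tr_ksign i x : ksign i (tr_class x) = tr_class (ksign i x).
Proof. by rewrite (ksign_add tr_classB). Qed.
Lemma tr_leibniz i q (a : A) : homog tr_gr i q ->
  tr_d (q ∙ a) = tr_d q ∙ a + ksign i (q ∙ dg_d a).
Proof.
move=> /tr_homogP [x [hx ->]]; rewrite (tr_ract x a) (tr_dE x) tr_dE.
rewrite (tr_ract (dm_d x) a) (tr_ract x (dg_d a)) tr_ksign -raddfD /=.
by rewrite (dm_leibniz _ hx).
Qed.
Definition dgTrunc : dgMod A := @DGMod A trunc tr_gr tr_d tr_act tr_d_additive
  tr_d_deg tr_dd tr_leibniz.

Lemma trunc_ract x (a : A) : (tr_class x : dgTrunc) ∙ a = tr_class (x ∙ a).
Proof. exact: tr_ract. Qed.
Lemma tr_class_linear : linear (tr_class : X -> dgTrunc).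
Proof. by apply: ract_linear => [x y|x a]; [exact: tr_classB|rewrite trunc_ract]. Qed.
Lemma tr_class_deg i x : dm_gr dgTrunc i (tr_class x) = tr_class (dm_gr X i x).
Proof. exact: tr_prE. Qed.
Lemma tr_class_d x : @dm_d A dgTrunc (tr_class x) = tr_class (dm_d x).
Proof. exact: tr_dE. Qed.
Definition dgTrIn : dgHom X dgTrunc := DGHom tr_class_linear tr_class_deg tr_class_d.
End Quot.
Arguments tr_class {X} x.
Arguments above : clear implicits.

Lemma above_hom X Y (f : dgHom X Y) x : x \in above X -> f x \in above Y.
Proof.
move=> /asboolP [x0 [y dy]]; apply/asboolP; split=> [i iN|].
  by rewrite dgh_deg x0 // raddf0.
by exists (f y); rewrite dgh_d dgh_deg dy.
Qed.

Section OnHoms.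
Variables (X Y : dgMod A) (f : dgHom X Y).
Definition tr_fun (q : dgTrunc X) : dgTrunc Y := tr_class (f (repr (q : trunc X))).
Lemma tr_funE x : tr_fun (tr_class x) = tr_class (f x).
Proof.
apply/tr_class_eq; rewrite -raddfB; apply: above_hom; apply/tr_class_eq.
by rewrite /tr_class reprK.
Qed.
Lemma tr_fun_linear : linear tr_fun.
Proof.
apply: ract_linear => [q r|q a].
  have [x ->] := tr_classP q; have [y ->] := tr_classP r.
  by rewrite -[X in tr_fun X](tr_classB x y) !tr_funE raddfB; exact: tr_classB.
by have [x ->] := tr_classP q; rewrite trunc_ract !tr_funE trunc_ract dgh_ract.
Qed.
Lemma tr_fun_deg i q : dm_gr (dgTrunc Y) i (tr_fun q) = tr_fun (dm_gr (dgTrunc X) i q).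
Proof.
by have [x ->] := tr_classP q; rewrite tr_funE !tr_class_deg tr_funE dgh_deg.
Qed.
Lemma tr_fun_d q : dm_d (tr_fun q) = tr_fun (dm_d q).
Proof.
by have [x ->] := tr_classP q; rewrite tr_funE !tr_class_d tr_funE dgh_d.
Qed.
Definition dgTrHom : dgHom (dgTrunc X) (dgTrunc Y) := DGHom tr_fun_linear tr_fun_deg tr_fun_d.
End OnHoms.

Lemma trunc_cycle X (x : X) : @dm_d A (dgTrunc X) (tr_class x) = 0 ->
  forall i, i <= N -> dm_d (dm_gr X i x) = 0.
Proof.
rewrite tr_class_d => /tr_class_eq0 /asboolP [h _] i iN.
by rewrite pr_d h //; lia.
Qed.

Lemma above_gt X (x : X) : (forall i, i <= N -> dm_gr X i x = 0) -> x \in above X.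
Proof.
move=> h; apply/asboolP; split=> [i iN|]; first by apply: h; lia.
by exists 0; rewrite raddf0 h.
Qed.

Lemma low_part X (s : seq int) (x : X) (u : int -> X) : uniq s ->
  x = \sum_(i <- s) dm_gr X i x -> (forall i, u i = if i <= N then dm_gr X i x else 0) ->
  x - \sum_(i <- s) u i \in above X.
Proof.
move=> us e uE; apply: above_gt => i iN.
rewrite raddfB {1}e !raddf_sum -big_split big1 // => j _; rewrite /= uE.
case: ifP => [_|jN]; first by rewrite subrr.
by rewrite raddf0 subr0 pr_pr; case: eqP => // ij; rewrite -ij iN in jN.
Qed.

Lemma trunc_quasi_iso X Y (f : dgHom X Y) :
  (forall i, i <= N -> hinj f i /\ hsurj f i) -> quasi_iso (dgTrHom f).
Proof.
move=> fis; apply/quasi_isoE; split=> [q r|r].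
  have [x ->] := tr_classP q; have [y ->] := tr_classP r.
  move=> dx; rewrite tr_class_d [dgTrHom f _]tr_funE => /tr_class_eq /asboolP [h [v dv]].
  have /choice [u uE] : forall i, exists u, dm_d u = if i <= N then dm_gr X i x else 0.
    move=> i; case: ifP => [iN|_]; last by exists 0; exact: raddf0.
    have b : exists z, dm_d z = f (dm_gr X i x).
      have e : dm_gr Y i (dm_d y) - f (dm_gr X i x) = dm_gr Y i (dm_d y - f x).
        by rewrite raddfB /= dgh_deg.
      move: iN; rewrite le_eqVlt => /orP [/eqP iN|iN].
        exists (dm_gr Y (i + 1) y - v); rewrite raddfB /= pr_d addrK dv -iN -e; abel.
      exists (dm_gr Y (i + 1) y); rewrite pr_d addrK.
      by apply/eqP; rewrite -subr_eq0 e h.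
    have [z dz] := b; have [fi _] := fis i iN.
    by apply: fi dz; [exact: homog_pr|exact: trunc_cycle dx i iN].
  have [s [us xE]] := pr_decomp (dm_gr X) x.
  exists (tr_class (\sum_(i <- s) u i)); rewrite tr_class_d; symmetry.
  by apply/tr_class_eq; rewrite raddf_sum; apply: low_part us xE _.
have [w ->] := tr_classP r => dw.
have [s [us wE]] := pr_decomp (dm_gr Y) w.
have /choice [u uE] : forall i, exists u : X * Y, dm_d u.1 = 0 /\
    f u.1 - dm_d u.2 = if i <= N then dm_gr Y i w else 0.
  move=> i; case: ifP => [iN|_]; last by exists (0, 0); rewrite /= !raddf0 addr0.
  have [_ fs] := fis i iN.
  have [|x [y [dx dy]]] := fs (dm_gr Y i w) (homog_pr _ _ _); first exact: trunc_cycle dw i iN.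
  by exists (x, y); rewrite /= dx dy; split=> //; abel.
exists (tr_class (\sum_(i <- s) (u i).1)), (tr_class (\sum_(i <- s) (u i).2)).
rewrite !tr_class_d; split.
  by rewrite raddf_sum big1 ?raddf0 // => i _; case: (uE i).
rewrite [dgTrHom f _]tr_funE -[RHS](tr_classB (f (\sum_(i <- s) (u i).1)) w).
apply/tr_class_eq.
have -> : dm_d (\sum_(i <- s) (u i).2) - (f (\sum_(i <- s) (u i).1) - w) =
    w - \sum_(i <- s) (f (u i).1 - dm_d (u i).2).
  rewrite sumrB -[\sum_(i <- s) f _]raddf_sum -[\sum_(i <- s) dm_d _]raddf_sum /=; abel.
by apply: low_part us wE _ => i; case: (uE i).
Qed.

Lemma trunc_in_quasi_iso X : (forall i, N < i -> hzero X i) -> quasi_iso (dgTrIn X).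
Proof.
move=> h0; apply/quasi_isoE; split=> [x r dx|r].
  have [y ->] := tr_classP r; rewrite tr_class_d => /tr_class_eq /asboolP [h [v dv]].
  have /choice [u uE] : forall i, exists u, dm_d u = dm_gr X i x.
    move=> i; have dxi : dm_d (dm_gr X i x) = 0 by rewrite pr_d dx raddf0.
    have e : dm_gr X i (dm_d y - x) = dm_d (dm_gr X (i + 1) y) - dm_gr X i x.
      by rewrite raddfB /= pr_d addrK.
    have [iN|iN|iN] := ltgtP i N.
    - exists (dm_gr X (i + 1) y); apply/eqP; rewrite -subr_eq0 -e; exact/eqP/h.
    - exact: h0 iN _ (homog_pr _ _ _) dxi.
    - exists (dm_gr X (i + 1) y - v); rewrite raddfB /= dv -iN e; abel.
  have [s [_ ->]] := pr_decomp (dm_gr X) x.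
  by exists (\sum_(i <- s) u i); rewrite raddf_sum; apply: eq_bigr => i _; exact: uE.
have [w ->] := tr_classP r => dw; have [s [us wE]] := pr_decomp (dm_gr X) w.
pose u i := if i <= N then dm_gr X i w else 0.
exists (\sum_(i <- s) u i), (tr_class (0 : X)); split.
  rewrite raddf_sum big1 // => i _; rewrite /u /=; case: ifP => [iN|_].
    exact: trunc_cycle dw i iN.
  exact: raddf0.
rewrite tr_class_d raddf0 -[RHS](tr_classB (\sum_(i <- s) u i) w); apply/tr_class_eq.
by rewrite sub0r opprB; apply: low_part us wE _.
Qed.

Definition dgTruncFunctor : dgFunctor A A.
Proof.
exists dgTrunc dgTrHom => [X Y f g fg q|X q|X Y Z g f q|X Y f qf].
- by have [x ->] := tr_classP q; rewrite [LHS]tr_funE [RHS]tr_funE fg.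
- by have [x ->] := tr_classP q; rewrite [LHS]tr_funE.
- have [x ->] := tr_classP q; rewrite [LHS]tr_funE.
  by rewrite -[RHS]/(dgTrHom g (tr_fun f (tr_class x))) tr_funE [RHS]tr_funE.
- apply: trunc_quasi_iso => i _.
  by split; [exact: quasi_iso_inj|exact: quasi_iso_surj].
Defined.

Lemma trunc_in_natural X Y (f : dgHom X Y) :
  dgComp (dgTrIn Y) f =1 dgComp (dgTrHom f) (dgTrIn X).
Proof. by move=> x; symmetry; exact: tr_funE. Qed.
End Truncation.

(** * Lifting maps from the localisation *)

Section Bracket.
Variables (A : dgRing) (X Y : dgMod A) (k l : int) (h : gHom k X Y).
Hypothesis kl : l = k - 1.
Notation br := (fun x : X => dm_d (h x) - ksign k (h (dm_d x))).
Lemma bracket_linear : linear br.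
Proof.
have brB : zmod_morphism br.
  by move=> x y; rewrite /= !raddfB /= ksignB; abel.
have br_sum (I : Type) (r : seq I) (E : I -> X) :
    br (\sum_(i <- r) E i) = \sum_(i <- r) br (E i).
  elim: r => [|i r IH]; first by rewrite !big_nil !raddf0 ksign0 subr0.
  by rewrite !big_cons -IH /= !raddfD /= ksignD; abel.
apply: (ract_linear brB) => x a; have [s [_ e]] := pr_decomp (dm_gr X) x.
rewrite e ract_sum !br_sum ract_sum; apply: eq_bigr => i _.
have hi := homog_pr (dm_gr X) i x; set y := dm_gr X i x in hi *.
rewrite gh_ract (dm_leibniz _ (gh_homog h hi)) (dm_leibniz _ hi) raddfD /= gh_ract.
rewrite (ksign_add (raddfB h)) /= gh_ract ksignD ksign_ksign [k + i]addrC.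
by rewrite ractBl ract_ksign; abel.
Qed.
Lemma bracket_deg i x : dm_gr Y (i + l) (br x) = br (dm_gr X i x).
Proof.
rewrite raddfB /= (ksign_add (@pr_is_additive _ (dm_gr Y) _)) dm_d_deg.
have -> : i + l + 1 = i + k by rewrite kl; lia.
by rewrite gh_deg kl addrA addrAC gh_deg pr_d.
Qed.
Definition gBracket : gHom l X Y := GHom bracket_linear bracket_deg.
End Bracket.

Section KProjective.
Variable A : dgRing.
Implicit Types X Y Z F V : dgMod A.

Lemma cellular_section F V (t : dgHom V F) : cellular F -> quasi_iso t ->
  exists s : dgHom F V, htp (dgComp t s) (dgId F).
Proof.
move=> cF qt; have aC : acyclic (dgCone t).
  move=> z dz; have [|y dy] := (@fib_acyclic A V F t qt z :
      @dm_d A (dgFib t) z = 0 -> exists y : dgFib t, dm_d y = z).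
    by rewrite -[@dm_d _ (dgFib t) z]/(- @dm_d _ (dgCone t) z) dz oppr0.
  by exists (- y : dgCone t); rewrite raddfN; exact: dy.
have [h hE] := cellular_null (dgConeIn t) cF aC.
have lin0 : linear (fun x => (h x).1) by move=> a x y; rewrite linearP.
have deg0 i x : dm_gr F (i + 1) (h x).1 = (h (dm_gr F i x)).1.
  by rewrite -gh_deg cone_degE.
have lin1 : linear (fun x => (h x).2 : V) by move=> a x y; rewrite linearP.
have deg1 i x : dm_gr V i (h x).2 = (h (dm_gr F i x)).2.
  by rewrite -gh_deg cone_degE /= addrK.
have d1 x : dm_d ((h x).2 : V) = (h (dm_d x)).2.
  have := congr1 snd (hE x); rewrite cone_dE /= => /eqP.
  by rewrite addrC subr_eq0 => /eqP ->.
exists (DGHom lin1 deg1 d1); apply: htp_sym; exists (GHom lin0 deg0) => x /=.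
have := congr1 fst (hE x); rewrite cone_dE /= => e.
rewrite -[X in _ = X - _]e; abel.
Qed.

Lemma cellular_dMor F Y (u : dMor F Y) : cellular F -> exists g, dEq u (dMap g).
Proof.
move=> cF; have [V [t [qt [f e]]]] := fraction u.
have [s ts] := cellular_section cF qt; exists (dgComp f s); rewrite e dEq_map.
apply: dEq_comp => //.
rewrite -[dInv qt]dEq_idr -(htp_dEq ts) dEq_map dEq_assoc dEq_invl.
by rewrite dEq_idl.
Qed.

Lemma cellular_dEq F Y (f g : dgHom F Y) : cellular F -> dEq (dMap f) (dMap g) -> htp f g.
Proof.
move=> cF /dEq_htp [V [t [qt ft]]]; have [s ts] := cellular_section cF qt.
apply: (htp_trans (htp_sym (htp_compl f ts))).
apply: (htp_trans (htp_compr s ft)); exact: (htp_compl g ts).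
Qed.

(* Maps from X to an N-truncated module do not see the difference between X
   and an approximation of X in degrees at most N. *)
Section Extension.
Variables (N : int) (F X Y : dgMod A) (phi : dgHom F X).
Hypothesis phiN : forall i, i <= N -> hinj phi i /\ hsurj phi i.
Hypothesis YN : forall i, N < i -> hzero Y i.
Notation T := (dgTruncFunctor A N).
Notation eta Z := (dgTrIn N Z).

Lemma trunc_nat Z W (u : dMor Z W) :
  dEq (dComp (dMap (eta W)) u) (dComp (fMor T u) (dMap (eta Z))).
Proof.
have := nat_dEq (F := dgIdFunctor A) (G := T) (eta := fun Z => eta Z)
  (@trunc_in_natural A N) u.
by rewrite fMor_id.
Qed.

Lemma extension (g : dMor F Y) : exists u : dMor X Y, dEq (dComp u (dMap phi)) g.
Proof.
have qY : quasi_iso (eta Y) := trunc_in_quasi_iso YN.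
have qp : quasi_iso (fh T phi) := trunc_quasi_iso phiN.
exists (dComp (dInv qY) (dComp (fMor T g) (dComp (dInv qp) (dMap (eta X))))).
rewrite -!dEq_assoc (trunc_nat (dMap phi)) (dEq_assoc (dInv qp)) dEq_invl dEq_idl.
by rewrite -trunc_nat dEq_assoc dEq_invl dEq_idl.
Qed.

Lemma extension_uniq (u v : dMor X Y) :
  dEq (dComp u (dMap phi)) (dComp v (dMap phi)) -> dEq u v.
Proof.
have qY : quasi_iso (eta Y) := trunc_in_quasi_iso YN.
have qp : quasi_iso (fh T phi) := trunc_quasi_iso phiN.
move=> /(fMor_dEq T) e.
have e' : dEq (dComp (fMor T u) (dMap (fh T phi))) (dComp (fMor T v) (dMap (fh T phi))) := e.
have {}e : dEq (fMor T u) (fMor T v).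
  rewrite -[fMor T u]dEq_idr -(dEq_invr qp) dEq_assoc e'.
  by rewrite -dEq_assoc dEq_invr dEq_idr.
rewrite -[u]dEq_idl -(dEq_invl qY) -dEq_assoc trunc_nat e -trunc_nat.
by rewrite dEq_assoc dEq_invl dEq_idl.
Qed.
End Extension.
End KProjective.

Section Lifting.
Variables (A : dgRing) (p : primeIdeal (H0 A)).
Hypothesis H0_noeth : noetherian (H0 A).
Hypothesis H_fg : homology_fin_gen (regMod A).
Implicit Types X Y Z F : dgMod A.
Notation P := (preim_prime p).
Notation RL := (fun X => dgRes (dgLocMod p X)).
Notation iota := (dgIota p).

Lemma iotaB Y (x y : Y) : iota Y (x - y) = iota Y x - iota Y y.
Proof. exact: lfracB. Qed.
Lemma iota_d_comm Y (y : Y) : dm_d (iota Y y) = iota Y (dm_d y).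
Proof. exact: dgh_d. Qed.

Lemma hzero_resloc X i : hzero X i -> hzero (RL X) i.
Proof.
move=> h0 q hq dq; have /loc_homogP [x0 [s0 [hx0 qE]]] := hq.
have {}qE : q = lfrac x0 s0 := qE; rewrite qE in dq *.
have [x [s [-> [dx hx]]]] := lfrac_cycle dq.
by have [y dy] := h0 x (hx i hx0) dx; exists (lfrac y s); rewrite [LHS]lfrac_d dy.
Qed.

Lemma Dfb_approx X Y : Dfb X -> Dfb Y -> exists N F (phi : dgHom F X),
  [/\ cellular F, forall i, i <= N -> hinj phi i /\ hsurj phi i
    & forall i, N < i -> hzero Y i].
Proof.
move=> DX /DfbP [[n hn] _].
have [F [phi [cF hphi]]] := cellular_approx H0_noeth H_fg n%:Z DX.
by exists n%:Z, F, phi; split=> // i ni; apply: hn; lia.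
Qed.

Lemma cellular_lift_hom F Y (g : dgHom F (RL Y)) : cellular F ->
  exists (s : primeC P) (h : dgHom F Y),
    dgComp (iota Y) h =1 dgComp (dgSmul (RL Y) (den s)) g.
Proof.
move=> cF; have [s [h hE]] := cellular_lift (gOf g) cF.
pose b := gBracket h (erefl (0 - 1)).
have [|t tE] := cellular_zero (p := p) (g := b) cF.
  move=> x; rewrite /b -[gBracket _ _ x]/(dm_d (h x) - h (dm_d x)).
  rewrite iotaB -iota_d_comm !hE d_act0; last exact: deg0P.
  by rewrite -[gOf g x]/(g x) dgh_d subrr.
have deg i x : dm_gr Y i (h x ∙ deg0_val (den t)) = h (dm_gr F i x) ∙ deg0_val (den t).
  by rewrite pr_act0; [rewrite -[i in LHS]addr0 gh_deg|exact: deg0P].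
have dd x : dm_d (h x ∙ deg0_val (den t)) = h (dm_d x) ∙ deg0_val (den t).
  rewrite d_act0; last exact: deg0P.
  by apply/eqP; rewrite -subr_eq0 -ractBl; apply/eqP; exact: tE.
exists (primeCM s t), (DGHom (gh_linear (gPost (dgSmul Y (den t)) h)) deg dd) => x.
by rewrite -[LHS]/(iota Y (h x ∙ _)) iota_ract hE ractA.
Qed.

Lemma cellular_htp_lift F Y (g g' : dgHom F Y) : cellular F ->
  htp (dgComp (iota Y) g) (dgComp (iota Y) g') ->
  exists s : primeC P, htp (dgComp (dgSmul Y (den s)) g) (dgComp (dgSmul Y (den s)) g').
Proof.
move=> cF [h hE]; have [s [l lE]] := cellular_lift h cF.
pose b : gHom 0 F Y := gBracket l (erefl (1 - 1)).
pose c : gHom 0 F Y := gOf (dgComp (dgSmul Y (den s)) (dgAdd g (dgOpp g'))).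
have [|t tE] := cellular_zero (p := p) (g := gAdd b (gOpp c)) cF.
  move=> x; rewrite -[gAdd _ _ x]/((dm_d (l x) - - l (dm_d x)) - (g x - g' x) ∙ deg0_val (den s)).
  rewrite opprK iotaB iotaD -iota_d_comm !lE iota_ract iotaB d_act0; last exact: deg0P.
  by rewrite -ractDl hE subrr.
exists (primeCM s t), (gPost (dgSmul Y (den t)) l) => x.
have := tE x.
rewrite -[gAdd _ _ x]/((dm_d (l x) - - l (dm_d x)) - (g x - g' x) ∙ deg0_val (den s)).
rewrite opprK ractBl => /eqP; rewrite subr_eq0 => /eqP e.
transitivity (dm_d (l x ∙ deg0_val (den t)) + l (dm_d x) ∙ deg0_val (den t)); first by [].
by rewrite d_act0 -?ractDl ?e; [rewrite ractA /= -ractBl|exact: deg0P].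
Qed.

Lemma resloc_lift X Y (a : dMor X (RL Y)) : Dfb X -> Dfb Y ->
  exists (s : primeC P) (u : dMor X Y),
    dEq (dComp (dMap (iota Y)) u) (dComp (dMap (dgSmul (RL Y) (den s))) a).
Proof.
move=> DX DY; have [N [F [phi [cF phiN YN]]]] := Dfb_approx DX DY.
have [g gE] := cellular_dMor (dComp a (dMap phi)) cF.
have [s [h hE]] := cellular_lift_hom g cF.
have [u uE] := extension phiN YN (dMap h).
exists s, u; apply: (extension_uniq phiN (fun i iN => hzero_resloc (YN i iN))).
rewrite -!dEq_assoc uE gE -!dEq_map; exact: dEq_ext.
Qed.

Lemma resloc_lift_uniq X Y (u v : dMor X Y) : Dfb X -> Dfb Y ->
  dEq (dComp (dMap (iota Y)) u) (dComp (dMap (iota Y)) v) ->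
  exists s : primeC P,
    dEq (dComp (dMap (dgSmul Y (den s))) u) (dComp (dMap (dgSmul Y (den s))) v).
Proof.
move=> DX DY uv; have [N [F [phi [cF phiN YN]]]] := Dfb_approx DX DY.
have [g gE] := cellular_dMor (dComp u (dMap phi)) cF.
have [g' g'E] := cellular_dMor (dComp v (dMap phi)) cF.
have e : dEq (dMap (dgComp (iota Y) g)) (dMap (dgComp (iota Y) g')).
  by rewrite !dEq_map -gE -g'E !dEq_assoc uv.
have [s hs] := cellular_htp_lift cF (cellular_dEq cF e).
exists s; apply: (extension_uniq phiN YN).
by rewrite -!dEq_assoc gE g'E -!dEq_map; exact: htp_dEq.
Qed.
End Lifting.

(** * Factoring maps through thick subcategories *)

Section Factor.
Variable A : dgRing.
Variable G : dgMod A -> Prop.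
Hypothesis hG : forall Y, G Y -> Dfb Y.
Implicit Types X Y Z T : dgMod A.
Notation thk := (thick (@Dfb A) G).

Definition factors n X Z (a : dMor X Z) : Prop :=
  exists T (u : dMor X T) (v : dMor T Z), thk n T /\ dEq a (dComp v u).

(* Z behaves, as a target of maps from D^f_b(A), like an object of thick^n(G). *)
Definition approachable n Z : Prop :=
  forall X (a : dMor X Z), Dfb X -> factors n a.

Lemma factors_pre n X Y Z (a : dMor Y Z) (c : dMor X Y) :
  factors n a -> factors n (dComp a c).
Proof.
move=> [T [u [v [tT e]]]]; exists T, (dComp u c), v; split=> //.
by rewrite e dEq_assoc.
Qed.
Lemma factors_post n X Y Z (a : dMor X Y) (c : dMor Y Z) :
  factors n a -> factors n (dComp c a).
Proof.
move=> [T [u [v [tT e]]]]; exists T, u, (dComp c v); split=> //.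
by rewrite e dEq_assoc.
Qed.
Lemma factors_dEq n X Z (a b : dMor X Z) : dEq a b -> factors n a -> factors n b.
Proof.
by move=> ab [T [u [v [tT e]]]]; exists T, u, v; split=> //; rewrite -ab.
Qed.

Lemma approachable_retract n Z W : d_retract Z W -> approachable n W -> approachable n Z.
Proof.
move=> [i [r ri]] aW X a DX; apply: (@factors_dEq _ _ _ (dComp r (dComp i a))).
  by rewrite dEq_assoc ri dEq_idl.
by apply: factors_post; exact: aW.
Qed.

Lemma factor_roof X T Z (a : dgHom X Z) (u : dMor X T) (v : dMor T Z) :
  dEq (dMap a) (dComp v u) ->
  exists X' (s : dgHom X' X) T' (r : dgHom T' T) (u' : dgHom X' T') (v' : dgHom T' Z),
  [/\ quasi_iso s, quasi_iso r & htp (dgComp a s) (dgComp v' u')].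
Proof.
have [T' [r [qr [v' ve]]]] := fraction v; have [X1 [s1 [qs1 [u1 ue]]]] := fraction u.
have [X2 [s2 [u2 [qs2 h2]]]] := ore u1 qr => e.
have {}e : dEq (dMap (dgComp a (dgComp s1 s2))) (dMap (dgComp v' u2)).
  rewrite !dEq_map e ve ue -!dEq_assoc (dEq_assoc (dInv qs1)) dEq_invl dEq_idl.
  apply: dEq_comp => //; rewrite -(dEq_map u1 s2) (htp_dEq h2) dEq_map dEq_assoc.
  by rewrite dEq_invl dEq_idl.
have [X3 [s3 [qs3 h3]]] := dEq_htp e.
exists X3, (dgComp (dgComp s1 s2) s3), T', r, (dgComp u2 s3), v'; split=> //.
by do 2?apply: quasi_iso_comp.
Qed.

Section Pushout.
(* K is a replacement of the fibre of u, and T is the homotopy pushout of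
   X <- K -> T1; it sits in a triangle T1 -> T -> T2. *)
Variables (X K T1 T2 : dgMod A) (u : dgHom X T2) (s : dgHom K (dgFib u)).
Variable c : dgHom K T1.
Hypothesis qs : quasi_iso s.
Let k : dgHom K X := dgComp (dgFibOut u) s.
Let m : dgHom K (dgSum X T1) := dgPair k c.
Let T : dgMod A := dgCone m.
Let i1 : dgHom T1 T := dgComp (dgConeIn m) (dgInr X T1).
Let top : gHom 1 K T2 := gPre (gFibTop u) s.

Lemma topE x : dm_d (gOpp top x) + gOpp top (dm_d x) = dgComp u (dgFst X T1) (m x).
Proof.
rewrite -[LHS]/(dm_d (- gFibTop u (s x)) + - gFibTop u (s (dm_d x))).
by rewrite raddfN -opprD -dgh_d fib_topE opprK.
Qed.
Let q : dgHom T T2 := coneRec topE.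

Lemma pushout_cocone x :
  dm_d (gZero T1 T2 1 x) + gZero T1 T2 1 (dm_d x) = q (i1 x).
Proof. by rewrite /= !raddf0. Qed.

Lemma pushout_cone_iso : d_iso (dgCone i1) T2.
Proof.
have [si ss] := (quasi_isoE s).1 qs.
apply: (@quasi_iso_d_iso _ _ _ (coneRec pushout_cocone)).
have qE x t1 z t1' : coneRec pushout_cocone ((((x, t1), z), t1') : dgCone i1) = u x - (s z).1.
  by rewrite /= addr0.
have dE x t1 z t1' : @dm_d A (dgCone i1) (((x, t1), z), t1') =
    (((dm_d (x : X) + k z, dm_d (t1 : T1) + c z + t1'), - dm_d (z : K)), - dm_d (t1' : T1)).
  rewrite cone_dE; congr (_, _); rewrite cone_dE; congr (_, _) => /=; last by rewrite addr0.
  by congr (_, _) => /=; rewrite ?addr0.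
have sE z : s z = ((s z).1, k z) :> dgFib u by rewrite [LHS]surjective_pairing.
apply/quasi_isoE; split=> [[[[x t1] z] t1'] y|w dw].
  rewrite dE qE => -[dx dt1 /eqP]; rewrite oppr_eq0 => /eqP dz dt1' dy.
  have kz : k z = - dm_d (x : X) by apply/eqP; rewrite -addr_eq0 addrC dx.
  have [||z2 dz2] := si z ((y, - x) : dgFib u) => //.
    rewrite fib_dE sE kz /= !raddfN /= dy; congr (_, _); abel.
  have [|ze [th [dze dth]]] := ss (s z2 - ((y, - x) : dgFib u)).
    rewrite raddfB /= dgh_d dz2 fib_dE sE kz /= !raddfN /= dy.
    by apply/eqP; rewrite subr_eq0; apply/eqP; congr (_, _); abel.
  move/(congr1 snd): dth; rewrite fib_dE [s z2]sE [s ze]sE /= => dth.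
  pose k2 := ze - z2.
  have dk2 : dm_d k2 = - z by rewrite raddfB /= dze dz2 sub0r.
  exists (((- th.2, 0), k2), t1 - c k2); rewrite dE; congr (((_, _), _), _).
  - have -> : k k2 = (s ze).2 - (s z2).2 by exact: (raddfB k).
    by rewrite raddfN /= dth; abel.
  - by rewrite raddf0; abel.
  - by rewrite dk2 opprK.
  - have -> : dm_d (t1 - c k2) = dm_d (t1 : T1) + c z.
      by rewrite raddfB /= dgh_d dk2 raddfN opprK.
    by apply/eqP; rewrite eqr_oppLR -addr_eq0; apply/eqP.
have [|ze [th [dze dth]]] := ss ((- w, 0) : dgFib u).
  by rewrite fib_dE /= raddfN /= dw !raddf0 ?addr0 ?raddf0.
have e1 : (s ze).1 = - w - (dm_d (th.1 : T2) + u th.2).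
  by have := congr1 fst dth; rewrite fib_dE /= => ->; abel.
have e2 : k ze = dm_d (th.2 : X).
  by have := congr1 snd dth; rewrite fib_dE /= subr0 => ->.
exists (((- th.2, 0), ze), - c ze), th.1; rewrite dE qE; split.
  congr (((_, _), _), _).
  - by rewrite e2 [dm_d (- _)]raddfN; exact: addNr.
  - by rewrite raddf0; abel.
  - by rewrite dze oppr0.
  - by rewrite [dm_d (- _)]raddfN /= dgh_d dze !raddf0.
rewrite e1 raddfN /=; abel.
Qed.
End Pushout.
End Factor.

Section Extend.
Variable A : dgRing.
Hypothesis H0_noeth : noetherian (H0 A).
Variable G : dgMod A -> Prop.
Hypothesis hG : forall Y, G Y -> Dfb Y.
Implicit Types X Y Z T : dgMod A.
Notation thk := (thick (@Dfb A) G).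

Section FibreMap.
Variables (X T2 Z1 Z : dgMod A) (f : dgHom Z1 Z) (a : dgHom X Z).
Variables (u : dgHom X T2) (v : dgHom T2 (dgCone f)) (H : gHom 1 X (dgCone f)).
Hypothesis HE : forall x,
  dm_d (H x) + H (dm_d x) = dgComp (dgConeIn f) a x - dgComp v u x.

Let H0E x : dm_d ((H x).1 : Z) + f (H x).2 + (H (dm_d x)).1 = a x - (v (u x)).1.
Proof. by have := congr1 fst (HE x); rewrite cone_dE. Qed.
Let H1E x : - dm_d ((H x).2 : Z1) + ((H (dm_d x)).2 : Z1) = - ((v (u x)).2 : Z1).
Proof. by have := congr1 snd (HE x); rewrite cone_dE /= sub0r. Qed.
Let v0E t : dm_d ((v t).1 : Z) + f (v t).2 = (v (dm_d t)).1.
Proof. by rewrite -dgh_d cone_dE. Qed.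
Let v1E t : - dm_d ((v t).2 : Z1) = (v (dm_d t)).2.
Proof. by rewrite -dgh_d cone_dE. Qed.

Let kap (z : dgFib u) : Z1 := ((H z.2).2 : Z1) - ((v z.1).2 : Z1).
Lemma kap_linear : linear kap.
Proof.
apply: ract_linear => [[t x] [t' x']|[t x] b]; rewrite /kap /=.
  by rewrite (raddfB H) (raddfB v) /=; abel.
by rewrite (gh_ract H) (dgh_ract v) ractBl.
Qed.
Lemma kap_deg i z : dm_gr Z1 i (kap z) = kap (dm_gr (dgFib u) i z).
Proof.
rewrite fib_degE /kap /= -gh_deg -dgh_deg !cone_degE /= raddfB /=.
by rewrite addrK.
Qed.
Lemma kap_d z : dm_d (kap z) = kap (dm_d z).
Proof.
case: z => t x; rewrite fib_dE /kap /= raddfB /=.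
rewrite raddfN (raddfD v) /= -v1E.
have -> : dm_d ((H x).2 : Z1) = ((v (u x)).2 : Z1) + ((H (dm_d (x : X))).2 : Z1).
  have aux (V : zmodType) (b b' c : V) : - b + b' = - c -> b = c + b'.
    by move=> e; rewrite -[c]opprK -e; abel.
  exact: aux (H1E x).
abel.
Qed.
Definition fibMap : dgHom (dgFib u) Z1 := DGHom kap_linear kap_deg kap_d.

Let hom (z : dgFib u) : Z := (H z.2).1 - (v z.1).1.
Lemma hom_linear : linear hom.
Proof.
apply: ract_linear => [[t x] [t' x']|[t x] b]; rewrite /hom /=.
  by rewrite (raddfB H) (raddfB v) /=; abel.
by rewrite (gh_ract H) (dgh_ract v) ractBl.
Qed.
Lemma hom_deg i z : dm_gr Z (i + 1) (hom z) = hom (dm_gr (dgFib u) i z).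
Proof. by rewrite fib_degE /hom /= -gh_deg -dgh_deg !cone_degE /= raddfB. Qed.
Lemma fibMap_htp : htp (dgComp a (dgFibOut u)) (dgComp f fibMap).
Proof.
exists (GHom hom_linear hom_deg) => -[t x].
rewrite fib_dE /= /hom /kap /= raddfB /= raddfN (raddfD v) /= -v0E (raddfB f).
have -> : a x = dm_d ((H x).1 : Z) + f (H x).2 + (H (dm_d (x : X))).1 + (v (u x)).1.
  by rewrite H0E; abel.
abel.
Qed.
End FibreMap.

Lemma factors_cone n X T2 Z1 Z (f : dgHom Z1 Z) (a : dgHom X Z) (u : dgHom X T2)
    (v : dgHom T2 (dgCone f)) : Dfb X -> thk n.+1 T2 -> approachable G 1 Z1 ->
  htp (dgComp (dgConeIn f) a) (dgComp v u) -> factors G n.+2 (dMap a).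
Proof.
move=> DX tT2 aZ1 [H HE].
have DT2 : Dfb T2 := thick_Dfb hG tT2.
have DK : Dfb (dgFib u) by apply: Dfb_shift; exact: Dfb_cone.
have [T1 [c0 [d0 [tT1 e0]]]] := aZ1 _ (dMap (fibMap HE)) DK.
have [K [s [T1' [r [c [d [qs qr [h2 h2E]]]]]]]] := factor_roof e0.
have DT1 : Dfb T1 := thick_Dfb hG tT1.
have DT1' : Dfb T1' := (Dfb_quasi_iso qr).2 DT1.
have tT1' : thk 1 T1' := thick_iso tT1 (d_iso_sym (quasi_iso_d_iso qr)) DT1'.
have DK' : Dfb K := (Dfb_quasi_iso qs).2 DK.
pose k := dgComp (dgFibOut u) s; pose m := dgPair k c.
have [h hE] := htp_compr s (fibMap_htp HE).
pose g := dgCopair a (dgOpp (dgComp f d)).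
have gm x : dm_d (gAdd h (gPost f h2) x) + gAdd h (gPost f h2) (dm_d x) = g (m x).
  have /= := hE x; have /= := congr1 f (h2E x); rewrite raddfD raddfB /= => e1 e2.
  rewrite raddfD /= dgh_d.
  transitivity (dm_d (h x) + h (dm_d x) + (f (dm_d (h2 x)) + f (h2 (dm_d x)))); first abel.
  rewrite e1 e2; abel.
have DT : Dfb (dgCone m) by apply: Dfb_cone => //; exact: Dfb_sum.
exists (dgCone m), (dMap (dgComp (dgConeIn m) (dgInl X T1'))), (dMap (coneRec gm)).
split; last first.
  rewrite -dEq_map; apply: dEq_ext => x /=.
  by rewrite !raddf0 !addr0.
apply/(thickSP _ _ hG); split=> //.
exists (dgZero A), T1', (dgCone m), (dgComp (dgConeIn m) (dgInr X T1')); split.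
- exact: Dfb_zero.
- exact: tT1'.
- have i2 := pushout_cone_iso c qs.
  exact: thick_iso tT2 (d_iso_sym i2) (Dfb_iso i2 DT2).
- exact: sum_zero_iso.
Qed.

Lemma approachable_cone n Z1 Z (f : dgHom Z1 Z) : approachable G 1 Z1 ->
  approachable G n.+1 (dgCone f) -> approachable G n.+2 Z.
Proof.
move=> a1 aC X b DX; have [X0 [s0 [qs0 [a be]]]] := fraction b.
apply: (factors_dEq (dEq_sym be)); apply: factors_pre.
have DX0 : Dfb X0 := (Dfb_quasi_iso qs0).2 DX.
have [T [u0 [v0 [tT e]]]] := aC _ (dMap (dgComp (dgConeIn f) a)) DX0.
have [X' [s [T' [r [u [v [qs qr h]]]]]]] := factor_roof e.
have DT' : Dfb T' := (Dfb_quasi_iso qr).2 (thick_Dfb hG tT).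
have tT' : thk n.+1 T' := thick_iso tT (d_iso_sym (quasi_iso_d_iso qr)) DT'.
have DX' : Dfb X' := (Dfb_quasi_iso qs).2 DX0.
have F : factors G n.+2 (dMap (dgComp a s)).
  by apply: (factors_cone DX' tT' a1 (f := f) (u := u) (v := v)); exact: h.
apply: factors_dEq (factors_pre (dInv qs) F).
by rewrite dEq_map -dEq_assoc dEq_invr dEq_idr.
Qed.

Lemma factors_zero X Z (a : dMor X Z) : acyclic Z -> factors G 1 a.
Proof.
move=> aZ; exists (dgZero A), (dMap (dgZ _ _)), (dMap (dgZ _ _)); split.
  exact: thick1_zero.
have q0 : quasi_iso (dgZ Z (dgZero A)).
  by apply: quasi_iso_acyclic => //; exact: acyclic_zero.
rewrite -[a]dEq_idl -(dEq_invl q0) -dEq_assoc.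
have e Y (b : dMor Y (dgZero A)) : dEq b (dMap (dgZ Y (dgZero A))).
  have [V [s [qs [f ->]]]] := fraction b.
  rewrite -[dMap (dgZ Y _)]dEq_idr -(dEq_invr qs) dEq_assoc -dEq_map.
  apply: dEq_comp => //; apply: dEq_ext => x /=; exact: thinmx0.
rewrite (e _ (dComp _ a)) -[dInv q0]dEq_idr.
have -> : dEq (dMap (dgId (dgZero A))) (dComp (dMap (dgZ Z (dgZero A))) (dMap (dgZ (dgZero A) Z))).
  by rewrite (e _ (dMap (dgId _))) (e _ (dComp _ _)).
by rewrite dEq_assoc dEq_invl dEq_idl.
Qed.

End Extend.

Section Pairing.
Variable A : dgRing.
Implicit Types X Y Z W : dgMod A.

Lemma common_roof W X Y (u : dMor W X) (v : dMor W Y) :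
  exists V (s : dgHom V W) (qs : quasi_iso s) (f : dgHom V X) (g : dgHom V Y),
    dEq u (dComp (dMap f) (dInv qs)) /\ dEq v (dComp (dMap g) (dInv qs)).
Proof.
have [V1 [s1 [q1 [f1 ue]]]] := fraction u; have [V2 [s2 [q2 [f2 ve]]]] := fraction v.
have [P [p [q [qp pq]]]] := ore s1 q2.
have qs := quasi_iso_comp q1 qp.
exists P, (dgComp s1 p), qs, (dgComp f1 p), (dgComp f2 q).
have e V (r : dgHom P V) (s : dgHom V W) (k : quasi_iso s) :
    dEq (dMap (dgComp s r)) (dMap (dgComp s1 p)) -> dEq (dInv k) (dComp (dMap r) (dInv qs)).
  move=> h; rewrite -[dInv k]dEq_idr -(dEq_invr qs) -h dEq_map !dEq_assoc dEq_invl.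
  by rewrite dEq_idl.
split.
  by rewrite ue (e _ p s1 q1) // dEq_map dEq_assoc.
rewrite ve (e _ q s2 q2) ?dEq_map ?dEq_assoc //.
by rewrite -!dEq_map; exact/dEq_sym/htp_dEq.
Qed.

Lemma d_pair W X Y (u : dMor W X) (v : dMor W Y) : exists w : dMor W (dgSum X Y),
  dEq (dComp (dMap (dgFst X Y)) w) u /\ dEq (dComp (dMap (dgSnd X Y)) w) v.
Proof.
have [V [s [qs [f [g [ue ve]]]]]] := common_roof u v.
exists (dComp (dMap (dgPair f g)) (dInv qs)); rewrite !dEq_assoc -!dEq_map ue ve.
by split; apply: dEq_comp => //; exact: dEq_ext.
Qed.

Lemma htp_pair W X Y (f g : dgHom W (dgSum X Y)) :
  htp (dgComp (dgFst X Y) f) (dgComp (dgFst X Y) g) ->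
  htp (dgComp (dgSnd X Y) f) (dgComp (dgSnd X Y) g) -> htp f g.
Proof.
move=> [h hE] [l lE].
have lin : linear (fun w => (h w, l w) : dgSum X Y).
  by move=> a x y; congr (_, _); rewrite linearP.
have deg i w : dm_gr (dgSum X Y) (i + 1) (h w, l w) = (h (dm_gr W i w), l (dm_gr W i w)).
  by rewrite sum_degE /= !gh_deg.
exists (GHom lin deg) => w.
transitivity ((dm_d (h w) + h (dm_d w), dm_d (l w) + l (dm_d w)) : dgSum X Y).
  by rewrite sum_dE.
by rewrite hE lE /=; case: (f w) (g w) => [x y] [x' y'].
Qed.

Lemma d_pair_uniq W X Y (u v : dMor W (dgSum X Y)) :
  dEq (dComp (dMap (dgFst X Y)) u) (dComp (dMap (dgFst X Y)) v) ->
  dEq (dComp (dMap (dgSnd X Y)) u) (dComp (dMap (dgSnd X Y)) v) -> dEq u v.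
Proof.
have [V [s [qs [f [g [ue ve]]]]]] := common_roof u v.
have sK Z (k l : dMor V Z) : dEq (dComp k (dInv qs)) (dComp l (dInv qs)) -> dEq k l.
  by move=> e; rewrite -[k]dEq_idr -(dEq_invl qs) dEq_assoc e -dEq_assoc dEq_invl dEq_idr.
rewrite ue ve !dEq_assoc -!dEq_map => /sK /dEq_htp [V1 [t1 [q1 h1]]].
move=> /sK e2; have {}e2 : dEq (dMap (dgComp (dgComp (dgSnd X Y) f) t1))
    (dMap (dgComp (dgComp (dgSnd X Y) g) t1)) by rewrite dEq_map e2 -dEq_map.
have [V2 [t2 [q2 h2]]] := dEq_htp e2.
have hp : htp (dgComp f (dgComp t1 t2)) (dgComp g (dgComp t1 t2)).
  by apply: htp_pair; [exact: (htp_compr t2 h1)|exact: h2].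
have qt := quasi_iso_comp q1 q2.
have fg : dEq (dMap (dgComp f (dgComp t1 t2))) (dMap (dgComp g (dgComp t1 t2))).
  exact: htp_dEq.
apply: dEq_comp => //; rewrite -[dMap f]dEq_idr -(dEq_invr qt) dEq_assoc -dEq_map fg.
by rewrite dEq_map -dEq_assoc dEq_invr dEq_idr.
Qed.

Section ShiftShift.
Variables (n m : int) (X : dgMod A).
Hypothesis nm : m + n = 0.
Lemma unshift_deg i (x : dgShift n (dgShift m X)) :
  dm_gr X i x = dm_gr (dgShift n (dgShift m X)) i x.
Proof.
rewrite [RHS]/(dm_gr X (i - n - m) x); congr (dm_gr X _ x).
by rewrite -[LHS]subr0 -nm; lia.
Qed.
Lemma unshift_d (x : dgShift n (dgShift m X)) :
  @dm_d A X x = @dm_d A (dgShift n (dgShift m X)) x.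
Proof.
have e := ksign_ksign n m (dm_d (x : X)); rewrite addrC nm in e.
exact: esym e.
Qed.
Definition dgUnshift : dgHom (dgShift n (dgShift m X)) X :=
  @DGHom A (dgShift n (dgShift m X)) X id (fun _ _ _ => erefl) unshift_deg unshift_d.
Lemma unshift_quasi_iso : quasi_iso dgUnshift.
Proof. by apply: quasi_iso_bijective => // y; exists y. Qed.
End ShiftShift.
End Pairing.

Section ThickSums.
Variable A : dgRing.
Variable G : dgMod A -> Prop.
Hypothesis hG : forall Y, G Y -> Dfb Y.
Implicit Types X Y Z T : dgMod A.
Notation thk := (thick (@Dfb A) G).

Lemma sum_swap_iso X Y Z T :
  d_iso (dgSum (dgSum X Y) (dgSum Z T)) (dgSum (dgSum X Z) (dgSum Y T)).
Proof.
pose f := dgPair (dgSumHom (dgFst X Y) (dgFst Z T)) (dgSumHom (dgSnd X Y) (dgSnd Z T)).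
pose g := dgPair (dgSumHom (dgFst X Z) (dgFst Y T)) (dgSumHom (dgSnd X Z) (dgSnd Y T)).
by apply: (bij_d_iso (f := f) (g := g)) => -[[x y] [z t]].
Qed.

Lemma cone_sum_iso X X' Y Y' (f : dgHom X Y) (f' : dgHom X' Y') :
  d_iso (dgSum (dgCone f) (dgCone f')) (dgCone (dgSumHom f f')).
Proof.
pose k (z : dgSum (dgCone f) (dgCone f')) : dgCone (dgSumHom f f') :=
  ((z.1.1, z.2.1), (z.1.2, z.2.2)).
have lin : linear k by move=> a [[y x] [y' x']] [[z w] [z' w']].
have deg i z : dm_gr (dgCone (dgSumHom f f')) i (k z) =
    k (dm_gr (dgSum (dgCone f) (dgCone f')) i z) by [].
have dd z : dm_d (k z) = k (dm_d z) by [].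
apply: (@quasi_iso_d_iso _ _ _ (DGHom lin deg dd)); apply: quasi_iso_bijective.
  by move=> [[y x] [y' x']] [-> -> -> ->].
by move=> [[y y'] [x x']]; exists ((y, x), (y', x')).
Qed.

Lemma thick_succ n X : thk n.+1 X -> thk n.+2 X.
Proof.
move=> tX; have DX := thick_Dfb hG tX; apply/(thickSP _ _ hG); split=> //.
exists (dgZero A), (dgZero A), X, (dgZ _ _); split.
- exact: Dfb_zero.
- exact: thick1_zero.
- have i : d_iso X (dgCone (dgZ (dgZero A) X)).
    apply: (@quasi_iso_d_iso _ _ _ (dgConeIn _)); apply: quasi_iso_bijective.
      by move=> x [].
    by move=> [x z]; exists x; congr (_, _); rewrite [z]thinmx0.
  exact: thick_iso tX i (Dfb_iso (d_iso_sym i) DX).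
- exact: sum_zero_iso.
Qed.

Lemma thick_mono n m X : (n <= m)%N -> thk n.+1 X -> thk m.+1 X.
Proof.
by move=> nm tX; rewrite -(subnK nm); elim: (m - n)%N => // k; exact: thick_succ.
Qed.

Lemma thick_sum n X Y : thk n.+1 X -> thk n.+1 Y -> thk n.+1 (dgSum X Y).
Proof.
elim: n X Y => [|n IH] X Y tX tY; first exact: thick1_sum.
have DX := thick_Dfb hG tX; have DY := thick_Dfb hG tY.
move/(thickSP _ _ hG): tX => [_ [X' [X1 [U [f [SX' t1 t2 iU]]]]]].
move/(thickSP _ _ hG): tY => [_ [Y' [Y1 [V [g [SY' s1 s2 iV]]]]]].
apply/(thickSP _ _ hG); split; first exact: Dfb_sum.
exists (dgSum X' Y'), (dgSum X1 Y1), (dgSum U V), (dgSumHom f g); split.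
- exact: Dfb_sum.
- exact: thick1_sum.
- have i := cone_sum_iso f g; apply: (thick_iso (IH _ _ t2 s2) i).
  by apply: Dfb_iso (d_iso_sym i) _; apply: Dfb_sum;
    [exact: (thick_Dfb hG t2)|exact: (thick_Dfb hG s2)].
- exact: d_iso_trans (sum_d_iso iU iV) (sum_swap_iso X X' Y Y').
Qed.

Lemma factors_add n X (a b : deg0 A) : factors G n.+1 (dMap (dgSmul X a)) ->
  factors G n.+1 (dMap (dgSmul X b)) -> factors G n.+1 (dMap (dgSmul X (a + b))).
Proof.
move=> [T1 [u1 [v1 [t1 e1]]]] [T2 [u2 [v2 [t2 e2]]]].
have [w [w1 w2]] := d_pair u1 u2.
have [z [z1 z2]] := d_pair (dComp v1 (dMap (dgFst T1 T2))) (dComp v2 (dMap (dgSnd T1 T2))).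
exists (dgSum T1 T2), w, (dComp (dMap (dgCopair (dgId X) (dgId X))) z); split.
  exact: thick_sum.
have e : dEq (dComp z w) (dMap (dgPair (dgSmul X a) (dgSmul X b))).
  apply: d_pair_uniq.
    rewrite dEq_assoc z1 -dEq_assoc w1 -e1 -dEq_map; exact: dEq_ext.
  rewrite dEq_assoc z2 -dEq_assoc w2 -e2 -dEq_map; exact: dEq_ext.
rewrite -dEq_assoc e -dEq_map; apply: dEq_ext => x.
exact: (ractDr (deg0_val a) (deg0_val b) x).
Qed.

Lemma approachable_sum X Y : approachable G 1 X -> approachable G 1 Y ->
  approachable G 1 (dgSum X Y).
Proof.
move=> aX aY W a DW.
have [T1 [u1 [v1 [t1 e1]]]] := aX _ (dComp (dMap (dgFst X Y)) a) DW.
have [T2 [u2 [v2 [t2 e2]]]] := aY _ (dComp (dMap (dgSnd X Y)) a) DW.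
have [w [w1 w2]] := d_pair u1 u2.
have [z [z1 z2]] := d_pair (dComp v1 (dMap (dgFst T1 T2))) (dComp v2 (dMap (dgSnd T1 T2))).
exists (dgSum T1 T2), w, z; split; first exact: thick1_sum.
apply: d_pair_uniq; first by rewrite dEq_assoc z1 -dEq_assoc w1.
by rewrite dEq_assoc z2 -dEq_assoc w2.
Qed.

Lemma approachable_shift k Z : approachable G 1 Z -> approachable G 1 (dgShift k Z).
Proof.
move=> aZ X a DX; pose Sk := dgShiftFunctor A k; pose Sm := dgShiftFunctor A (- k).
have k0 : - k + k = 0 by rewrite addNr.
have k0' : k + - k = 0 by rewrite subrr.
have nat (U V : dgMod A) (u : dMor U V) :
    dEq (dComp (dMap (dgUnshift V k0)) (fMor Sk (fMor Sm u))) (dComp u (dMap (dgUnshift U k0))).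
  have := nat_dEq (F := dgCompFunctor Sk Sm) (G := dgIdFunctor A)
    (eta := fun X => dgUnshift X k0) (fun _ _ _ _ => erefl) u.
  by rewrite fMor_id fMor_comp.
pose e := dMap (dgUnshift Z k0') : dMor (Sm (Sk Z)) Z.
have [T [u [v [tT uv]]]] := aZ (Sm X) (dComp e (fMor Sm a)) (Dfb_shift (- k) DX).
have qX := unshift_quasi_iso X k0; have qe := unshift_quasi_iso Z k0'.
have F : factors G 1 (fMor Sk (dComp e (fMor Sm a))).
  exists (Sk T), (fMor Sk u), (fMor Sk v); split; first exact: (thick1_shift k tT).
  exact: (fMor_dEq Sk uv).
pose b := dComp (dMap (dgUnshift (Sk Z) k0)) (dInv (fh_quasi_iso Sk qe)).
apply: factors_dEq (factors_pre (dInv qX) (factors_post b F)).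
rewrite /b /= -!dEq_assoc (dEq_assoc (dInv (fh_quasi_iso Sk qe))) dEq_invl dEq_idl.
by rewrite dEq_assoc nat -dEq_assoc dEq_invr dEq_idr.
Qed.
End ThickSums.

(** * The local-to-global principle *)

Lemma maximal_above (R : comPzRingType) (I : R -> Prop) : ideal I -> ~ I 1 ->
  exists m : primeIdeal R, maximalIdeal m /\ forall x, I x -> m x.
Proof.
move=> hI I1.
pose E := {J : R -> Prop | [/\ ideal J, ~ J 1 & forall x, I x -> J x]}.
pose le (J K : E) := `[< forall x, sval J x -> sval K x >].
have hI' : [/\ ideal I, ~ I 1 & forall x, I x -> I x] by [].
have [|||C Ctot|[J [hJ J1 IJ]] Jmax] := @classical_sets.Zorn E le.
- by move=> J; apply/asboolP.
- by move=> K J L /asboolP JK /asboolP KL; apply/asboolP => x /JK /KL.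
- move=> [J PJ] [K PK] /asboolP /= JK /asboolP /= KJ.
  apply: eq_exist; apply/funext => x; apply/propext; split; [exact: JK|exact: KJ].
- pose U x := I x \/ exists J, C J /\ sval J x.
  have [I0 ID IM] := hI.
  have UP : [/\ ideal U, ~ U 1 & forall x, I x -> U x].
    split; [split| |]; first by left.
    + move=> x y [Ix|[J [CJ Jx]]] [Iy|[K [CK Ky]]].
      * by left; exact: ID.
      * right; exists K; split=> //; have [[_ KD _] _ IK] := svalP K.
        by apply: KD => //; exact: IK.
      * right; exists J; split=> //; have [[_ JD _] _ IJ] := svalP J.
        by apply: JD => //; exact: IJ.
      * have [/asboolP JK|/asboolP KJ] := Ctot J K CJ CK; right.
          exists K; split=> //; have [[_ KD _] _ _] := svalP K.
          by apply: KD => //; exact: JK.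
        exists J; split=> //; have [[_ JD _] _ _] := svalP J.
        by apply: JD => //; exact: KJ.
    + move=> r x [Ix|[J [CJ Jx]]]; first by left; exact: IM.
      by right; exists J; split=> //; have [[_ _ JM] _ _] := svalP J; exact: JM.
    + by move=> [//|[J [CJ J1]]]; have [_ + _] := svalP J; apply.
    + by left.
  by exists (exist _ U UP) => J CJ; apply/asboolP => x Jx; right; exists J.
have Jm : maximalIdeal J.
  split=> // K hK K1 JK x Kx.
  have KP : [/\ ideal K, ~ K 1 & forall x, I x -> K x] by split=> // y /IJ /JK.
  have /asboolP JKP : forall y, sval (exist _ _ (And3 hJ J1 IJ) : E) y -> K y by exact: JK.
  have := Jmax (exist _ K KP) JKP; move=> /(congr1 sval) /= e; by rewrite -e.
by exists (PrimeIdeal hJ J1 (maximal_prime Jm)).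
Qed.

Section LocalToGlobal.
Variable A : dgRing.
Hypothesis H0_noeth : noetherian (H0 A).
Hypothesis H_fg : homology_fin_gen (regMod A).
Variable G : dgMod A -> Prop.
Hypothesis hG : forall Y, G Y -> Dfb Y.
Implicit Types X Y Z T : dgMod A.
Notation thk := (thick (@Dfb A) G).

Section AtPrime.
Variable p : primeIdeal (H0 A).
Notation P := (preim_prime p).
Notation B := (dgLoc p).
Notation RL := (fun X => dgRes (dgLocMod p X)).
Notation iota := (dgIota p).
Notation thkp := (thick (@Dfb B) (locFull p G)).

Lemma approachable_gen Y : G Y -> approachable G 1 (RL Y).
Proof.
move=> GY X a DX; have [s [u su]] := resloc_lift H0_noeth H_fg a DX (hG GY).
exists Y, u, (dComp (dMap (dgDiv Y s)) (dMap (iota Y))); split.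
  exact: thick1_gen.
rewrite -dEq_assoc su dEq_assoc -dEq_map.
rewrite (dEq_idE (f := dgComp (dgDiv Y s) (dgSmul (RL Y) (den s)))) ?dEq_idl //.
exact: dgDivK.
Qed.

Lemma approachable_thick1 (Z : dgMod B) :
  thick1 (@Dfb B) (locFull p G) Z -> approachable G 1 (dgRes Z).
Proof.
elim=> {Z} [_ [Y GY ->]||X Y _ aX _ aY|X Y Z _ _ _ aZ ZXY|n X _ aX].
- exact: approachable_gen.
- by move=> X a _; apply: factors_zero => x _; exists 0; rewrite raddf0; symmetry;
    exact: (@thinmx0 _ _ x).
- apply: approachable_retract (d_iso_retract (res_sum_iso X Y)) _.
  exact: approachable_sum.
- apply: approachable_retract aZ; apply: (fMor_retract (dgResFunctor p)).
  exact: d_retract_trans (sum_retract X Y) (d_iso_retract (d_iso_sym ZXY)).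
- apply: approachable_retract (d_iso_retract (res_shift_iso n X)) _.
  exact: approachable_shift.
Qed.

Lemma approachable_thick n (Z : dgMod B) : thkp n.+1 Z -> approachable G n.+1 (dgRes Z).
Proof.
elim: n Z => [|n IH] Z; first exact: approachable_thick1.
move/(thickSP _ _ (locFull_Dfb hG)) => [_ [Z' [X1 [Y [f [_ t1 t2 iY]]]]]].
have aY : approachable G n.+2 (dgRes Y).
  apply: (approachable_cone H0_noeth hG (f := dgResHom f)).
    exact: approachable_thick1.
  exact: approachable_retract (d_iso_retract (d_iso_sym (res_cone_iso f))) (IH _ t2).
apply: approachable_retract aY; apply: (fMor_retract (dgResFunctor p)).
exact: d_retract_trans (sum_retract Z Z') (d_iso_retract (d_iso_sym iY)).
Qed.

Lemma factors_of_local n X : Dfb X -> thkp n.+1 (dgLocMod p X) ->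
  exists s : primeC P, factors G n.+1 (dMap (dgSmul X (den s))).
Proof.
move=> DX tX; have [T [u [v [tT e]]]] := approachable_thick tX (dMap (iota X)) DX.
have DT := thick_Dfb hG tT.
have [s [w sw]] := resloc_lift H0_noeth H_fg v DT DX.
have [|t te] := resloc_lift_uniq (p := p) H0_noeth H_fg (u := dComp w u)
    (v := dMap (dgSmul X (den s))) DX DX.
  rewrite dEq_assoc sw -dEq_assoc -e -!dEq_map; apply: dEq_ext => x.
  by symmetry; exact: (iota_ract p).
exists (primeCM s t), T, u, (dComp (dMap (dgSmul X (den t))) w); split=> //.
rewrite -dEq_assoc te -dEq_map; apply: dEq_ext => x.
by rewrite /= ractA.
Qed.
End AtPrime.

Lemma smul_quasi_iso X (a : deg0 A) : toH0 a = 1 -> quasi_iso (dgSmul X a).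
Proof.
move=> a1; have id_h i (h : homology X i) : hmap (dgSmul X a) h = h.
  have [z ->] := hclassP h; rewrite hmapE -[RHS]scale1r -a1 toH0_scale.
  by congr hclass; exact: val_inj.
by move=> i; split=> [h k|h]; [rewrite !id_h|exists h; rewrite id_h].
Qed.

Lemma thick_of_local X : Dfb X ->
  (forall m : primeIdeal (H0 A), maximalIdeal m ->
    exists n, thick (@Dfb (dgLoc m)) (locFull m G) n (dgLocMod m X)) ->
  exists n, thk n X.
Proof.
move=> DX hm.
pose I r := exists a n, toH0 a = r /\ factors G n.+1 (dMap (dgSmul X a)).
have mono n k Y Z (a : dMor Y Z) : (n <= k)%N -> factors G n.+1 a -> factors G k.+1 a.
  move=> nk [T [u [v [tT e]]]]; exists T, u, v; split=> //; exact: thick_mono tT.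
have hI : ideal I.
  split.
  - exists 0, 0%N; split; first exact: toH00.
    exists (dgZero A), (dMap (dgZ _ _)), (dMap (dgZ _ _)); split; first exact: thick1_zero.
    by rewrite -dEq_map; apply: dEq_ext => x; exact: ract0r.
  - move=> _ _ [a [n [<- fa]]] [b [k [<- fb]]]; exists (a + b), (maxn n k).
    split; first exact: toH0D.
    apply: factors_add => //; first exact: mono (leq_maxl n k) fa.
    exact: mono (leq_maxr n k) fb.
  - move=> r _ [a [n [<- fa]]]; have [b ->] := toH0_surj r.
    exists (b * a), n; split; first exact: toH0M.
    apply: factors_dEq (factors_post (dMap (dgSmul X b)) fa).
    rewrite -dEq_map; apply: dEq_ext => x; rewrite /= ractA; congr (_ ∙ _).
    exact: deg0C.
have [[a [n [a1 [T [u [v [tT e]]]]]]]|nI1] := pselect (I 1).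
  exists n.+1; apply: (thick_retract hG _ tT).
  have qa := smul_quasi_iso X a1.
  exists u, (dComp (dInv qa) v); rewrite -dEq_assoc -e; exact: dEq_invl.
have [m [mmax Im]] := maximal_above hI nI1.
have [n tX] := hm m mmax.
have {}tX : thick (@Dfb (dgLoc m)) (locFull m G) n.-1.+1 (dgLocMod m X).
  case: n tX => // -[DL L0]; apply: thick1_iso (thick1_zero _ _) (d_iso_sym L0) DL.
have [s fs] := factors_of_local DX tX.
have /= ns := @primeC_notin _ _ s.
by case: ns; apply: Im; exists (den s), n.-1.
Qed.
End LocalToGlobal.

Theorem corollary4p10 (A : dgRing)
  (H0_noeth : noetherian (H0 A))
  (H_fg : homology_fin_gen (regMod A))
  (A_noeth : graded_noetherian A)
  (X : dgMod A) (hX : Dfb X)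
  (G : dgMod A -> Prop) (hG : forall Y : dgMod A, G Y -> Dfb Y) :
  (level_finite (@Dfb A) G X <->
   forall p : primeIdeal (H0 A),
     level_finite (@Dfb (dgLoc p)) (locFull p G) (dgLocMod p X)) /\
  (level_finite (@Dfb A) G X <->
   forall m : primeIdeal (H0 A), maximalIdeal m ->
     level_finite (@Dfb (dgLoc m)) (locFull m G) (dgLocMod m X)).
Proof.
have local p : level_finite (@Dfb A) G X ->
    level_finite (@Dfb (dgLoc p)) (locFull p G) (dgLocMod p X).
  by move=> /level_finiteP [n tX]; apply/level_finiteP; exists n; exact: thick_loc.
have global : (forall m : primeIdeal (H0 A), maximalIdeal m ->
    level_finite (@Dfb (dgLoc m)) (locFull m G) (dgLocMod m X)) ->
    level_finite (@Dfb A) G X.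
  move=> h; apply/level_finiteP; apply: thick_of_local => // m mmax.
  exact/level_finiteP/h.
split; split=> [fX|h].
- by move=> p; exact: local.
- by apply: global => m _; exact: h.
- by move=> m _; exact: local.
- exact: global.
Qed.
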